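(* Let $\sigma>0$, let $H:\mathbb{T}^d\times\mathbb{R}^d\to\mathbb{R}$ be $\mathcal{C}^1$ and convex in its second argument, and let $f,U_0:\mathbb{T}^d\times\mathcal{P}(\mathbb{T}^d)\to\mathbb{R}$ be continuous and monotone, i.e. for $g\in\{f,U_0\}$, $\langle g(\cdot,\mu)-g(\cdot,\nu),\mu-\nu\rangle\ge0$ for all $\mu,\nu\in\mathcal{P}(\mathbb{T}^d)$. If $U$ and $V$ are two monotone solutions of the time-dependent master equation (ME), then there is a function $c:[0,\infty)\times\mathcal{P}(\mathbb{T}^d)\to\mathbb{R}$ such that $U(t,x,m)=V(t,x,m)+c(t,m)$ for all $t\ge0$, $x\in\mathbb{T}^d$, $m\in\mathcal{P}(\mathbb{T}^d)$. Moreover, if a monotone solution $U$ exists, then $U(t)$ is monotone for every $t\ge0$: $\langle U(t,\cdot,\mu)-U(t,\cdot,\nu),\mu-\nu\rangle\ge0$ for all $\mu,\nu\in\mathcal{P}(\mathbb{T}^d)$.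
   Context: Notation. $d$ is an integer greater than $1$; $\mathbb{T}^d$ is the $d$-dimensional torus; $\mathcal{M}(\mathbb{T}^d)$ is the set of (finite signed) measures; $\mathcal{P}(\mathbb{T}^d)$ is the set of probability measures with the Monge–Kantorovich (1-Wasserstein) distance $\mathbf{d}_1$. $\|\cdot\|_2$ is the $\mathcal{C}^2(\mathbb{T}^d)$ norm. $\langle g,\mu\rangle=\int g\,d\mu$, $\langle g,\mathrm{div}(bm)\rangle=-\int\nabla g\cdot b\,dm$, $\langle g,\Delta m\rangle=\int\Delta g\,dm$. $D_pH$ is the gradient of $H$ in its second argument. $\mathcal{B}_t$ is the space of functions $U:[0,\infty)\times\mathbb{T}^d\times\mathcal{P}(\mathbb{T}^d)\to\mathbb{R}$ that are globally continuous with $\sup_{m,\,t\in[0,T]}\|U(t,\cdot,m)\|_2<\infty$ for all $T>0$. Master equation (ME), on $(0,\infty)\times\mathbb{T}^d\times\mathcal{P}(\mathbb{T}^d)$: $$\partial_tU-\sigma\Delta U+H(x,\nabla_xU)-\Big\langle\tfrac{\delta U}{\delta m}(x,m,\cdot),\mathrm{div}\big(D_pH(\cdot,\nabla_xU(\cdot,m))m\big)\Big\rangle-\sigma\Big\langle\tfrac{\delta U}{\delta m}(x,m,\cdot),\Delta m\Big\rangle=f(x,m),$$ with $U(0,x,m)=U_0(x,m)$. Monotone solution of (ME): a function $U\in\mathcal{B}_t$ such that $U(0,\cdot,\cdot)=U_0$ and, for any $\mathcal{C}^2$ function $\phi:\mathbb{T}^d\to\mathbb{R}$, any $\nu\in\mathcal{M}(\mathbb{T}^d)$,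 any smooth $\vartheta:[0,\infty)\to\mathbb{R}$, any $T>0$ and any point $(t_0,m_0)\in(0,T]\times\mathcal{P}(\mathbb{T}^d)$ of strict minimum of $(t,m)\mapsto\langle U(t,\cdot,m)-\phi,m-\nu\rangle-\vartheta(t)$ on $[0,T]\times\mathcal{P}(\mathbb{T}^d)$ (strictly smaller than at any other point), $$\frac{d\vartheta}{dt}(t_0)+\langle-\sigma\Delta U+H(\cdot,\nabla_xU),m_0-\nu\rangle\ge\langle f(\cdot,m_0),m_0-\nu\rangle-\langle U-\phi,\mathrm{div}(D_pH(\cdot,\nabla_xU)m_0)\rangle-\sigma\langle\Delta(U-\phi),m_0\rangle,$$ where $U$ stands for $U(t_0,\cdot,m_0)$. *)

(* Defs.v *)
From HB Require Import structures.
From mathcomp Require Import all_boot all_order all_algebra generic_quotient.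
From mathcomp Require Import all_classical all_reals all_analysis.
From mathcomp Require giry.
Set Implicit Arguments.
Unset Strict Implicit.
Unset Printing Implicit Defensive.
Import Order.TTheory GRing.Theory Num.Theory.
Import numFieldNormedType.Exports.
Local Open Scope classical_set_scope.
Local Open Scope quotient_scope.
Local Open Scope ring_scope.

Section Torus.
Variables (R : realType) (d : nat).

Definition int_translate (x y : 'rV[R]_d) : bool :=
  [forall i, (x ord0 i - y ord0 i) \is a Num.int].

Lemma int_translate_equiv : equiv_class_of int_translate.
Proof.
split.
- by move=> x; apply/forallP => i; rewrite subrr rpred0.
- move=> x y; apply/forallP/forallP => h i; by rewrite -opprB rpredN.
- move=> y x z /forallP xy /forallP yz; apply/forallP => i.
  by rewrite -(subrK (y ord0 i) (x ord0 i)) -addrA rpredD.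
Qed.

Canonical int_translate_equiv_rel := EquivRelPack int_translate_equiv.

(* The torus R^d / Z^d with its quotient topology. *)
Definition torus : Type :=
  quotient_topology {eq_quot int_translate_equiv_rel}.
HB.instance Definition _ := Quotient.on torus.
HB.instance Definition _ := Choice.on torus.
HB.instance Definition _ := Topological.on torus.
HB.instance Definition _ := Pointed.on torus.

Definition proj_torus (x : 'rV[R]_d) : torus := \pi_torus x.

Definition enorm (x : 'rV[R]_d) : R := Num.sqrt (\sum_i x ord0 i ^+ 2).

Definition torus_dist (x y : torus) : R :=
  inf [set r | exists a b : 'rV[R]_d,
    [/\ proj_torus a = x, proj_torus b = y & r = enorm (a - b)]].

Definition btorus := g_sigma_algebraType (@open torus).

Definition signed_measure := {charge set btorus -> \bar R}.

Definition prob : Type := probability btorus R.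
HB.instance Definition _ := gen_eqMixin prob.
HB.instance Definition _ := gen_choiceMixin prob.

(* Members of [probability] are functions on all subsets, constrained only on
   the measurable ones; two of them are the same measure when they agree on
   every Borel set, which is weaker than Leibniz equality. *)
Definition same_prob (mu nu : prob) : Prop :=
  giry.measure_eq (mu : measure btorus R) (nu : measure btorus R).

(* Monge-Kantorovich distance d_1, as the supremum over 1-Lipschitz test
   functions; extended-real valued so that no finiteness proof is needed to
   define the metric structure. *)
Definition dprob (mu nu : prob) : \bar R :=
  ereal_sup [set ((\int[mu]_x phi x) - (\int[nu]_x phi x))%:E |
    phi in [set phi : btorus -> R |
      forall x y, `|phi x - phi y| <= torus_dist x y]].

Definition prob_ball (mu : prob) (e : R) (nu : prob) : Prop :=
  (dprob mu nu < e%:E)%E.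

Lemma prob_ball_center mu (e : R) : 0 < e -> prob_ball mu e mu.
Proof.
move=> e0; apply: (@le_lt_trans _ _ 0%E); last by rewrite lte_fin.
by apply: ge_ereal_sup => _ [phi _ <-]; rewrite subrr.
Qed.

Lemma Rintegral_opp (mu : prob) (phi : btorus -> R) :
  \int[mu]_x - phi x = - \int[mu]_x phi x.
Proof.
rewrite /Rintegral integralE [in RHS]integralE.
have -> : (fun x => (- phi x)%:E) = (\- (EFin \o phi))%E by apply/funext.
rewrite funeposN funenegN.
have := @integral_ge0 _ _ _ mu setT (EFin \o phi)^\+%E
  (fun x _ => funepos_ge0 _ x).
have := @integral_ge0 _ _ _ mu setT (EFin \o phi)^\-%E
  (fun x _ => funeneg_ge0 _ x).
set a := integral _ _ _; set b := integral _ _ _.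
by move: a b => [a| |] [b| |] //=; rewrite ?oppr0// opprB.
Qed.

Lemma prob_ball_sym mu nu (e : R) : prob_ball mu e nu -> prob_ball nu e mu.
Proof.
apply: le_lt_trans; apply: ge_ereal_sup => _ [phi lphi <-].
apply: ereal_sup_ubound; exists (fun x => - phi x) => /=.
  by move=> x y; rewrite opprK addrC distrC.
by rewrite !Rintegral_opp opprK addrC.
Qed.

Lemma prob_ball_triangle mu nu rho (e1 e2 : R) :
  prob_ball mu e1 nu -> prob_ball nu e2 rho -> prob_ball mu (e1 + e2) rho.
Proof.
move=> munu nurho; rewrite /prob_ball EFinD.
apply: le_lt_trans (lteD munu nurho).
apply: ge_ereal_sup => _ [phi lphi <-].
rewrite -(subrK (\int[nu]_x phi x) (\int[mu]_x phi x)) -addrA EFinD.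
by apply: leeD; apply: ereal_sup_ubound; exists phi.
Qed.

HB.instance Definition _ := hasNbhs.Build prob (nbhs_ (entourage_ prob_ball)).
HB.instance Definition _ := @Nbhs_isPseudoMetric.Build R prob
  (entourage_ prob_ball) erefl prob_ball
  prob_ball_center prob_ball_sym prob_ball_triangle erefl.

Definition charge_of_prob (mu : prob) : signed_measure :=
  charge_of_finite_measure (mu : probability btorus R).

Definition csub (mu nu : signed_measure) : signed_measure :=
  cadd mu (copp nu).

Definition hahn_pos (nu : signed_measure) : set btorus :=
  sval (cid (Hahn_decomposition nu)).
Definition hahn_neg (nu : signed_measure) : set btorus :=
  sval (cid (svalP (cid (Hahn_decomposition nu)))).
Definition hahn_posneg (nu : signed_measure) :
    hahn_decomposition nu (hahn_pos nu) (hahn_neg nu) :=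
  svalP (cid (svalP (cid (Hahn_decomposition nu)))).

(* The library integrates against measures only: a signed measure is integrated
   through its Jordan decomposition. *)
Definition pairing (g : torus -> R) (nu : signed_measure) : R :=
  \int[jordan_pos (hahn_posneg nu)]_x g x
  - \int[jordan_neg (hahn_posneg nu)]_x g x.

Definition C1 (V : normedModType R) (F : V -> R) : Prop :=
  (forall x, differentiable F x) /\ forall v, continuous ('D_v F).

Definition C2 (V : normedModType R) (F : V -> R) : Prop :=
  C1 F /\ forall v, C1 ('D_v F).

Definition base (i : 'I_d) : 'rV[R]_d := delta_mx ord0 i.

(* A function on the torus is differentiated through its periodic lift to R^d;
   the value at x does not depend on the chosen representative. *)
Definition lift_torus (g : torus -> R) : 'rV[R]_d -> R := g \o proj_torus.

Definition C2_torus (g : torus -> R) : Prop := C2 (lift_torus g).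

Definition partial1 (i : 'I_d) (g : torus -> R) (x : torus) : R :=
  'D_(base i) (lift_torus g) (repr x).

Definition partial2 (i j : 'I_d) (g : torus -> R) (x : torus) : R :=
  'D_(base i) ('D_(base j) (lift_torus g)) (repr x).

Definition grad (g : torus -> R) (x : torus) : 'rV[R]_d :=
  \row_i partial1 i g x.

Definition lap (g : torus -> R) (x : torus) : R := \sum_i partial2 i i g x.

Definition dot (u v : 'rV[R]_d) : R := \sum_i u ord0 i * v ord0 i.

Definition supnorm (g : torus -> R) : \bar R :=
  ereal_sup [set `|g x|%:E | x in [set: torus]].

Definition C2norm (g : torus -> R) : \bar R :=
  (supnorm g + \sum_(i < d) supnorm (partial1 i g)
   + \sum_(i < d) \sum_(j < d) supnorm (partial2 i j g))%E.

Definition hamiltonian_C1 (H : torus -> 'rV[R]_d -> R) : Prop :=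
  C1 (fun z : 'rV[R]_d * 'rV[R]_d => H (proj_torus z.1) z.2).

Definition hamiltonian_convex (H : torus -> 'rV[R]_d -> R) : Prop :=
  forall x, convex_function [set: convex_lmodType 'rV[R]_d] (H x).

Definition DpH (H : torus -> 'rV[R]_d -> R) (x : torus) (p : 'rV[R]_d) :
    'rV[R]_d :=
  \row_i 'D_(base i) (H x) p.

Definition monotone_dual (g : torus -> prob -> R) : Prop :=
  forall mu nu : prob,
    0 <= pairing (fun x => g x mu - g x nu)
           (csub (charge_of_prob mu) (charge_of_prob nu)).

Definition pairing_div (g : torus -> R) (b : torus -> 'rV[R]_d) (m : prob) : R :=
  - pairing (fun x => dot (grad g x) (b x)) (charge_of_prob m).

Definition pairing_lap (g : torus -> R) (m : prob) : R :=
  pairing (lap g) (charge_of_prob m).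

(* Functions of time are defined on all of R; only their restriction to
   [0, +oo[ is used. *)
Definition Bt (U : R -> torus -> prob -> R) : Prop :=
  [/\ {within [set z : R * torus * prob | 0 <= z.1.1],
        continuous (fun z : R * torus * prob => U z.1.1 z.1.2 z.2)},
      forall (t : R) m, 0 <= t -> C2_torus (fun x => U t x m) &
      forall T : R, 0 < T ->
        (ereal_sup [set C2norm (fun x => U z.1 x z.2) |
           z in [set z : R * prob | (0 <= z.1 <= T)%R]] < +oo)%E].

(* Smooth up to the boundary point 0: every derivative on ]0, +oo[ has a
   limit at 0. *)
Definition smooth_halfline (theta : R -> R) : Prop :=
  {within [set t : R | 0 <= t], continuous theta} /\
  forall n, (forall t : R, 0 < t -> derivable (theta^`(n)%classic) t 1) /\
    cvg (theta^`(n)%classic t @[t --> 0^'+]).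

Definition test_functional (U : R -> torus -> prob -> R) (phi : torus -> R)
    (nu : signed_measure) (theta : R -> R) (t : R) (m : prob) : R :=
  pairing (fun x => U t x m - phi x) (csub (charge_of_prob m) nu) - theta t.

Definition strict_min (F : R -> prob -> R) (T t0 : R) (m0 : prob) : Prop :=
  forall (t : R) (m : prob), 0 <= t <= T ->
    ~ (t = t0 /\ same_prob m m0) -> F t0 m0 < F t m.

Definition monotone_solution (sigma : R) (H : torus -> 'rV[R]_d -> R)
    (f U0 : torus -> prob -> R) (U : R -> torus -> prob -> R) : Prop :=
  [/\ Bt U, forall x m, U 0 x m = U0 x m &
    forall (phi : torus -> R) (nu : signed_measure) (theta : R -> R)
        (T t0 : R) (m0 : prob),
      C2_torus phi -> smooth_halfline theta -> 0 < T -> 0 < t0 <= T ->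
      strict_min (test_functional U phi nu theta) T t0 m0 ->
      let u := fun x => U t0 x m0 in
      let w := fun x => u x - phi x in
      let mnu := csub (charge_of_prob m0) nu in
      pairing (fun x => f x m0) mnu
        - pairing_div w (fun x => DpH H x (grad u x)) m0
        - sigma * pairing_lap w m0
      <= theta^`()%classic t0
         + pairing (fun x => - sigma * lap u x + H x (grad u x)) mnu].

End Torus.

(* Main.v *)
(** Doubling of variables.  For two solutions [U] and [V] one shows
    [<U(t,.,mu) - V(t,.,nu), mu - nu> >= 0].  Otherwise one minimises
    [<U(t,.,mu) - V(s,.,nu), mu - nu> + g (t + s) + k (t - s)^2
     - e (energy mu + energy nu)]
    over the compact set [[0,T]^2 x P^2], where [energy mu] is a weighted sum of
    the squared Fourier coefficients of [mu].  Since
    [energy mu - 2 <psi, mu> + energy mu0], with [psi] the [C^2] function whose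
    coefficients are the weighted ones of [mu0], is the squared distance of [mu]
    to [mu0] in a norm separating measures, the concave energy term turns the
    minimum into a strict minimum at the price of adding [2 e psi] to the test
    function, so no variational principle is needed.  The two viscosity
    inequalities at the minimum add up, by convexity of [H] and monotonicity of
    [f], to [g = O(e)]; a minimum at time zero contradicts monotonicity of [U0].
    Independence of [U - V] from [x] follows by comparing [m] with
    [(1 - e) m + e delta_x] and letting [e] go to zero. *)

Require Import Defs.
From HB Require Import structures.
From mathcomp Require Import all_boot all_order all_algebra generic_quotient.
From mathcomp Require Import all_classical all_reals all_analysis.
From mathcomp Require Import measurable_realfun.
From mathcomp Require Import ring lra zify.
Set Implicit Arguments.
Unset Strict Implicit.
Unset Printing Implicit Defensive.
Import Order.TTheory GRing.Theory Num.Theory.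
Import numFieldNormedType.Exports.
Local Open Scope classical_set_scope.
Local Open Scope quotient_scope.
Local Open Scope ring_scope.

(** Two obstacles shape the proof. The inequality is available only at strict minima, where measures
    are told apart up to [same_prob]; the perturbation must therefore separate Borel measures, and
    must itself be an admissible [C^2] test function, which dictates the decay of its coefficients.
    A minimum must also exist, so the measures have to be compact for [d_1]; the limit of an
    ultrafilter is constructed as the image of Lebesgue measure on [0, 1[ under a limit of quantile
    maps. The order of the constants matters. The bound on [DpH] along the gradients of both
    solutions and the bounds on the derivatives of [psi] hold uniformly in the minimum point, so [e]
    is chosen against [g] before any minimum is taken. The penalty [k] may be as large as desired,
    because its two time derivatives are opposite and cancel in the sum. At the final time the
    inequality is part of the definition, so the linear drift [g (t + s)] suffices. *)

Lemma cvg_sumr (R : realType) (V : normedModType R) (I X : Type) (r : seq I) (F : set_system X)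
    {FF : Filter F} (f : I -> X -> V) (l : I -> V) :
  (forall i, f i x @[x --> F] --> l i) ->
  \sum_(i <- r) f i x @[x --> F] --> \sum_(i <- r) l i.
Proof.
move=> fl; elim: r => [|i r ih].
  by rewrite big_nil; under eq_fun do rewrite big_nil; exact: cvg_cst.
by rewrite big_cons; under eq_fun do rewrite big_cons; exact: cvgD.
Qed.

(** * Distance, representatives and compactness of the torus *)

Section TorusGeometry.
Variables (R : realType) (d : nat).
Local Notation T := (torus R d).
Local Notation V := 'rV[R]_d.
Implicit Types (x y : T) (a b u v : V).

Lemma proj_repr x : proj_torus (repr x) = x.
Proof. exact: reprK. Qed.

Lemma proj_torusP a b :
  proj_torus a = proj_torus b <-> forall i, a ord0 i - b ord0 i \is a Num.int.
Proof.
have E : proj_torus a = proj_torus b <-> int_translate a b.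
  by split=> [h|h]; apply/(@eqquotP _ _ {eq_quot @int_translate_equiv_rel R d}).
by rewrite E; split=> [/forallP|/forallP].
Qed.

Lemma proj_torus_continuous : continuous (@proj_torus R d).
Proof. exact: pi_continuous. Qed.

Lemma continuous_torusP (Z : topologicalType) (g : T -> Z) :
  continuous (g \o @proj_torus R d) -> continuous g.
Proof. by move=> cg; apply/quotient_continuous. Qed.

Lemma enorm_ge0 u : 0 <= enorm u.
Proof. exact: sqrtr_ge0. Qed.

Lemma coord_le_enorm u i : `|u ord0 i| <= enorm u.
Proof.
rewrite -sqrtr_sqr ler_wsqrtr// (bigD1 i)//= lerDl.
by apply: sumr_ge0 => j _; exact: sqr_ge0.
Qed.

Lemma sqr_sum_le (I : Type) (r : seq I) (F : I -> R) :
  (forall i, 0 <= F i) -> \sum_(i <- r) F i ^+ 2 <= (\sum_(i <- r) F i) ^+ 2.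
Proof.
move=> F0; elim: r => [|i r ih]; first by rewrite !big_nil expr0n.
rewrite !big_cons sqrrD -addrA lerD2l (le_trans ih)// lerDr mulrn_wge0//.
by apply: mulr_ge0 => //; exact: sumr_ge0.
Qed.

Lemma enorm_le_sum u : enorm u <= \sum_i `|u ord0 i|.
Proof.
rewrite /enorm -[leRHS]ger0_norm; last by apply: sumr_ge0.
rewrite -sqrtr_sqr ler_wsqrtr//.
under eq_bigr do rewrite -real_normK ?num_real//.
exact: sqr_sum_le.
Qed.

Lemma torus_dist_has_inf x y : has_inf [set r | exists a b : V,
    [/\ proj_torus a = x, proj_torus b = y & r = enorm (a - b)]].
Proof.
split; last by exists 0 => _ [a [b [_ _ ->]]]; exact: enorm_ge0.
by exists (enorm (repr x - repr y)), (repr x), (repr y); rewrite !proj_repr.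
Qed.

Lemma torus_dist_le a b : torus_dist (proj_torus a) (proj_torus b) <= enorm (a - b).
Proof.
apply: ge_inf; last by exists a, b.
by have [] := torus_dist_has_inf (proj_torus a) (proj_torus b).
Qed.

Lemma torus_dist_ge0 x y : 0 <= torus_dist x y.
Proof.
apply: lb_le_inf; first by have [] := torus_dist_has_inf x y.
by move=> _ [a [b [_ _ ->]]]; exact: enorm_ge0.
Qed.

(** The infimum runs over pairs of representatives; translating a pair by the integer vector
    [a - a'] lets its first member be prescribed. *)
Lemma torus_dist_lt a y (r : R) : torus_dist (proj_torus a) y < r ->
  exists2 b, proj_torus b = y & enorm (a - b) < r.
Proof.
move=> /(inf_lt (torus_dist_has_inf _ _).1)[_ [a' [b [aa' <- ->]] ltr]].
move/proj_torusP : aa' => aa'.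
exists (b + (a - a')); last first.
  by rewrite opprD opprB addrCA [a + _]addrC subrK addrC.
apply/proj_torusP => i; rewrite !mxE addrAC subrr add0r.
by rewrite -opprB rpredN.
Qed.

Lemma torus_distC x y : torus_dist x y = torus_dist y x.
Proof.
rewrite /torus_dist; congr inf; apply/seteqP; split => r [a [b [ax by_ ->]]];
  exists b, a; split=> //; rewrite /enorm; congr Num.sqrt;
  by apply: eq_bigr => i _; rewrite !mxE -sqrrN opprB.
Qed.

Lemma lipschitz_torusP (g : T -> R) (L : R) : 0 <= L ->
  (forall a b, `|g (proj_torus a) - g (proj_torus b)| <= L * enorm (a - b)) ->
  forall x y, `|g x - g y| <= L * torus_dist x y.
Proof.
move=> L0 gL x y; apply/ler_addgt0Pr => e e0.
(* The denominator is [L + 1] because [L] may vanish. *)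
have e1 : 0 < e / (L + 1) by rewrite divr_gt0// ltr_wpDl.
have := @torus_dist_lt (repr x) y (torus_dist x y + e / (L + 1)).
rewrite proj_repr ltrDl => /(_ e1)[b <- /ltW xb].
rewrite -{1}(proj_repr x); apply: (le_trans (gL _ _)).
apply: (le_trans (ler_wpM2l L0 xb)); rewrite mulrDr lerD2l.
rewrite mulrCA ler_piMr ?(ltW e0)// ler_pdivrMr ?mul1r ?lerDl//.
by rewrite ltr_wpDl.
Qed.

Lemma enorm_continuous : continuous (@enorm R d).
Proof.
move=> u; apply: (@continuous_comp _ _ _ (fun u : V => \sum_i u ord0 i ^+ 2) Num.sqrt).
  apply: (@cvg_sumr _ _ _ _ _ (nbhs u)) => i.
  apply: cvgM; exact: coord_continuous.
exact: sqrt_continuous.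
Qed.

Lemma lipschitz_continuous (g : T -> R) (L : R) :
  (forall x y, `|g x - g y| <= L * torus_dist x y) -> continuous g.
Proof.
move=> gL; apply: continuous_torusP => a; apply/(@cvgrPdist_le _ _ _ (nbhs a) _) => /= e e0.
have c0 : (fun b : V => `|L| * enorm (a - b)) b @[b --> a] --> (0 : R).
  have -> : (0 : R) = `|L| * enorm (a - a).
    by rewrite subrr /enorm big1 ?sqrtr0 ?mulr0// => i _; rewrite mxE expr0n.
  apply: (@cvgM _ _ (nbhs a)); first exact: (@cst_continuous V).
  apply: (@continuous_comp _ _ _ (fun b : V => a - b)); last exact: enorm_continuous.
  by apply: (@cvgB _ _ _ (nbhs a)); [exact: (@cst_continuous V)|exact: cvg_id].
have /(@cvgrPdist_le _ _ _ (nbhs a) _)/(_ e e0) := c0; apply: filterS => b /=.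
rewrite sub0r normrN => h; apply: (le_trans (gL _ _)).
apply: (le_trans _ h); rewrite (le_trans _ (ler_norm _))//.
apply: (@le_trans _ _ (`|L| * torus_dist (proj_torus a) (proj_torus b))).
  by rewrite ler_wpM2r ?torus_dist_ge0// ler_norm.
by rewrite ler_wpM2l// torus_dist_le.
Qed.

Definition frac_part (r : R) : R := r - (Num.floor r)%:~R.

Lemma frac_part_itv r : 0 <= frac_part r < 1.
Proof.
have /andP[h1 h2] := floor_itv r; rewrite /frac_part subr_ge0 h1 ltrBlDr.
by rewrite -[X in _ < X + _]/(1%:~R) -intrD addrC.
Qed.

Lemma proj_frac_part a : proj_torus (\row_i frac_part (a ord0 i)) = proj_torus a.
Proof.
apply/proj_torusP => i; rewrite mxE /frac_part addrAC subrr add0r rpredN.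
exact: intr_int.
Qed.

Lemma torus_dist_bound x y : torus_dist x y <= d%:R.
Proof.
rewrite -(proj_repr x) -(proj_repr y) -(proj_frac_part (repr x)) -(proj_frac_part (repr y)).
apply: (le_trans (torus_dist_le _ _)); apply: (le_trans (enorm_le_sum _)).
rewrite -[leRHS](_ : \sum_(i < d) 1 = _); last by rewrite sumr_const card_ord.
apply: ler_sum => i _; rewrite !mxE.
have /andP[? ?] := frac_part_itv (repr x ord0 i).
have /andP[? ?] := frac_part_itv (repr y ord0 i).
by rewrite ler_norml; apply/andP; split; lra.
Qed.

Lemma torus_compact : compact [set: T].
Proof.
have -> : [set: T] = @proj_torus R d @` [set v : V | forall i, v ord0 i \in `[0, 1]].
  apply/seteqP; split => // x _; exists (\row_i frac_part (repr x ord0 i)); last first.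
    by rewrite proj_frac_part proj_repr.
  move=> i /=; rewrite mxE in_itv/=; have /andP[-> /ltW ->] := frac_part_itv (repr x ord0 i).
  by [].
apply: continuous_compact; first by apply: continuous_subspaceT; exact: proj_torus_continuous.
have := @rV_compact R d (fun=> `[0, 1]%classic) (fun=> @segment_compact _ _ _).
by congr compact; apply/seteqP; split => v h i; have := h i.
Qed.

(** The torus carries its quotient topology and no declared metric; this lemma and [torus_ball_open]
    are the two halves of its comparison with [torus_dist]. *)
Lemma open_torus_ball (O : set T) x : open O -> O x ->
  exists2 r : R, 0 < r & forall y, torus_dist x y < r -> O y.
Proof.
move=> oO Ox; have oP : open (@proj_torus R d @^-1` O).
  by move/continuousP : proj_torus_continuous; exact.
have : nbhs (repr x) (@proj_torus R d @^-1` O).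
  by apply: open_nbhs_nbhs; split => //=; rewrite proj_repr.
move=> /nbhs_ballP[r /= r0 rO]; exists r => // y.
rewrite -{1}(proj_repr x) => /torus_dist_lt[b <- abr].
apply: rO; split => [|i j]; first exact: le_lt_trans (enorm_ge0 _) abr.
rewrite ord1 /ball/= (le_lt_trans _ abr)//.
by have := coord_le_enorm (repr x - b) j; rewrite !mxE.
Qed.

End TorusGeometry.

(** Boundedness in place of integrability makes the class independent of the measure and stable
    under products. *)
Definition bmeas d (T : measurableType d) (R : realType) (g : T -> R) : Prop :=
  measurable_fun [set: T] g /\ exists M : R, forall x, `|g x| <= M.

Lemma prob_setT_lty d (T : measurableType d) (R : realType) (m : probability T R) :
  (m setT < +oo)%E.
Proof. by rewrite probability_setT ltry. Qed.

(** * Integration of bounded measurable functions *)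

Section BoundedMeasurable.
Context d (T : measurableType d) (R : realType).
Implicit Types (g h : T -> R).

Lemma bmeas_integrable (m : {measure set T -> \bar R}) g :
  (m setT < +oo)%E -> bmeas g -> m.-integrable setT (EFin \o g).
Proof.
move=> moo [mg [M gM]]; apply: measurable_bounded_integrable => //.
exists M; split; first exact: num_real.
by move=> x Mx y _ /=; rewrite (le_trans (gM y))// ltW.
Qed.

Lemma bmeas_cst (r : R) : bmeas (fun _ : T => r).
Proof. by split; [exact: measurable_cst|exists `|r|]. Qed.

Lemma bmeasD g h : bmeas g -> bmeas h -> bmeas (fun x => g x + h x).
Proof.
move=> [mg [M gM]] [mh [N hN]]; split; first exact: measurable_funD.
by exists (M + N) => x; rewrite (le_trans (ler_normD _ _))// lerD.
Qed.

Lemma bmeasM g h : bmeas g -> bmeas h -> bmeas (fun x => g x * h x).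
Proof.
move=> [mg [M gM]] [mh [N hN]]; split; first exact: measurable_funM.
by exists (M * N) => x; rewrite normrM ler_pM.
Qed.

Lemma bmeasZ (r : R) g : bmeas g -> bmeas (fun x => r * g x).
Proof. by move=> bg; apply: bmeasM => //; exact: bmeas_cst. Qed.

Lemma bmeasN g : bmeas g -> bmeas (fun x => - g x).
Proof. by move=> /(bmeasZ (-1)); under eq_fun do rewrite mulN1r. Qed.

Lemma bmeasB g h : bmeas g -> bmeas h -> bmeas (fun x => g x - h x).
Proof. by move=> bg bh; apply: bmeasD => //; exact: bmeasN. Qed.

Lemma bmeas_sum (I : Type) (r : seq I) (F : I -> T -> R) :
  (forall i, bmeas (F i)) -> bmeas (fun x => \sum_(i <- r) F i x).
Proof.
move=> bF; elim: r => [|i r ih].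
  by under eq_fun do rewrite big_nil; exact: bmeas_cst.
by under eq_fun do rewrite big_cons; exact: bmeasD.
Qed.

Variable m : probability T R.

Let moo := prob_setT_lty m.

Lemma int_cst (r : R) : \int[m]_x r = r.
Proof.
by rewrite Rintegral_cst// [X in fine X](_ : _ = 1%E) ?mulr1//; exact: probability_setT.
Qed.

Lemma intD g h : bmeas g -> bmeas h ->
  \int[m]_x (g x + h x) = \int[m]_x g x + \int[m]_x h x.
Proof. by move=> bg bh; rewrite RintegralD//; exact: bmeas_integrable. Qed.

Lemma intB g h : bmeas g -> bmeas h ->
  \int[m]_x (g x - h x) = \int[m]_x g x - \int[m]_x h x.
Proof. by move=> bg bh; rewrite RintegralB//; exact: bmeas_integrable. Qed.

Lemma intZ (r : R) g : bmeas g -> \int[m]_x (r * g x) = r * \int[m]_x g x.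
Proof. by move=> bg; rewrite RintegralZl//; exact: bmeas_integrable. Qed.

Lemma int_le g h : bmeas g -> bmeas h -> (forall x, g x <= h x) ->
  \int[m]_x g x <= \int[m]_x h x.
Proof. by move=> bg bh gh; apply: le_Rintegral => //; exact: bmeas_integrable. Qed.

Lemma int_norm_le (M : R) g : bmeas g -> (forall x, `|g x| <= M) ->
  `|\int[m]_x g x| <= M.
Proof.
move=> bg gM; rewrite ler_norml -{1}(int_cst (- M)) -{2}(int_cst M).
by apply/andP; split; apply: int_le => //; try exact: bmeas_cst;
  move=> x; have := gM x; rewrite ler_norml => /andP[].
Qed.

Lemma int_sum (I : Type) (r : seq I) (F : I -> T -> R) :
  (forall i, bmeas (F i)) ->
  \int[m]_x \sum_(i <- r) F i x = \sum_(i <- r) \int[m]_x F i x.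
Proof.
move=> bF; elim: r => [|i r ih].
  by rewrite big_nil; under eq_Rintegral do rewrite big_nil; exact: int_cst.
under eq_Rintegral do rewrite big_cons.
by rewrite big_cons intD// ?ih//; exact: bmeas_sum.
Qed.

Lemma int_dist_le (e : R) g h : bmeas g -> bmeas h ->
  (forall x, `|g x - h x| <= e) -> `|\int[m]_x g x - \int[m]_x h x| <= e.
Proof. by move=> bg bh ghe; rewrite -intB//; apply: int_norm_le => //; exact: bmeasB. Qed.

End BoundedMeasurable.

Lemma jordan_diff d (T : measurableType d) (R : realType)
    (nu : {charge set T -> \bar R}) (P N : set T)
    (PN : hahn_decomposition nu P N) (A : set T) : measurable A ->
  (nu A = jordan_pos PN A - jordan_neg PN A)%E.
Proof.
move=> mA; rewrite (jordan_decomp PN mA) /cadd.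
congr (_ + _)%E.
exact: mulN1e.
Qed.

(** * Integration against signed measures on the torus *)

Section TorusIntegral.
Variables (R : realType) (d : nat).
Local Notation T := (torus R d).
Local Notation P := (prob R d).
Implicit Types (g : T -> R) (mu nu : P).

Lemma continuous_bmeas g : continuous g -> bmeas (g : btorus R d -> R).
Proof.
move=> cg; split.
  move=> mD; apply: (measurability _ (RGenOpens.measurableE R)) => //.
  move=> _ [_ [a [b ->]] <-]; rewrite setTI.
  apply: sub_sigma_algebra; move/continuousP : cg; apply.
  exact: interval_open.
have [ | |c _ cM] := @compact_EVT_max T R (fun x => `|g x|) setT _ (@torus_compact R d).
- by exists (proj_torus 0).
- apply: continuous_subspaceT => x.
  by apply: (continuous_comp (cg x)); exact: norm_continuous.
- by exists `|g c| => x; apply: cM; rewrite inE.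
Qed.

(** The Jordan decomposition may be replaced by any other difference of finite measures:
    [jp - jn = m1 - m2] rearranges into an equality of positive measures [jp + m2 = m1 + jn], where
    integrals are additive. *)
Lemma pairing_signed (nu : signed_measure R d)
    (m1 m2 : {finite_measure set (btorus R d) -> \bar R}) g :
  (forall A, measurable A -> nu A = m1 A - m2 A)%E -> bmeas (g : btorus R d -> R) ->
  pairing g nu = \int[m1]_x g x - \int[m2]_x g x.
Proof.
move=> nuE bg; rewrite /pairing.
set jp := jordan_pos _; set jn := jordan_neg _.
have foo (m : {finite_measure set (btorus R d) -> \bar R}) : (m setT < +oo)%E.
  by rewrite ltey_eq fin_num_measure.
have fI (m : {finite_measure set (btorus R d) -> \bar R}) :
    m.-integrable setT (EFin \o g).
  by apply: (bmeas_integrable (foo m) bg).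
have ffin (m : {finite_measure set (btorus R d) -> \bar R}) :
    (\int[m]_x (g x)%:E)%E \is a fin_num.
  by apply: integrable_fin_num => //; exact: fI.
have jmE : (\int[measure_add jp m2]_x (g x)%:E = \int[measure_add m1 jn]_x (g x)%:E)%E.
  apply: eq_measure_integral => A mA _.
  transitivity (jp A + m2 A)%E; first exact: measure_addE.
  transitivity (m1 A + jn A)%E; last exact/esym/measure_addE.
  have jE : (m1 A - m2 A = jp A - jn A)%E.
    by rewrite -(nuE _ mA) (jordan_diff (hahn_posneg nu) mA).
  have fE (m : {finite_measure set (btorus R d) -> \bar R}) : exists r, m A = r%:E.
    by exists (fine (m A)); rewrite fineK// fin_num_measure.
  have [p jpE] : exists r, jp A = r%:E := fE jp.
  have [q jnE] : exists r, jn A = r%:E := fE jn.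
  have [[r m1E] [s m2E]] := (fE m1, fE m2).
  move: jE; rewrite jpE jnE m1E m2E -!EFinB -!EFinD => -[h].
  by congr EFin; lra.
have jmE' : \int[jp]_x g x + \int[m2]_x g x = \int[m1]_x g x + \int[jn]_x g x.
  rewrite -(fineD (ffin jp) (ffin m2)) -(fineD (ffin m1) (ffin jn)); congr fine.
  have addE (p q : {finite_measure set (btorus R d) -> \bar R}) :=
    @integral_measure_add _ _ _ p q setT measurableT _ (fI p) (fI q).
  by rewrite -(addE jp m2) -(addE m1 jn).
apply/eqP; rewrite subr_eq addrAC [_ + \int[jn]_x _]addrC -subr_eq opprK jmE'.
by rewrite addrC.
Qed.

Lemma pairing_prob g mu : bmeas (g : btorus R d -> R) ->
  pairing g (charge_of_prob mu) = \int[mu]_x g x.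
Proof.
move=> bg; rewrite (@pairing_signed _ mu mzero)//; last first.
  by move=> A mA; rewrite /= sube0.
by rewrite /Rintegral integral_measure_zero subr0.
Qed.

Lemma pairing_sub g mu nu : bmeas (g : btorus R d -> R) ->
  pairing g (csub (charge_of_prob mu) (charge_of_prob nu)) =
  \int[mu]_x g x - \int[nu]_x g x.
Proof. by move=> bg; apply: pairing_signed. Qed.

End TorusIntegral.

(** * Trigonometric polynomials separate measures *)

Section Characters.
Variables (R : realType) (d : nat).
Local Notation T := (torus R d).
Local Notation V := 'rV[R]_d.
Local Notation freq := {ffun 'I_d -> int}.
Implicit Types (k l : freq) (a b : V) (x : T).

Definition freq_vec k : V := \row_i (2 * pi * (k i)%:~R).

(** A cosine with a free phase replaces the complex exponential: products of two such functions and
    derivatives of one stay in the family, with real coefficients. *)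
Definition character k (th : R) (x : T) : R := cos (dot (freq_vec k) (repr x) + th).

Lemma dotDr (u a b : V) : dot u (a + b) = dot u a + dot u b.
Proof. by rewrite /dot -big_split/=; apply: eq_bigr => i _; rewrite mxE mulrDr. Qed.

Lemma dotDl (u v a : V) : dot (u + v) a = dot u a + dot v a.
Proof. by rewrite /dot -big_split/=; apply: eq_bigr => i _; rewrite mxE mulrDl. Qed.

Lemma dotBl (u v a : V) : dot (u - v) a = dot u a - dot v a.
Proof.
rewrite dotDl; congr (_ + _); rewrite /dot -sumrN.
by apply: eq_bigr => i _; rewrite mxE mulNr.
Qed.

Lemma dotBr (u a b : V) : dot u (a - b) = dot u a - dot u b.
Proof.
rewrite dotDr; congr (_ + _); rewrite /dot -sumrN.
by apply: eq_bigr => i _; rewrite mxE mulrN.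
Qed.

Lemma freq_vecD k l : freq_vec (k + l) = freq_vec k + freq_vec l.
Proof. by apply/rowP => i; rewrite !mxE ffunE intrD mulrDr. Qed.

Lemma freq_vecB k l : freq_vec (k - l) = freq_vec k - freq_vec l.
Proof. by apply/rowP => i; rewrite !mxE !ffunE intrB mulrBr. Qed.

Lemma cos_int_shift (y : R) (n : int) : cos (y + 2 * pi * n%:~R) = cos y.
Proof.
case: n => n.
  have -> : 2 * pi * (Posz n)%:~R = (pi *+ 2) *+ n :> R.
    by rewrite -[(Posz n)%:~R]/(n%:R) -[RHS]mulr_natr -[pi *+ 2]mulr_natl.
  by rewrite (periodicn (@cosD2pi R)).
have nE : 2 * pi * n.+1%:R = (pi *+ 2) *+ n.+1 :> R.
  by rewrite -[RHS]mulr_natr -[pi *+ 2]mulr_natl.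
have -> : y + 2 * pi * (Negz n)%:~R = y - (pi *+ 2) *+ n.+1.
  by rewrite NegzE mulrNz mulrN -nE.
by rewrite -[in RHS](subrK ((pi *+ 2) *+ n.+1) y) (periodicn (@cosD2pi R)).
Qed.

Lemma characterE k th a : character k th (proj_torus a) = cos (dot (freq_vec k) a + th).
Proof.
rewrite /character.
have /proj_torusP ra : proj_torus (repr (proj_torus a)) = proj_torus a.
  exact: proj_repr.
have [n nE] : exists n : int,
    dot (freq_vec k) (repr (proj_torus a)) = dot (freq_vec k) a + 2 * pi * n%:~R.
  have /fin_all_exists[n nP] : forall i, exists n : int,
      repr (proj_torus a) ord0 i - a ord0 i = n%:~R.
    by move=> i; have /intrP[n ->] := ra i; exists n.
  exists (\sum_i k i * n i).
  rewrite rmorph_sum/= mulr_sumr /dot -big_split/=; apply: eq_bigr => i _.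
  by rewrite mxE intrM -nP; ring.
by rewrite nE addrAC cos_int_shift.
Qed.

Lemma character_le1 k th x : `|character k th x| <= 1.
Proof. exact: cos_max. Qed.

Lemma coord_cont (u : V) : continuous (dot u : V -> R).
Proof.
move=> a; apply: (@cvg_sumr _ _ _ _ _ (nbhs a)) => i.
apply: (@cvgM _ _ (nbhs a)); first exact: (@cst_continuous V).
exact: coord_continuous.
Qed.

Lemma character_continuous k th : continuous (character k th).
Proof.
apply: continuous_torusP.
have -> : character k th \o @proj_torus R d = fun a => cos (dot (freq_vec k) a + th).
  by apply/funext => a /=; rewrite characterE.
move=> a; apply: (@continuous_comp _ _ _ (fun a : V => dot (freq_vec k) a + th)).
  by apply: (@cvgD _ _ _ (nbhs a)); [exact: coord_cont|exact: (@cst_continuous V)].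
exact: continuous_cos.
Qed.

Lemma cosM (y z : R) : cos y * cos z = 2^-1 * cos (y + z) + 2^-1 * cos (y - z).
Proof. by rewrite cosD cosB; field. Qed.

Lemma characterM k l th th' x : character k th x * character l th' x =
  2^-1 * character (k + l) (th + th') x + 2^-1 * character (k - l) (th - th') x.
Proof.
rewrite /character cosM freq_vecD freq_vecB dotDl dotBl.
by congr (_ * cos _ + _ * cos _); ring.
Qed.

Lemma character0 x : character 0 0 x = 1.
Proof.
rewrite /character addr0 (_ : dot _ _ = 0) ?cos0//.
by rewrite /dot big1// => i _; rewrite mxE ffunE mulr0 mul0r.
Qed.

Definition trigpoly (g : T -> R) : Prop :=
  exists s : seq (R * (freq * R)), forall x,
    g x = \sum_(t <- s) t.1 * character t.2.1 t.2.2 x.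

Lemma trigpoly_character k th : trigpoly (character k th).
Proof. by exists [:: (1, (k, th))] => x; rewrite big_seq1 mul1r. Qed.

Lemma trigpolyD g h : trigpoly g -> trigpoly h -> trigpoly (fun x => g x + h x).
Proof.
by move=> [s gs] [s' hs]; exists (s ++ s') => x; rewrite big_cat gs hs.
Qed.

Lemma trigpolyZ (r : R) g : trigpoly g -> trigpoly (fun x => r * g x).
Proof.
move=> [s gs]; exists [seq (r * t.1, t.2) | t <- s] => x.
by rewrite big_map gs mulr_sumr; apply: eq_bigr => i _; rewrite mulrA.
Qed.

Lemma trigpoly_cst (r : R) : trigpoly (fun=> r).
Proof.
exists [:: (r, (0, 0))] => x; rewrite big_seq1/= character0 mulr1//.
Qed.

Lemma trigpoly_sum (I : Type) (s : seq I) (F : I -> T -> R) :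
  (forall i, trigpoly (F i)) -> trigpoly (fun x => \sum_(i <- s) F i x).
Proof.
move=> tF; elim: s => [|i s ih].
  by under eq_fun do rewrite big_nil; exact: trigpoly_cst.
by under eq_fun do rewrite big_cons; exact: trigpolyD.
Qed.

Lemma trigpolyM g h : trigpoly g -> trigpoly h -> trigpoly (fun x => g x * h x).
Proof.
move=> [s gs] [s' hs].
have -> : (fun x => g x * h x) = (fun x => \sum_(t <- s) \sum_(t' <- s')
    (t.1 * t'.1) * (2^-1 * character (t.2.1 + t'.2.1) (t.2.2 + t'.2.2) x
      + 2^-1 * character (t.2.1 - t'.2.1) (t.2.2 - t'.2.2) x)).
  apply/funext => x; rewrite gs hs mulr_suml; apply: eq_bigr => t _.
  rewrite mulr_sumr; apply: eq_bigr => t' _.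
  by rewrite -characterM; ring.
apply: trigpoly_sum => t; apply: trigpoly_sum => t'.
by apply/trigpolyZ/trigpolyD; apply: trigpolyZ; exact: trigpoly_character.
Qed.

Lemma trigpoly_continuous g : trigpoly g -> continuous g.
Proof.
move=> [s gs]; have -> : g = fun x => \sum_(t <- s) t.1 * character t.2.1 t.2.2 x.
  exact/funext.
move=> x; apply: (@cvg_sumr _ _ _ _ _ (nbhs x)) => t.
by apply: (@cvgM _ _ (nbhs x)); [exact: (@cst_continuous T)|exact: character_continuous].
Qed.

Lemma trigpoly_bound g : trigpoly g -> exists2 M : R, 0 < M & forall x, `|g x| <= M.
Proof.
move=> [s gs]; exists (\sum_(t <- s) `|t.1| + 1).
  by rewrite ltr_wpDl// sumr_ge0.
move=> x; rewrite gs (le_trans (ler_norm_sum _ _ _))//.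
rewrite -[leLHS]addr0 lerD// ler_sum// => t _.
by rewrite normrM ler_piMr// character_le1.
Qed.

(* The bounded pointwise limits of trigonometric polynomials, a class stable
   under products that contains indicators. *)
Definition trig_limit (g : T -> R) : Prop := exists gn : nat -> T -> R,
  [/\ forall n, trigpoly (gn n), (exists M : R, forall n x, `|gn n x| <= M) &
      forall x, gn n x @[n --> \oo] --> g x].

Lemma trig_limitM g h : trig_limit g -> trig_limit h -> trig_limit (fun x => g x * h x).
Proof.
move=> [gn [tg [M gM] gng]] [hn [th [N hN] hnh]].
exists (fun n x => gn n x * hn n x); split=> [n||x]; first exact: trigpolyM.
  by exists (M * N) => n x; rewrite normrM ler_pM.
by apply: cvgM; [exact: gng|exact: hnh].
Qed.

(* Iterating this cubic on [-1, 1] converges to the sign: it makes the indicator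
   of [p > 0] a bounded limit of polynomials in [p]. *)
Let q (y : R) : R := y * (3 - y ^+ 2) / 2.

(** On [0, 1] the map increases its argument towards the fixed point 1. The contraction factor of
    the gap depends only on a lower bound [e] of [y], so it remains the same along the iterates. *)
Let q_sub (y e : R) : 0 <= e <= y -> y <= 1 ->
  [/\ e <= q y, q y <= 1 & 1 - q y <= (1 - e / 2) * (1 - y)].
Proof.
move=> /andP[e0 ey] y1.
have yq : y <= q y.
  by rewrite -subr_ge0 (_ : q y - y = y * (1 - y) * (1 + y) / 2) /q; [nra|field].
split; first exact: le_trans yq.
  rewrite -subr_ge0 (_ : 1 - q y = (1 - y) ^+ 2 * (2 + y) / 2) /q; last by field.
  by rewrite divr_ge0// mulr_ge0 ?sqr_ge0//; lra.
rewrite (_ : 1 - q y = (1 - y * (1 + y) / 2) * (1 - y)) /q; last by field.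
by apply: ler_wpM2r; nra.
Qed.

Let q_iter (y : R) n : 0 < y <= 1 ->
  [/\ y <= iter n q y, iter n q y <= 1 & 1 - iter n q y <= (1 - y / 2) ^+ n].
Proof.
move=> /andP[y0 y1]; elim: n => [|n [ih1 ih2 ih3]]; first by split=> //=; rewrite expr0; lra.
have [||h1 h2 h3] := @q_sub (iter n q y) y; rewrite ?(ltW y0)//.
split=> //=; rewrite (le_trans h3)// exprS ler_wpM2l//; lra.
Qed.

Let qN (y : R) n : iter n q (- y) = - iter n q y.
Proof. by elim: n => //= n ->; rewrite /q; field. Qed.

Let q_norm (y : R) n : `|y| <= 1 -> `|iter n q y| <= 1.
Proof.
have pos z : 0 < z -> `|z| <= 1 -> `|iter n q z| <= 1.
  move=> z0; rewrite gtr0_norm// => z1.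
  have [|h1 h2 _] := @q_iter z n; first by rewrite z0.
  by rewrite ger0_norm// (le_trans (ltW z0)).
have [y0|y0|->] := ltgtP y 0; last first.
- by move=> _; rewrite (_ : iter n q 0 = 0) ?normr0//; elim: n {pos} => //= n ->; rewrite /q !mul0r.
- exact: pos.
- move=> y1; rewrite -[y]opprK qN normrN.
  by apply: pos; rewrite ?oppr_gt0// normrN.
Qed.

Let q_cvg (y : R) : `|y| <= 1 -> iter n q y @[n --> \oo] --> Num.sg y.
Proof.
have pos z : 0 < z -> `|z| <= 1 -> iter n q z @[n --> \oo] --> (1 : R).
  move=> z0; rewrite gtr0_norm// => z1.
  have zp : 0 < z <= 1 by rewrite z0.
  apply: (@squeeze_cvgr _ _ _ _ (fun n => 1 - (1 - z / 2) ^+ n) (fun=> 1)).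
  - apply: nearW => n; have [_ h2 h3] := q_iter n zp.
    by rewrite h2 andbT lerBlDr addrC -lerBlDr.
  - rewrite -[X in _ --> X]subr0; apply: cvgB; first exact: cvg_cst.
    by apply: cvg_expr; rewrite ger0_norm; lra.
  - exact: cvg_cst.
move=> y1; have [y0|y0|->] := ltgtP y 0; last first.
- rewrite sgr0 (_ : (fun n => iter n q 0) = cst 0); first exact: cvg_cst.
  by apply/funext; elim=> //= n ->; rewrite /q !mul0r.
- by rewrite gtr0_sg//; exact: pos.
- rewrite ltr0_sg//; rewrite -[y]opprK; under eq_fun do rewrite qN.
  by apply: cvgN; apply: pos; rewrite ?oppr_gt0// normrN.
Qed.

Lemma trig_limit_pos p : trigpoly p -> trig_limit \1_[set x | 0 < p x].
Proof.
move=> tp; have [M M0 pM] := trigpoly_bound tp.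
pose f n x := iter n q (M^-1 * p x).
have fp x : `|M^-1 * p x| <= 1.
  by rewrite normrM gtr0_norm ?invr_gt0// mulrC ler_pdivrMr// mul1r.
have tf n : trigpoly (f n).
  elim: n => [|n ih]; first exact: trigpolyZ.
  have -> : f n.+1 = fun x => 2^-1 * (f n x * (3 + -1 * (f n x * f n x))).
    by apply/funext => x; rewrite /f/= -/(f n x) /q; field.
  apply/trigpolyZ/trigpolyM => //; apply: trigpolyD; first exact: trigpoly_cst.
  exact/trigpolyZ/trigpolyM.
(* With [s] the sign of [p x], the value [(s + s^2) / 2] is 1 when [s = 1] and 0 when [s] is 0 or
   -1. *)
exists (fun n x => 2^-1 * (f n x + f n x * f n x)); split.
- by move=> n; apply/trigpolyZ/trigpolyD => //; exact: trigpolyM.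
- exists 1 => n x; rewrite normrM gtr0_norm ?invr_gt0// mulrC ler_pdivrMr// mul1r.
  have := q_norm n (fp x); rewrite -/(f n x) => fx.
  rewrite (le_trans (ler_normD _ _))// normrM.
  have : `|f n x| * `|f n x| <= 1 by rewrite mulr_ile1.
  by lra.
- move=> x; have fc := q_cvg (fp x).
  have -> : \1_[set x | 0 < p x] x =
      2^-1 * (Num.sg (M^-1 * p x) + Num.sg (M^-1 * p x) * Num.sg (M^-1 * p x)).
    rewrite sgrM gtr0_sg ?invr_gt0// mul1r indicE.
    have [p0|p0|p0] := ltgtP (p x) 0.
    + by rewrite ltr0_sg// memNset/=; [field|move=> h; have := lt_trans p0 h; rewrite ltxx].
    + by rewrite gtr0_sg// mem_set//=; field.
    + by rewrite p0 sgr0 memNset/= ?ltxx// ; [field|rewrite p0 ltxx].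
  apply: cvgM; first exact: cvg_cst.
  by apply: cvgD => //; apply: cvgM.
Qed.

Lemma trig_limit_bmeas g : trig_limit g -> bmeas (g : btorus R d -> R).
Proof.
move=> [gn [tg [M gM] gng]]; split.
  apply: (@measurable_fun_cvg _ _ _ _ (gn : nat -> btorus R d -> R)).
    by move=> n; have [] := continuous_bmeas (trigpoly_continuous (tg n)).
  by move=> x _; exact: gng.
exists M => x; have : `|gn n x| @[n --> \oo] --> `|g x| by apply: cvg_norm; exact: gng.
move=> h; rewrite -(cvg_lim (@Rhausdorff R) h).
by apply: limr_le; [apply: cvgP h|apply: nearW => n; exact: gM].
Qed.

Lemma int_bounded_cvg (m : prob R d) (gn : nat -> T -> R) g (M : R) :
  (forall n, bmeas (gn n : btorus R d -> R)) -> bmeas (g : btorus R d -> R) ->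
  (forall n x, `|gn n x| <= M) -> (forall x, gn n x @[n --> \oo] --> g x) ->
  \int[m]_x gn n x @[n --> \oo] --> \int[m]_x g x.
Proof.
move=> bgn bg gM gng.
have [//|||||_ _ cv] := @dominated_convergence _ (btorus R d) R m setT measurableT
  (fun n x => (gn n x)%:E) (fun x => (g x)%:E) (fun=> M%:E).
- by move=> n; apply/measurable_EFinP; case: (bgn n).
- by apply/measurable_EFinP; case: bg.
- by apply: aeW => x _; apply: cvg_EFin; [exact: nearW|exact: gng].
- apply: (@bmeas_integrable _ _ _ m (fun=> M)); last exact: bmeas_cst.
  exact: prob_setT_lty.
- by apply: aeW => x n _; rewrite lee_fin.
apply: fine_cvg; rewrite fineK; first exact: cv.
apply: integrable_fin_num => //; apply: (@bmeas_integrable _ _ _ m) => //.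
exact: prob_setT_lty.
Qed.

Definition cell_family := (nat * freq)%type.

(** Modulo integers, this is the open cube of centre [c / (n + 2)] and half-side [1 / (n + 2)]. The
    cosine form makes its indicator a product of indicators of positivity sets of trigonometric
    polynomials. The shift by 2 keeps the half-side at most 1/2, so that all angles compared stay in
    [0, pi], where cosine decreases. *)
Definition trig_cell (j : cell_family) : set T := [set x : T | forall i,
  cos (2 * pi / j.1.+2%:R) < cos (2 * pi * (repr x ord0 i - (j.2 i)%:~R / j.1.+2%:R))].

Lemma trig_limit_cell j : trig_limit \1_(trig_cell j).
Proof.
case: j => n c.
pose e i : freq := [ffun i' => (i' == i)%:Z].
pose p i x := character (e i) (- (2 * pi * ((c i)%:~R / n.+2%:R))) x + - cos (2 * pi / n.+2%:R).
have tp i : trigpoly (p i) by apply: trigpolyD; [exact: trigpoly_character|exact: trigpoly_cst].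
have pE i x : p i x = cos (2 * pi * (repr x ord0 i - (c i)%:~R / n.+2%:R)) - cos (2 * pi / n.+2%:R).
  rewrite /p /character; congr (cos _ + _).
  rewrite /dot (bigD1 i)//= big1 ?addr0; last first.
    by move=> i' ii'; rewrite mxE ffunE (negbTE ii')/= mulr0 mul0r.
  by rewrite mxE ffunE eqxx/=; ring.
have -> : \1_(trig_cell (n, c)) = (fun x => \prod_i \1_[set x | 0 < p i x] x) :> (T -> R).
  apply/funext => x; rewrite indicE; case: (boolP (x \in _)) => [|]; rewrite ?inE /trig_cell/=.
    move=> h; rewrite big1// => i _.
    by rewrite indicE mem_set//= pE subr_gt0.
  move=> h; have /existsNP[i hi] : ~ trig_cell (n, c) x.
    by move=> hx; move: h; rewrite (_ : _ \in _ = true)//; exact: mem_set.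
  by rewrite (bigD1 i)//= indicE memNset/= ?mul0r// pE subr_gt0.
elim: (index_enum _) => [|i s ih].
  under eq_fun do rewrite big_nil.
  exists (fun _ _ => 1); split; first by move=> _; exact: trigpoly_cst.
    by exists 1 => _ _; rewrite normr1.
  by move=> x; exact: cvg_cst.
under eq_fun do rewrite big_cons.
by apply: trig_limitM => //; exact: trig_limit_pos.
Qed.

Lemma trig_cell_open j : open (trig_cell j).
Proof.
pose A i := [set x : T | cos (2 * pi / j.1.+2%:R) <
    cos (2 * pi * (repr x ord0 i - (j.2 i)%:~R / j.1.+2%:R))].
have -> : trig_cell j = \big[setI/setT]_(i <- enum 'I_d) A i.
  rewrite -bigcap_seq; apply/seteqP; split => x h i; first by move=> _; exact: (h i).
  by apply: (h i); rewrite /= mem_enum.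
elim: (enum _) => [|i s ih]; first by rewrite big_nil; exact: openT.
rewrite big_cons; apply: openI => // {ih}.
pose e : freq := [ffun i' => (i' == i)%:Z].
pose th : R := - (2 * pi * ((j.2 i)%:~R / j.1.+2%:R)).
rewrite (_ : A i = character e th @^-1` [set r | cos (2 * pi / j.1.+2%:R) < r]).
  by move/continuousP : (@character_continuous e th); apply; exact: open_gt.
apply/seteqP; split => x /=; rewrite /character /dot (bigD1 i)//= big1 ?addr0;
  try by move=> i' ii'; rewrite mxE ffunE (negbTE ii')/= mulr0 mul0r.
  by rewrite mxE ffunE eqxx/= /th mulr1 -mulrBr.
by rewrite mxE ffunE eqxx/= /th mulr1 -mulrBr.
Qed.

Lemma cos_gt_near_int (e y : R) : 0 < e <= 1 / 2 -> cos (2 * pi * e) < cos (2 * pi * y) ->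
  exists n : int, `|y - n%:~R| < e.
Proof.
move=> /andP[e0 e2] ey.
(* This is the integer nearest to [y], so that [2 pi |y - n|] lies in [0, pi]. *)
pose n := Num.floor (y + 1 / 2); exists n.
have /andP[n1 n2] := floor_itv (y + 1 / 2).
rewrite intrD in n2.
set z := y - n%:~R; have zh : `|z| <= 1 / 2.
  by rewrite /z ler_norml -/n; apply/andP; split; rewrite /n; lra.
have yz : cos (2 * pi * y) = cos (2 * pi * `|z|).
  rewrite -{1}(subrK (n%:~R) y) -/z mulrDr cos_int_shift -cos_norm normrM.
  by rewrite ger0_norm// mulr_ge0// pi_ge0.
have pi0 := pi_gt0 R.
move: ey; rewrite yz ltr_cos; first by rewrite ltr_pM2l// mulr_gt0.
  by rewrite in_itv/=; have z0 := normr_ge0 z; apply/andP; split; nra.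
by rewrite in_itv/=; apply/andP; split; nra.
Qed.

Lemma trig_cell_small (r : R) : 0 < r -> exists n, forall c x y,
  trig_cell (n, c) x -> trig_cell (n, c) y -> torus_dist x y < r.
Proof.
(* After integer translations two points of a cell differ by less than [2 / (n + 2)] in each
   coordinate, hence by at most [2 d / (n + 2)] in the l1 norm. *)
move=> r0; pose n := Num.bound (2 * d%:R / r); exists n => c x y cx cy.
have e02 : (0 : R) < 1 / (n.+2%:R : R) <= 1 / 2.
  by rewrite divr_gt0//= ler_pM2l// lef_pV2 ?posrE// ler_nat.
have near_int z : trig_cell (n, c) z -> exists k : {ffun 'I_d -> int}, forall i,
    `|repr z ord0 i - (c i)%:~R / n.+2%:R - (k i)%:~R| < 1 / n.+2%:R.
  move=> cz; have /fin_all_exists[k kP] : forall i, exists k : int,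
      `|repr z ord0 i - (c i)%:~R / n.+2%:R - k%:~R| < 1 / n.+2%:R.
    by move=> i; apply: cos_gt_near_int => //; have := cz i; rewrite mulrA mulr1.
  by exists (finfun k) => i; rewrite ffunE.
have [k kx] := near_int _ cx; have [l ly] := near_int _ cy.
pose a := \row_i (repr x ord0 i - (k i)%:~R) : V.
pose b := \row_i (repr y ord0 i - (l i)%:~R) : V.
have ax : proj_torus a = x.
  rewrite -[RHS]proj_repr; apply/proj_torusP => i.
  by rewrite mxE addrAC subrr add0r rpredN intr_int.
have by_ : proj_torus b = y.
  rewrite -[RHS]proj_repr; apply/proj_torusP => i.
  by rewrite mxE addrAC subrr add0r rpredN intr_int.
rewrite -ax -by_ (le_lt_trans (torus_dist_le _ _))// (le_lt_trans (enorm_le_sum _))//.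
apply: (@le_lt_trans _ _ (\sum_(i < d) 2 / n.+2%:R)).
  apply: ler_sum => i _; rewrite !mxE.
  have hx := kx i; have hy := ly i.
  rewrite -[leRHS](_ : 1 / n.+2%:R + 1 / n.+2%:R = _); last by field.
  rewrite [X in `|X|](_ : _ = (repr x ord0 i - (c i)%:~R / n.+2%:R - (k i)%:~R)
    - (repr y ord0 i - (c i)%:~R / n.+2%:R - (l i)%:~R)); last by ring.
  by rewrite (le_trans (ler_normB _ _))// lerD// ltW.
rewrite sumr_const card_ord -[_ *+ d]mulr_natr mulrAC ltr_pdivrMr// mulrC -ltr_pdivrMl// mulrC.
have : 2 * d%:R / r < n%:R.
  by apply: archi_boundP; rewrite divr_ge0 ?mulr_ge0// ltW.
move=> h; rewrite [ltLHS]mulrC (lt_le_trans h)// ler_nat; lia.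
Qed.

(** Rounding the fractional part of each coordinate down to a multiple of [1 / (n + 2)] makes an
    error strictly below the half-side of a cell. *)
Lemma trig_cell_cover n : exists s : seq freq, forall x, exists2 c, c \in s & trig_cell (n, c) x.
Proof.
exists [seq ([ffun i => ((u : {ffun 'I_d -> 'I_n.+2}) i)%:Z] : freq) | u <- enum {: {ffun 'I_d -> 'I_n.+2}}].
move=> x.
pose c (i : 'I_d) := Num.trunc (n.+2%:R * frac_part (repr x ord0 i)).
have cP i : [/\ (c i < n.+2)%N, (c i)%:R <= n.+2%:R * frac_part (repr x ord0 i) &
    n.+2%:R * frac_part (repr x ord0 i) < (c i)%:R + 1].
  have /andP[f0 f1] := frac_part_itv (repr x ord0 i).
  have /andP[c1 c2] : (c i)%:R <= n.+2%:R * frac_part (repr x ord0 i) < (c i).+1%:R.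
    by apply: truncn_itv; rewrite mulr_ge0.
  split=> //; last by rewrite natr1.
  rewrite -(ltr_nat R) (le_lt_trans c1)// -[ltRHS]mulr1 ltr_pM2l//.
exists [ffun i => (c i)%:Z].
  apply/mapP; exists [ffun i => Ordinal (let: And3 h _ _ := cP i in h)].
    by rewrite mem_enum.
  by apply/ffunP => i; rewrite !ffunE.
move=> i /=; rewrite ffunE.
have [_ c1 c2] := cP i.
rewrite [X in _ < cos X](_ : _ = 2 * pi * (frac_part (repr x ord0 i) - (c i)%:R / n.+2%:R)
   + 2 * pi * (Num.floor (repr x ord0 i))%:~R); last first.
  by rewrite /frac_part -[(Posz (c i))%:~R]/((c i)%:R : R); ring.
rewrite cos_int_shift.
set f := frac_part _ in c1 c2 *.
have f0 : 0 <= f - (c i)%:R / n.+2%:R by rewrite subr_ge0 ler_pdivrMr// mulrC.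
have f1 : f - (c i)%:R / n.+2%:R < 1 / n.+2%:R.
  by rewrite ltrBlDl -mulrDl ltr_pdivlMr// mulrC.
have pi0 := pi_gt0 R.
have n2 : (1 / n.+2%:R : R) <= 1 / 2 by rewrite ler_pM2l// lef_pV2 ?posrE// ler_nat.
rewrite [X in cos X < _](_ : _ = 2 * pi * (1 / n.+2%:R)) ?mul1r//.
rewrite -[in X in cos X < _](mul1r n.+2%:R^-1) ltr_cos.
- by rewrite ltr_pM2l// mulr_gt0.
- rewrite in_itv/=; move: (f - _) f0 f1 => w w0 w1.
  by move: (1 / _) n2 w1 => m n2 w1; apply/andP; split; nra.
- rewrite in_itv/=; have : (0 : R) <= 1 / n.+2%:R by [].
  by move: (1 / _) n2 => m n2 m0; apply/andP; split; nra.
Qed.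

Lemma character_phase k th x :
  character k th x = cos th * character k 0 x - sin th * character k (- (pi / 2)) x.
Proof. by rewrite /character addr0 cosBpihalf cosD; ring. Qed.

Lemma character_bmeas k th : bmeas (character k th : btorus R d -> R).
Proof. exact/continuous_bmeas/character_continuous. Qed.

(** The two phases give cosines and sines, hence all characters. Equality of integrals then passes
    to bounded limits of trigonometric polynomials. The sets whose indicator is such a limit form a
    pi-system that contains the cells; the cells are a countable base of the topology, so this
    pi-system generates the Borel sets. *)
Lemma same_prob_characters (mu nu : prob R d) :
  (forall k (b : bool), \int[mu]_x character k (- (b%:R * (pi / 2))) x =
                        \int[nu]_x character k (- (b%:R * (pi / 2))) x) ->
  same_prob mu nu.
Proof.
move=> h.
have hchr k th : \int[mu]_x character k th x = \int[nu]_x character k th x.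
  have E (m : prob R d) : \int[m]_x character k th x =
      cos th * \int[m]_x character k 0 x - sin th * \int[m]_x character k (- (pi / 2)) x.
    under eq_Rintegral do rewrite character_phase.
    by rewrite intB ?intZ//; do ?apply: bmeasZ; exact: character_bmeas.
  rewrite !E; have := h k true; have := h k false.
  by rewrite mul1r mul0r oppr0 => -> ->.
have htrig g : trigpoly g -> \int[mu]_x g x = \int[nu]_x g x.
  move=> [s gs].
  have -> : g = fun x => \sum_(t <- s) t.1 * character t.2.1 t.2.2 x by exact/funext.
  have bs (t : R * (freq * R)) : bmeas (fun x : btorus R d => t.1 * character t.2.1 t.2.2 x).
    by apply: bmeasZ; exact: character_bmeas.
  rewrite !int_sum//; apply: eq_bigr => t _.
  by rewrite !intZ ?hchr//; exact: character_bmeas.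
have hlim g : trig_limit g -> \int[mu]_x g x = \int[nu]_x g x.
  move=> tg; have bg := trig_limit_bmeas tg; case: tg => gn [tgn [M gM] gng].
  have bgn n : bmeas (gn n : btorus R d -> R) by exact/continuous_bmeas/trigpoly_continuous.
  have := @int_bounded_cvg mu _ _ _ bgn bg gM gng.
  have -> : (fun n => \int[mu]_x gn n x) = (fun n => \int[nu]_x gn n x).
    by apply/funext => n; exact: htrig.
  have := @int_bounded_cvg nu _ _ _ bgn bg gM gng.
  by move=> c1 c2; apply: (cvg_unique _ c2 c1).
pose G : set (set (btorus R d)) := [set S | trig_limit \1_S].
have Gm S : G S -> measurable S.
  by move=> /trig_limit_bmeas[mS _]; apply/(measurable_indicP R).
have GmE : measurable = <<s G >>.
  apply/seteqP; split; last first.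
    by apply: smallest_sub; [exact: sigma_algebra_measurable|exact: Gm].
  apply: smallest_sub; first exact: smallest_sigma_algebra.
  move=> B oB.
  (* An open set is the union of the countably many cells that it contains; every other index
     contributes the empty set. *)
  pose C n := if unpickle n is Some j then
    (if pselect (trig_cell j `<=` B) then trig_cell j else set0) else set0.
  have -> : B = \bigcup_n C n.
    apply/seteqP; split => [x Bx|x [n _]]; last first.
      by rewrite /C; case: unpickle => [j|//]; case: pselect => // jB /jB.
    have [r r0 rB] := open_torus_ball oB Bx.
    have [n nP] := trig_cell_small r0.
    have [s sP] := trig_cell_cover n; have [c _ cx] := sP x.
    exists (pickle (n, c)) => //; rewrite /C pickleK; case: pselect => //.
    by case=> y cy; apply: rB; apply: nP cx cy.
  apply: (@bigcupT_measurable _ (g_sigma_algebraType G)) => n.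
  rewrite /C; case: unpickle => [j|]; last exact: measurable0.
  case: (pselect (trig_cell j `<=` B)) => [jB|jB] /=; last exact: measurable0.
  by apply: sub_sigma_algebra; exact: trig_limit_cell.
move=> A mA; apply: (measure_unique G (fun=> setT)) => //.
- move=> S S' GS GS'; rewrite /G/= (_ : \1_(S `&` S') = fun x => \1_S x * \1_S' x).
    exact: trig_limitM.
  by rewrite indicI.
- move=> _; rewrite /G/= indicT; exists (fun _ _ => 1); split.
  + by move=> _; exact: trigpoly_cst.
  + by exists 1 => _ _; rewrite normr1.
  + by move=> x; exact: cvg_cst.
- by apply/seteqP; split => // x _; exists 0%N.
- move=> S GS; have mS := Gm _ GS.
  have := hlim _ GS; rewrite /Rintegral !integral_indic// !setIT => fE.
  have fin (m : prob R d) : (m S \is a fin_num)%E by exact: fin_num_measure.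
  by rewrite -[LHS](fineK (fin mu)) -[RHS](fineK (fin nu)) fE.
- by move=> _; exact: prob_setT_lty.
Qed.

End Characters.

(** * Compactness of the space of probability measures *)

Section Coding.
Variables (R : realType) (d : nat).
Local Notation T := (torus R d).
Local Notation P := (prob R d).
Implicit Types (x y z : T) (mu nu : P).

(** A triangle inequality up to the factor [d], which comes from bounding the Euclidean norm by the
    l1 norm; its uses only concern small distances. *)
Lemma torus_dist_quasi x y z (r s : R) : torus_dist x y < r -> torus_dist y z < s ->
  torus_dist x z <= d%:R * (r + s).
Proof.
rewrite torus_distC -(proj_repr y) => /torus_dist_lt[a <- ar] /torus_dist_lt[b <- bs].
apply: (le_trans (torus_dist_le _ _)); apply: (le_trans (enorm_le_sum _)).
rewrite (_ : d%:R * (r + s) = \sum_(i < d) (r + s)); last first.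
  by rewrite sumr_const card_ord mulr_natl.
apply: ler_sum => i _.
have := le_lt_trans (coord_le_enorm _ i) ar; have := le_lt_trans (coord_le_enorm _ i) bs.
rewrite !mxE => h1 h2.
rewrite (_ : a ord0 i - b ord0 i =
  (repr y ord0 i - b ord0 i) - (repr y ord0 i - a ord0 i)); last by ring.
by rewrite (le_trans (ler_normB _ _))// addrC lerD// ltW.
Qed.

Lemma torus_ball_open x (r : R) : open [set y : T | torus_dist x y < r].
Proof.
suff : open (@proj_torus R d @^-1` [set y : T | torus_dist x y < r]) by [].
rewrite openE => a /=; rewrite torus_distC => /torus_dist_lt[b bx abr].
have cb : enorm (a' - b) @[a' --> a] --> enorm (a - b).
  apply: (@continuous_comp _ _ _ (fun a' : 'rV[R]_d => a' - b)); last exact: enorm_continuous.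
  by apply: (@cvgB _ _ _ (nbhs a)); [exact: cvg_id|exact: (@cst_continuous 'rV[R]_d)].
have sub : [set a' | enorm (a' - b) < r] `<=`
    @proj_torus R d @^-1` [set y : T | torus_dist x y < r].
  by move=> a' /= a'b; rewrite torus_distC -bx (le_lt_trans (torus_dist_le _ _)).
exact: (@filterS _ (nbhs a) _ _ _ sub (cb _ (lt_nbhsl abr))).
Qed.

Definition cell_seq (n : nat) : set T :=
  if (unpickle n : option (cell_family d)) is Some j then trig_cell j else set0.

(* The first [k] binary digits of [x] record which of the first [k] cells of a
   countable basis contain [x]; a limit of measures is read off the limits of the
   distribution functions of the codes, and realised on [0, 1[ by its quantiles. *)
Fixpoint code (k : nat) x : nat :=
  if k is k'.+1 then ((x \in cell_seq k') + (code k' x).*2)%N else 0%N.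

Lemma code_half k x : (code k.+1 x)./2 = code k x.
Proof. exact: half_bit_double. Qed.

Lemma code_odd k x : odd (code k.+1 x) = (x \in cell_seq k).
Proof. by rewrite /= oddD odd_double addbF oddb. Qed.

Lemma code_lt k x : (code k x < 2 ^ k)%N.
Proof. by elim: k => //= k ih; rewrite expnS; case: (_ \in _) => /=; lia. Qed.

Lemma code_agree k x y : code k x = code k y ->
  forall j, (j < k)%N -> (x \in cell_seq j) = (y \in cell_seq j).
Proof.
elim: k => // k ih xy j; rewrite ltnS leq_eqVlt => /predU1P[->|jk].
  by rewrite -!code_odd xy.
by apply: ih => //; rewrite -[LHS]code_half -[RHS]code_half xy.
Qed.

(** [K] exceeds the index of every cell of a finite cover by cells of diameter below [r], so points
    with equal codes share one of these cells. *)
Lemma code_sep (r : R) : 0 < r -> exists K, forall x y, code K x = code K y -> torus_dist x y < r.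
Proof.
move=> r0; have [n nP] := trig_cell_small d r0.
have [s sP] := @trig_cell_cover R d n.
exists (\max_(c <- s) pickle (n, c)).+1 => x y xy.
have [c cs cx] := sP x; apply: (nP c x y cx).
have := code_agree xy (j := pickle (n, c)).
have lej : (pickle (n, c) <= \max_(c0 <- s) pickle (n, c0))%N.
  exact: (@leq_bigmax_seq _ s xpredT (fun c0 => pickle (n, c0)) c cs isT).
rewrite ltnS => /(_ lej).
have cE : cell_seq (pickle (n, c)) = trig_cell (n, c) by rewrite /cell_seq pickleK.
rewrite cE => xyE; have : x \in trig_cell (n, c) by exact: mem_set.
by rewrite xyE => /set_mem.
Qed.

Lemma measurable_cell_seq k : measurable (cell_seq k : set (btorus R d)).
Proof.
rewrite /cell_seq; case: unpickle => [j|]; last exact: measurable0.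
by apply: sub_sigma_algebra; exact: trig_cell_open.
Qed.

Lemma measurable_code k i : measurable ([set x | code k x = i] : set (btorus R d)).
Proof.
elim: k i => [|k ih] i.
  have [->|i0] := eqVneq i 0%N.
    by rewrite [X in measurable X](_ : _ = setT)//; apply/seteqP; split.
  rewrite [X in measurable X](_ : _ = set0)//; apply/seteqP; split => // x /= i0'.
  by rewrite -i0' in i0.
rewrite [X in measurable X](_ : _ = [set x | code k x = i./2] `&`
    (if odd i then cell_seq k else ~` cell_seq k)).
  apply: measurableI => //; case: odd; first exact: measurable_cell_seq.
  by apply: measurableC; exact: measurable_cell_seq.
apply/seteqP; split => [x xi|x [] /= xi].
  split; first by rewrite /= -code_half xi.
  rewrite -xi code_odd; have [xk|xk] := boolP (x \in _); first exact/set_mem.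
  by move=> /mem_set; rewrite (negbTE xk).
move=> h; rewrite -(odd_double_half i) -xi; congr (nat_of_bool _ + _)%N.
case: (odd i) h => h; first exact: mem_set.
by apply/negbTE/negP => /set_mem.
Qed.

End Coding.

Lemma int_finite_valued d (S : measurableType d) (R : realType) (m : probability S R)
    (c : S -> nat) (N : nat) (g : nat -> R) :
  (forall i, measurable [set x | c x = i]) -> (forall x, c x < N)%N ->
  bmeas (fun x => g (c x)) /\
  \int[m]_x g (c x) = \sum_(i < N) g i * fine (m [set x | c x = i]).
Proof.
move=> mc cN.
have bi (i : 'I_N) : bmeas (\1_[set x | c x = i] : S -> R).
  split; first exact/measurable_indicP.
  by exists 1 => x; rewrite indicE; case: (_ \in _); rewrite ?normr1 ?normr0.
have gE : (fun x => g (c x)) = fun x => \sum_(i < N) g i * \1_[set x | c x = i] x.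
  apply/funext => x; rewrite (bigD1 (Ordinal (cN x)))//= big1 ?addr0.
    by rewrite indicE mem_set//= mulr1.
  move=> i /eqP ix; rewrite indicE memNset/= ?mulr0// => xi.
  by apply: ix; exact: val_inj.
rewrite gE; split; first by apply: bmeas_sum => i; exact: bmeasZ.
rewrite int_sum; last by move=> i; exact: bmeasZ.
apply: eq_bigr => i _; rewrite intZ//; congr (_ * _).
by rewrite /Rintegral integral_indic// setIT.
Qed.

(** * Quantiles of a nested family of distribution functions *)

Section Quantile.
Variables (R : realType) (G : nat -> nat -> R).
Hypothesis G0 : forall k, G k 0%N = 0.
Hypothesis G1 : forall k, G k (2 ^ k)%N = 1.
Hypothesis Gmono : forall k i j, (i <= j)%N -> G k i <= G k j.
Hypothesis Gnest : forall k i, G k.+1 i.*2 = G k i.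

(** Quantiles are total functions on [R]; points outside [0, 1[ are sent to 0, and [leb01] gives
    them no mass. *)
Definition clamp01 (w : R) : R := if (0 <= w < 1) then w else 0.

Lemma clamp01_itv w : 0 <= clamp01 w < 1.
Proof. by rewrite /clamp01; case: ifPn => // _; rewrite lexx ltr01. Qed.

Definition quantile k (w : R) : nat := find (fun i => clamp01 w < G k i.+1) (iota 0 (2 ^ k)%N).

Lemma quantile_lt_pow k w : (quantile k w < 2 ^ k)%N.
Proof.
rewrite -[X in (_ < X)%N](size_iota 0) -has_find; apply/hasP.
exists ((2 ^ k).-1)%N; first by rewrite mem_iota add0n prednK ?expn_gt0 ?leqnn.
by rewrite prednK ?expn_gt0// G1; case/andP: (clamp01_itv w).
Qed.

(** The adjunction between quantile and distribution function; both the nesting of the quantiles and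
    the shape of their level sets follow from it. *)
Lemma quantile_ltP k w i : (quantile k w < i)%N = (clamp01 w < G k i).
Proof.
have qN := quantile_lt_pow k w; apply/idP/idP => [qi|].
  have h : has (fun i => clamp01 w < G k i.+1) (iota 0 (2 ^ k)%N).
    by rewrite has_find size_iota.
  have := nth_find 0 h; rewrite -/(quantile k w) nth_iota// add0n => /lt_le_trans; apply.
  exact: Gmono.
case: i => [|i wi]; first by rewrite G0 ltNge; case/andP: (clamp01_itv w) => ->.
rewrite ltnS leqNgt; apply/negP => iq.
have := before_find 0 iq; rewrite nth_iota ?add0n ?wi//.
exact: ltn_trans qN.
Qed.

Lemma quantile_half k w : (quantile k.+1 w)./2 = quantile k w.
Proof.
have h i : (quantile k.+1 w < i.*2)%N = (quantile k w < i)%N by rewrite !quantile_ltP Gnest.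
have := h (quantile k w).+1; have := h (quantile k w).
by rewrite ltnn ltnSn; lia.
Qed.

Lemma quantileE k w i : (quantile k w = i) <-> G k i <= clamp01 w < G k i.+1.
Proof.
rewrite leNgt -!quantile_ltP -leqNgt ltnS; split=> [->|/andP[h1 h2]].
  by rewrite leqnn.
by apply/eqP; rewrite eqn_leq h1 h2.
Qed.

Lemma measurable_clamp01 : measurable_fun [set: R] clamp01.
Proof.
have m01 : measurable (`[0, 1[%classic : set R) by exact: measurable_itv.
rewrite (_ : clamp01 = fun w => w * \1_(`[0, 1[%classic : set R) w).
  by apply: measurable_funM => //; exact/measurable_indicP.
apply/funext => w; rewrite /clamp01 indicE; case: ifPn => w01.
  by rewrite mem_set/= ?mulr1// in_itv.
by rewrite memNset/= ?mulr0// in_itv; exact/negP.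
Qed.

Lemma measurable_quantile k i : measurable [set w : R | quantile k w = i].
Proof.
rewrite (_ : [set w | _] = clamp01 @^-1` `[G k i, G k i.+1[%classic).
  by rewrite -[X in measurable X]setTI; apply: measurable_clamp01 => //; exact: measurable_itv.
by apply/seteqP; split => w /=; rewrite in_itv/=; move/quantileE.
Qed.

End Quantile.

Section UnitInterval.
Variable R : realType.

Definition leb01 := mrestr (@lebesgue_measure R)
  (measurable_itv `[0, 1[ : measurable (`[0, 1[%classic : set (measurableTypeR R))).

HB.instance Definition _ := Measure.on leb01.

Lemma leb01_setT : leb01 setT = 1%E.
Proof.
rewrite /leb01 /mrestr setTI lebesgue_measure_itv/= lte01.
by rewrite sube0.
Qed.

HB.instance Definition _ := Measure_isProbability.Build _ _ _ leb01 leb01_setT.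

Lemma leb01_quantile (G : nat -> nat -> R) k i :
  (forall k, G k 0%N = 0) -> (forall k, G k (2 ^ k)%N = 1) ->
  (forall k i j, (i <= j)%N -> G k i <= G k j) -> (i < 2 ^ k)%N ->
  leb01 [set w : R | quantile G k w = i] = (G k i.+1 - G k i)%:E.
Proof.
move=> G0 G1 Gm ik.
have Gi0 : 0 <= G k i by rewrite -(G0 k) Gm.
have Gi1 : G k i.+1 <= 1 by rewrite -(G1 k) Gm.
rewrite /leb01 /mrestr (_ : _ `&` _ = `[G k i, G k i.+1[%classic); last first.
  apply/seteqP; split => w /=; rewrite !in_itv/=.
    move=> [qi w01]; have cw : clamp01 w = w by rewrite /clamp01 w01.
    by rewrite -cw; apply/(quantileE G0 G1 Gm).
  move=> /andP[h1 h2]; have w01 : 0 <= w < 1.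
    by rewrite (le_trans Gi0 h1)/= (lt_le_trans h2).
  by split=> //; apply/(quantileE G0 G1 Gm); rewrite /clamp01 w01 h1.
rewrite lebesgue_measure_itv/= lte_fin; case: ltP => // h.
have -> : G k i.+1 = G k i by apply/eqP; rewrite eq_le h Gm.
by rewrite subrr.
Qed.

End UnitInterval.

Section Compactness.
Variables (R : realType) (d : nat) (F : set_system (prob R d)).
Context {UF : UltraFilter F}.
Local Notation T := (torus R d).
Local Notation P := (prob R d).

Definition mass (A : set (btorus R d)) (m : P) : R := fine (m A).

Lemma mass_itv A m : measurable A -> 0 <= mass A m <= 1.
Proof.
move=> mA; have mfin : m A \is a fin_num by exact: fin_num_measure.
apply/andP; split; first by rewrite fine_ge0.
rewrite -lee_fin fineK//; exact: probability_le1.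
Qed.

Lemma mass_add A B m : measurable A -> measurable B -> A `&` B = set0 ->
  mass (A `|` B) m = mass A m + mass B m.
Proof.
move=> mA mB AB; rewrite /mass measureU// fineD//; exact: fin_num_measure.
Qed.

(** A cluster point along an ultrafilter is a limit: the preimage of a neighbourhood or the
    complement of that preimage belongs to the ultrafilter, and the latter would contradict
    clustering. *)
Lemma ultra_cvg01 (f : P -> R) : (forall m, 0 <= f m <= 1) ->
  exists l : R, f @ F --> l.
Proof.
move=> f01; have c01 := @segment_compact R 0 1.
have [|l [_ lcl]] := c01 (f @ F) _.
  by apply: (@filterS _ F _ setT) => [m _ /=|]; [rewrite in_itv/= f01|exact: filterT].
exists l => V Vl; have [//|nFV] := in_ultra_setVsetC (f @^-1` V) UF.
have [r [/= + Vr]] := lcl (~` V) V nFV Vl.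
by move/(_ Vr).
Qed.

Definition cdf_set k i : set (btorus R d) := [set x | (code k x < i)%N].

Lemma measurable_cdf_set k i : measurable (cdf_set k i).
Proof.
rewrite (_ : cdf_set k i = \bigcup_(j in `I_i) [set x | code k x = j]).
  by apply: bigcup_measurable => j _; exact: measurable_code.
by apply/seteqP; split => [x xi|x [j ji /= xj]]; [exists (code k x)|rewrite /cdf_set/= xj].
Qed.

Definition limit_cdf k i : R := xget 0 [set l | mass (cdf_set k i) @ F --> l].

Lemma limit_cdfP k i : mass (cdf_set k i) m @[m --> F] --> limit_cdf k i.
Proof.
have [l lP] := @ultra_cvg01 (mass (cdf_set k i)) (fun m => mass_itv m (measurable_cdf_set k i)).
exact: (@xgetPex R 0 [set l | mass (cdf_set k i) @ F --> l] (ex_intro _ l lP)).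
Qed.

Arguments limit_cdfP : clear implicits.

Let G := limit_cdf.

Lemma limit_cdf0 k : G k 0%N = 0.
Proof.
have -> : 0 = lim (mass (cdf_set k 0) m @[m --> F]).
  rewrite (_ : mass (cdf_set k 0) = cst 0) ?lim_cst//.
  apply/funext => m; rewrite /mass (_ : cdf_set k 0 = set0) ?measure0//.
  by apply/seteqP; split.
by apply/esym/cvg_lim => //; exact: limit_cdfP.
Qed.

Lemma limit_cdf1 k : G k (2 ^ k)%N = 1.
Proof.
have -> : 1 = lim (mass (cdf_set k (2 ^ k)%N) m @[m --> F]).
  rewrite (_ : mass (cdf_set k (2 ^ k)%N) = cst 1) ?lim_cst//.
  apply/funext => m; rewrite /mass (_ : cdf_set k _ = setT).
    by rewrite [X in fine X](_ : _ = 1%E)//; exact: probability_setT.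
  by apply/seteqP; split => // x _; exact: code_lt.
by apply/esym/cvg_lim => //; exact: limit_cdfP.
Qed.

Lemma cdf_set_diff k i j m : (i <= j)%N ->
  mass (cdf_set k j) m = mass (cdf_set k i) m + mass [set x | (i <= code k x < j)%N] m.
Proof.
move=> ij; rewrite -mass_add; [|exact: measurable_cdf_set| |].
- congr mass; apply/seteqP; split => x; rewrite /cdf_set/=; first last.
    by case=> [h|/andP[]//]; exact: leq_trans ij.
  by move=> xj; case: (ltnP (code k x) i) => h; [left|right].
- rewrite (_ : [set x | _] = cdf_set k j `\` cdf_set k i).
    by apply: measurableD; exact: measurable_cdf_set.
  apply/seteqP; split => x; rewrite /cdf_set/=.
    by move=> /andP[h1 h2]; split=> //; apply/negP; rewrite -leqNgt.
  by move=> [h1 /negP h2]; rewrite leqNgt h2.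
- by apply/seteqP; split => // x []; rewrite /cdf_set/= => h /andP[]; rewrite leqNgt h.
Qed.

Lemma limit_cdf_mono k i j : (i <= j)%N -> G k i <= G k j.
Proof.
move=> ij; apply: (ler_cvg_to (limit_cdfP k i) (limit_cdfP k j)).
by apply: nearW => m; rewrite (cdf_set_diff k m ij) lerDl fine_ge0.
Qed.

Lemma limit_cdf_nest k i : G k.+1 i.*2 = G k i.
Proof.
rewrite /G /limit_cdf (_ : cdf_set k.+1 i.*2 = cdf_set k i)//.
by apply/seteqP; split => x; rewrite /cdf_set/= -(code_half k x) /=; lia.
Qed.

Lemma limit_cell k i : mass [set x | code k x = i] m @[m --> F] --> G k i.+1 - G k i.
Proof.
rewrite (_ : (fun m => _) =
  (fun m => mass (cdf_set k i.+1) m - mass (cdf_set k i) m)).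
  by apply: cvgB; exact: limit_cdfP.
apply/funext => m; rewrite (cdf_set_diff k m (leqnSn i)) -[RHS]addrC addKr.
congr mass; apply/seteqP; split => x /=; rewrite ltnS -eqn_leq eq_sym => /eqP //.
Qed.

Definition cell_point k i : T := xget (proj_torus 0) [set x | code k x = i].

Lemma code_cell_point k (x : T) : code k (cell_point k (code k x)) = code k x.
Proof. by rewrite /cell_point; apply: (@xgetPex _ _ [set y | code k y = code k x]); exists x. Qed.

(** A value taken by the quantile has positive limiting mass, hence positive mass for some measure,
    so its cell is not empty and [cell_point] does not return its default. *)
Lemma quantile_cell_point k w : code k (cell_point k (quantile G k w)) = quantile G k w.
Proof.
suff [x <-] : exists x : T, code k x = quantile G k w by exact: code_cell_point.
have /andP[h1 h2] : G k (quantile G k w) <= clamp01 w < G k (quantile G k w).+1.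
  by apply/(quantileE limit_cdf0 limit_cdf1 limit_cdf_mono).
have : 0 < G k (quantile G k w).+1 - G k (quantile G k w) by rewrite subr_gt0 (le_lt_trans h1).
move=> h; have : \forall m \near F, 0 < mass [set x : T | code k x = quantile G k w] m.
  exact: (@limit_cell k (quantile G k w) _ (lt_nbhsr h)).
move=> /filter_ex[m /= m0].
apply: contrapT => /forallNP nx; move: m0.
rewrite /mass (_ : [set x | _] = set0) ?measure0/= ?ltxx//.
by apply/seteqP; split => // x /nx.
Qed.

Lemma code_mono K k (x y : T) : (K <= k)%N -> code k x = code k y -> code K x = code K y.
Proof.
move=> /subnKC <-; elim: (k - K)%N => [|n ih]; first by rewrite addn0.
by rewrite addnS => xy; apply: ih; rewrite -[LHS]code_half -[RHS]code_half xy.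
Qed.

Let Y k w := cell_point k (quantile G k w).

Lemma code_approx K k w : (K <= k)%N -> code K (Y k w) = quantile G K w.
Proof.
move=> /subnKC <-; elim: (k - K)%N => [|n ih]; first by rewrite addn0 quantile_cell_point.
rewrite -ih; apply: (code_mono (leq_addr n K)).
rewrite addnS -[LHS]code_half !quantile_cell_point.
exact: (quantile_half limit_cdf0 limit_cdf1 limit_cdf_mono limit_cdf_nest).
Qed.

(** For [k >= K] the points [Y k w] share their first [K] digits with [Y K w], so a cluster point,
    given by compactness, stays near it. A class of equal codes need not be closed, which is why the
    limit is controlled by a distance and not by its digits. *)
Lemma limit_point_ex w : exists x : T, forall K (r : R),
  (forall y z : T, code K y = code K z -> torus_dist y z < r) ->
  torus_dist (Y K w) x <= d%:R * (r + r).
Proof.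
have [|x [_ xcl]] := @torus_compact R d (Y k w @[k --> \oo]) _; first exact: filterT.
exists x => K r Kr.
have r0 : 0 < r by rewrite (le_lt_trans (torus_dist_ge0 x x))// Kr.
have [||y [[k Kk <-] xy]] := xcl [set Y k w | k in [set k | (K <= k)%N]] [set y | torus_dist x y < r].
- by exists K => // k /= Kk; exists k.
- apply: open_nbhs_nbhs; split; first exact: torus_ball_open.
  by rewrite /= (le_lt_trans _ (Kr x x erefl))//.
apply: torus_dist_quasi; last by rewrite torus_distC; exact: xy.
by apply: Kr; rewrite !code_approx.
Qed.

Definition limit_map w : T := xget (proj_torus 0) [set x : T | forall K (r : R),
  (forall y z : T, code K y = code K z -> torus_dist y z < r) ->
  torus_dist (Y K w) x <= d%:R * (r + r)].

Lemma limit_mapP w K (r : R) : (forall y z : T, code K y = code K z -> torus_dist y z < r) ->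
  torus_dist (Y K w) (limit_map w) <= d%:R * (r + r).
Proof.
have := limit_point_ex w => /(@xgetPex T (proj_torus 0) [set x : T | forall K (r : R),
  (forall y z : T, code K y = code K z -> torus_dist y z < r) ->
  torus_dist (Y K w) x <= d%:R * (r + r)]); exact.
Qed.

Lemma measurable_limit_map : measurable_fun [set: measurableTypeR R] (limit_map : _ -> btorus R d).
Proof.
move=> mT; apply: (@measurability _ _ _ (btorus R d) _ _ (@open T)) => //.
move=> _ [B oB <-]; rewrite setTI.
(* [good K i] says that the first [K] digits alone certify that the limit point lies in [B]; the
   preimage of [B] becomes a countable union of level sets of quantiles. *)
pose good K i := exists2 r : R, (forall y z : T, code K y = code K z -> torus_dist y z < r) &
  forall y : T, torus_dist (cell_point K i) y <= d%:R * (r + r) -> B y.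
rewrite [X in measurable X](_ : _ = \bigcup_K \bigcup_(i in good K) [set w | quantile G K w = i]).
  apply: bigcup_measurable => K _; apply: bigcup_measurable => i _.
  exact: (measurable_quantile limit_cdf0 limit_cdf1 limit_cdf_mono).
apply/seteqP; split => [w Bw|w [K _ [i [r Kr rB] /= wi]]]; last first.
  by apply: rB; rewrite -wi; exact: limit_mapP.
have [e e0 eB] := open_torus_ball oB Bw.
pose D : R := d%:R; have D0 : 0 <= D by [].
(* Two distances below [2 D r + r], combined by [torus_dist_quasi], give [(4 D^2 + 2 D) r], which
   has to stay below [e]. *)
pose r := e / (4 * D * D + 2 * D + 1).
have den0 : 0 < 4 * D * D + 2 * D + 1 by rewrite ltr_wpDl// addr_ge0// !mulr_ge0.
have r0 : 0 < r by rewrite divr_gt0.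
have [K Kr] := @code_sep R d r r0.
exists K => //; exists (quantile G K w) => //; exists r => // y Yy.
apply: eB.
have D4 : d%:R * (r + r) < D * (r + r) + r by rewrite ltrDl.
have h1 := le_lt_trans Yy D4.
have h2 := le_lt_trans (@limit_mapP w K r Kr) D4.
rewrite torus_distC in h2.
apply: (le_lt_trans (torus_dist_quasi h2 h1)).
have -> : d%:R * (D * (r + r) + r + (D * (r + r) + r)) = (4 * D * D + 2 * D) * r by rewrite /D; ring.
rewrite /r mulrCA gtr_pMr// ltr_pdivrMr// mul1r; lra.
Qed.

Definition limit_rv : measurableTypeR R -> btorus R d := limit_map.

HB.instance Definition _ :=
  @isMeasurableFun.Build _ _ (measurableTypeR R) (btorus R d) limit_rv measurable_limit_map.

Definition limit_prob : P := distribution (@leb01 R) limit_rv.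

Lemma int_code_approx (m : P) K (r : R) (phi : T -> R) :
  (forall x y, `|phi x - phi y| <= torus_dist x y) ->
  (forall y z : T, code K y = code K z -> torus_dist y z < r) ->
  `|\int[m]_x phi x - \sum_(i < (2 ^ K)%N) phi (cell_point K i) * mass [set x | code K x = i] m| <= r.
Proof.
move=> lphi Kr.
have bphi : bmeas (phi : btorus R d -> R).
  by apply/continuous_bmeas/(@lipschitz_continuous _ _ _ 1) => x y; rewrite mul1r.
have [bc <-] := @int_finite_valued _ (btorus R d) R m (code K) (2 ^ K)%N
  (fun i => phi (cell_point K i)) (@measurable_code R d K) (code_lt K).
apply: int_dist_le => // x.
by rewrite (le_trans (lphi _ _))// ltW// Kr// code_cell_point.
Qed.

Lemma int_limit_prob K (r : R) (phi : T -> R) :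
  (forall x y, `|phi x - phi y| <= torus_dist x y) ->
  (forall y z : T, code K y = code K z -> torus_dist y z < r) ->
  `|\int[limit_prob]_x phi x - \sum_(i < (2 ^ K)%N) phi (cell_point K i) * (G K i.+1 - G K i)|
    <= d%:R * (r + r).
Proof.
move=> lphi Kr.
have bphi : bmeas (phi : btorus R d -> R).
  by apply/continuous_bmeas/(@lipschitz_continuous _ _ _ 1) => x y; rewrite mul1r.
have [bc iE] := @int_finite_valued _ (measurableTypeR R) R (@leb01 R) (quantile G K) (2 ^ K)%N
  (fun i => phi (cell_point K i))
  (@measurable_quantile _ _ limit_cdf0 limit_cdf1 limit_cdf_mono K)
  (@quantile_lt_pow _ _ limit_cdf1 K).
have -> : \sum_(i < (2 ^ K)%N) phi (cell_point K i) * (G K i.+1 - G K i) =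
    \int[@leb01 R]_w phi (cell_point K (quantile G K w)).
  rewrite iE; apply: eq_bigr => i _; congr (_ * _).
  have := @leb01_quantile R G K i limit_cdf0 limit_cdf1 limit_cdf_mono (ltn_ord i).
  by move=> /(congr1 fine) /= <-.
have bX : bmeas (fun w : measurableTypeR R => phi (limit_map w)).
  case: bphi => mphi [M phiM]; split; last by exists M.
  exact: (measurableT_comp mphi measurable_limit_map).
have -> : \int[limit_prob]_x phi x = \int[@leb01 R]_w phi (limit_map w).
  rewrite /Rintegral /limit_prob integral_distribution//.
    by apply/measurable_EFinP; case: bphi.
  by apply: (bmeas_integrable (prob_setT_lty _) bX).
apply: int_dist_le => // w.
by rewrite (le_trans (lphi _ _))// torus_distC limit_mapP.
Qed.

Lemma ultra_cvg_prob : F --> limit_prob.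
Proof.
apply/cvg_ballP => e e0.
pose D : R := d%:R; have D0 : 0 <= D by [].
(* The errors are [2 D r] for the limit measure, [r] for the approximating measure and [r] between
   the two finite sums; the total is [e / 2]. *)
pose r := e / (4 * D + 4).
have den0 : 0 < 4 * D + 4 by rewrite ltr_wpDl// mulr_ge0.
have r0 : 0 < r by rewrite divr_gt0.
have [K Kr] := @code_sep R d r r0.
have near_sum : \forall m \near F, \sum_(i < (2 ^ K)%N) D *
    `|(G K i.+1 - G K i) - mass [set x | code K x = i] m| < r.
  have c0 : \sum_(i < (2 ^ K)%N) D * `|(G K i.+1 - G K i) - mass [set x | code K x = i] m|
      @[m --> F] --> (0 : R).
    rewrite [X in _ --> X](_ : 0 = \sum_(i < (2 ^ K)%N) D *
        `|(G K i.+1 - G K i) - (G K i.+1 - G K i)|); last first.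
      by rewrite big1// => i _; rewrite subrr normr0 mulr0.
    apply: cvg_sumr => i; apply: cvgM; first exact: cvg_cst.
    by apply: cvg_norm; apply: cvgB; [exact: cvg_cst|exact: limit_cell].
  exact: (c0 _ (lt_nbhsl r0)).
apply: filterS near_sum => m hm.
rewrite /ball/= /prob_ball.
apply: (@le_lt_trans _ _ (d%:R * (r + r) + r + r)%:E); last first.
  rewrite lte_fin -/D (_ : D * (r + r) + r + r = (2 * D + 2) * r); last by ring.
  by rewrite /r mulrCA gtr_pMr// ltr_pdivrMr// mul1r; lra.
apply: ge_ereal_sup => _ [phi lphi <-]; rewrite lee_fin.
(* Subtracting a constant, which changes no difference of integrals of probabilities, bounds the
   test function by [d]; [near_sum] then controls all 1-Lipschitz functions at once. *)
pose psi x := phi x - phi (cell_point K 0).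
have lpsi x y : `|psi x - psi y| <= torus_dist x y.
  by rewrite /psi opprB addrA subrK.
have bphi : bmeas (phi : btorus R d -> R).
  by apply/continuous_bmeas/(@lipschitz_continuous _ _ _ 1) => x y; rewrite mul1r.
have psiE (mm : P) : \int[mm]_x psi x = \int[mm]_x phi x - phi (cell_point K 0).
  by rewrite /psi intB ?int_cst//; exact: bmeas_cst.
have -> : \int[limit_prob]_x phi x - \int[m]_x phi x =
    \int[limit_prob]_x psi x - \int[m]_x psi x by rewrite !psiE; ring.
have h1 := int_limit_prob lpsi Kr.
have h2 := int_code_approx m lpsi Kr.
have h3 : `|\sum_(i < (2 ^ K)%N) psi (cell_point K i) * (G K i.+1 - G K i) -
    \sum_(i < (2 ^ K)%N) psi (cell_point K i) * mass [set x | code K x = i] m| <= r.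
  rewrite -sumrB (le_trans (ler_norm_sum _ _ _))// (le_trans _ (ltW hm))//.
  apply: ler_sum => i _; rewrite -mulrBr normrM ler_wpM2r//.
  rewrite /psi (le_trans (lphi _ _))//; exact: torus_dist_bound.
move: h1 h2 h3; rewrite !ler_norml => /andP[? ?] /andP[? ?] /andP[? ?].
lra.
Qed.

End Compactness.

Lemma prob_compact (R : realType) (d : nat) : compact [set: prob R d].
Proof.
rewrite compact_ultra => F UF _; exists (@limit_prob R d F UF); split => //.
exact: ultra_cvg_prob.
Qed.

(** An explicit quadratic remainder is a criterion that can be summed term by term along a
    series. *)
Lemma differentiable_quadratic (R : realType) (V W : normedModType R) (F : V -> W)
    (x : V) (df : {linear V -> W}) (C : R) : continuous df ->
  (forall h, `|F (x + h) - F x - df h| <= C * `|h| ^+ 2) ->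
  differentiable F x /\ 'd F x = df :> (V -> W).
Proof.
move=> dfc FC.
have K0 : 0 < `|C| + 1 by rewrite ltr_wpDl.
have Fo : F \o shift x = cst (F x) + df +o_ 0 id.
  apply/eqaddoP => _/posnumP[e]; near=> h.
  rewrite /= -[(_ - _) h]/(F (h + x) - (F x + df h)) opprD addrA [h + x]addrC.
  rewrite (le_trans (FC h))// expr2 mulrA ler_wpM2r//.
  apply: (@le_trans _ _ ((`|C| + 1) * `|h|)).
    by rewrite ler_wpM2r// (le_trans (ler_norm C))// lerDl.
  rewrite -(ler_pdivlMl _ _ K0).
  near: h; apply/nbhs_norm0P; exists ((`|C| + 1)^-1 * e%:num) => /=.
    by rewrite mulr_gt0// invr_gt0.
  by move=> h /= /ltW.
have dE : 'd F x = df :> (V -> W) by exact: diff_unique.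
by split=> //; apply/diff_locallyP; rewrite dE.
Unshelve. all: by end_near. Qed.

(** * Differential calculus on the torus *)

Section Differentiation.
Variables (R : realType) (d : nat).
Local Notation V := 'rV[R]_d.
Local Notation T := (torus R d).
Implicit Types (F : V -> R^o) (A a b v : V).

Lemma dot_is_linear A : linear (dot A : V -> R^o).
Proof.
move=> k u v; rewrite /dot scaler_sumr -big_split/=; apply: eq_bigr => i _.
by rewrite !mxE /GRing.scale/=; ring.
Qed.

HB.instance Definition _ A := GRing.isLinear.Build R V R^o _ (dot A) (dot_is_linear A).

Lemma coord_le_norm (h : V) i : `|h ord0 i| <= `|h|.
Proof.
rewrite {2}/Num.norm/= mx_normrE.
exact: (@le_bigmax_cond _ _ _ 0 (ord0, i) xpredT (fun ij : 'I_1 * 'I_d => `|h ij.1 ij.2|)).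
Qed.

Definition norm1 A : R := \sum_i `|A ord0 i|.

Lemma norm1_ge0 A : 0 <= norm1 A. Proof. exact: sumr_ge0. Qed.

Lemma dot_le_norm A (h : V) : `|dot A h| <= norm1 A * `|h|.
Proof.
rewrite /dot (le_trans (ler_norm_sum _ _ _))// /norm1 mulr_suml.
by apply: ler_sum => i _; rewrite normrM ler_wpM2l// coord_le_norm.
Qed.

Lemma dot_le_enorm A (h : V) : `|dot A h| <= norm1 A * enorm h.
Proof.
rewrite /dot (le_trans (ler_norm_sum _ _ _))// /norm1 mulr_suml.
by apply: ler_sum => i _; rewrite normrM ler_wpM2l// coord_le_enorm.
Qed.

Lemma differentiable_dot F (x : V) A (C : R) :
  (forall h : V, `|F (x + h) - F x - dot A h| <= C * `|h| ^+ 2) ->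
  differentiable F x /\ forall v, 'D_v F x = dot A v.
Proof.
move=> FC; have [dF dE] := @differentiable_quadratic R V R^o F x (dot A) C (@coord_cont R d A) FC.
by split=> // v; rewrite deriveE// dE.
Qed.

Lemma row_base_sum v : v = \sum_i v ord0 i *: base R i.
Proof. by rewrite {1}(row_sum_delta v). Qed.

Lemma derive_sum_base F (x : V) v : differentiable F x ->
  'D_v F x = \sum_i v ord0 i * 'D_(base R i) F x.
Proof.
move=> dF; rewrite deriveE// {1}(row_base_sum v) linear_sum/=.
by apply: eq_bigr => i _; rewrite linearZ/= deriveE.
Qed.

Lemma is_derive_line F a v (t : R) : differentiable F (t *: v + a) ->
  is_derive t 1 (fun s : R => F (s *: v + a)) ('D_v F (t *: v + a)).
Proof.
move=> dF.
have E : (fun h : R => h^-1 *: (F ((h *: (1 : R) + t) *: v + a) - F (t *: v + a))) =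
    (fun h : R => h^-1 *: (F (h *: v + (t *: v + a)) - F (t *: v + a))).
  by apply/funext => h; rewrite scalerDl addrA [h *: (1 : R)]mulr1.
have dFv := diff_derivable (v := v) dF.
apply: DeriveDef; last by rewrite /derive E.
by rewrite /derivable E.
Qed.

Lemma mean_value_bound F a b (M : R) : (forall x, differentiable F x) ->
  (forall x, `|'D_(a - b) F x| <= M) -> `|F a - F b| <= M.
Proof.
move=> dF FM.
have dl t := @is_derive_line F b (a - b) t (dF _).
have cl : continuous (fun s : R => F (s *: (a - b) + b)).
  move=> t; apply: differentiable_continuous; apply/derivable1_diffP.
  by have := dl t; case.
have [c _] := @MVT R (fun s => F (s *: (a - b) + b)) _ 0 1 ltr01
  (fun t _ => dl t) (continuous_subspaceT cl).
by rewrite scale1r scale0r add0r subrK subr0 mulr1 => ->.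
Qed.

Definition derive_torus v (g : T -> R) (x : T) : R := 'D_v (lift_torus g) (repr x).

(** The difference quotients at two representatives coincide, because the lift is periodic. *)
Lemma derive_torusE v (g : T -> R) a :
  derive_torus v g (proj_torus a) = 'D_v (lift_torus g) a.
Proof.
have /proj_torusP ra : proj_torus (repr (proj_torus a)) = proj_torus a.
  exact: proj_repr.
have E : (fun h : R => h^-1 *: ((lift_torus g \o shift (repr (proj_torus a))) (h *: v)
      - lift_torus g (repr (proj_torus a)))) =
    (fun h : R => h^-1 *: ((lift_torus g \o shift a) (h *: v) - lift_torus g a)).
  apply/funext => h; congr (_ *: (_ - _)); rewrite /lift_torus/=; last by rewrite proj_repr.
  by congr g; apply/proj_torusP => i; rewrite !mxE opprD addrACA subrr add0r ra.
by rewrite /derive_torus /derive E.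
Qed.

Lemma lift_derive_torus v (g : T -> R) : lift_torus (derive_torus v g) = 'D_v (lift_torus g).
Proof. by apply/funext => a; rewrite /lift_torus/= derive_torusE. Qed.

Lemma partial1E i (g : T -> R) : partial1 i g = derive_torus (base R i) g.
Proof. by []. Qed.

Lemma partial2E i j (g : T -> R) :
  partial2 i j g = derive_torus (base R i) (derive_torus (base R j) g).
Proof. by apply/funext => x; rewrite /partial2 /derive_torus -lift_derive_torus. Qed.

Lemma C1_continuous F : C1 F -> continuous F.
Proof. by move=> [dF _] x; exact: differentiable_continuous. Qed.

Lemma C2_torus_continuous (g : T -> R) : C2_torus g -> continuous g.
Proof. by move=> [c1 _]; apply: continuous_torusP; exact: C1_continuous. Qed.

Lemma partial1_continuous i (g : T -> R) : C2_torus g -> continuous (partial1 i g).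
Proof.
move=> [[_ c1] _]; apply: continuous_torusP; rewrite partial1E.
by rewrite -/(lift_torus _) lift_derive_torus.
Qed.

Lemma partial2_continuous i j (g : T -> R) : C2_torus g -> continuous (partial2 i j g).
Proof.
move=> [_ c2]; apply: continuous_torusP; rewrite partial2E.
rewrite -/(lift_torus _) !lift_derive_torus.
by have [_] := c2 (base R j).
Qed.

Lemma C2_torus_lipschitz (g : T -> R) (M : R) : C2_torus g -> 0 <= M ->
  (forall i x, `|partial1 i g x| <= M) ->
  forall x y, `|g x - g y| <= d%:R * M * torus_dist x y.
Proof.
move=> [[dg _] _] M0 gM; apply: lipschitz_torusP; first by rewrite mulr_ge0.
move=> a b; apply: (@mean_value_bound (lift_torus g)) => // x.
rewrite derive_sum_base// (le_trans (ler_norm_sum _ _ _))//.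
rewrite (_ : d%:R * M * _ = \sum_(i < d) enorm (a - b) * M); last first.
  by rewrite sumr_const card_ord -mulr_natl; ring.
apply: ler_sum => i _; rewrite normrM ler_pM// ?coord_le_enorm//.
by rewrite -derive_torusE; exact: gM.
Qed.

Lemma derive_torusD v (g h : T -> R) :
  (forall a, differentiable (lift_torus g) a) -> (forall a, differentiable (lift_torus h) a) ->
  derive_torus v (fun y => g y + h y) = fun x => derive_torus v g x + derive_torus v h x.
Proof.
move=> dg dh; apply/funext => x; rewrite /derive_torus.
by rewrite -deriveD//; exact: diff_derivable.
Qed.

Lemma derive_torusZ v (k : R) (g : T -> R) : (forall a, differentiable (lift_torus g) a) ->
  derive_torus v (fun y => k * g y) = fun x => k * derive_torus v g x.
Proof.
move=> dg; apply/funext => x; rewrite /derive_torus.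
by rewrite -[RHS]/(k *: _) -deriveZ//; exact: diff_derivable.
Qed.

Lemma C2_torus_diff (g : T -> R) : C2_torus g -> forall a, differentiable (lift_torus g) a.
Proof. by case=> -[]. Qed.

Lemma C2_torus_diff_derive v (g : T -> R) : C2_torus g ->
  forall a, differentiable (lift_torus (derive_torus v g)) a.
Proof. by move=> [_ c2] a; rewrite lift_derive_torus; have [] := c2 v. Qed.

Lemma gradD (g h : T -> R) x : C2_torus g -> C2_torus h ->
  grad (fun y => g y + h y) x = grad g x + grad h x.
Proof.
move=> cg ch; apply/rowP => i; rewrite !mxE partial1E derive_torusD//; exact: C2_torus_diff.
Qed.

Lemma gradZ (k : R) (g : T -> R) x : C2_torus g -> grad (fun y => k * g y) x = k *: grad g x.
Proof.
by move=> cg; apply/rowP => i; rewrite !mxE partial1E derive_torusZ//; exact: C2_torus_diff.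
Qed.

Lemma lapD (g h : T -> R) x : C2_torus g -> C2_torus h ->
  lap (fun y => g y + h y) x = lap g x + lap h x.
Proof.
move=> cg ch; rewrite /lap -big_split/=; apply: eq_bigr => i _; rewrite !partial2E.
rewrite derive_torusD; [|exact: C2_torus_diff|exact: C2_torus_diff].
by rewrite derive_torusD//; exact: C2_torus_diff_derive.
Qed.

Lemma lapZ (k : R) (g : T -> R) x : C2_torus g -> lap (fun y => k * g y) x = k * lap g x.
Proof.
move=> cg; rewrite /lap mulr_sumr; apply: eq_bigr => i _; rewrite !partial2E.
rewrite derive_torusZ; last exact: C2_torus_diff.
by rewrite derive_torusZ//; exact: C2_torus_diff_derive.
Qed.

Lemma C1D F (G : V -> R^o) : C1 F -> C1 G -> C1 (F + G).
Proof.
move=> [dF cF] [dG cG]; split => [x|v]; first exact: differentiableD.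
have -> : 'D_v (F + G) = 'D_v F + 'D_v G.
  by apply/funext => x; rewrite deriveD//; exact: diff_derivable.
by move=> x; apply: continuousD; [exact: cF|exact: cG].
Qed.

Lemma C1Z (k : R) F : C1 F -> C1 (k \*: F).
Proof.
move=> [dF cF]; split => [x|v]; first exact: differentiableZ.
have -> : 'D_v (k \*: F) = k \*: 'D_v F.
  by apply/funext => x; rewrite deriveZ//; exact: diff_derivable.
by move=> x; apply: continuousZl_tmp; exact: cF.
Qed.

Lemma C2_torusD (g h : T -> R) : C2_torus g -> C2_torus h -> C2_torus (fun x => g x + h x).
Proof.
move=> [g1 g2] [h1 h2]; split; first exact: C1D.
move=> v; have -> : 'D_v (lift_torus (fun x => g x + h x)) =
    'D_v (lift_torus g) + 'D_v (lift_torus h).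
  apply/funext => x; case: g1 h1 => dg _ [dh _].
  transitivity ('D_v (lift_torus g) x + 'D_v (lift_torus h) x); last by [].
  by rewrite -deriveD//; exact: diff_derivable.
exact: C1D.
Qed.

Lemma C2_torusZ (k : R) (g : T -> R) : C2_torus g -> C2_torus (fun x => k * g x).
Proof.
move=> [g1 g2]; split; first exact: (@C1Z k (lift_torus g)).
move=> v; have -> : 'D_v (lift_torus (fun x => k * g x)) = k \*: 'D_v (lift_torus g).
  apply/funext => x; case: g1 => dg _.
  by rewrite /= -deriveZ//; exact: diff_derivable.
exact: C1Z.
Qed.

End Differentiation.

Section DiffConvex.
Variables (R : realType) (d : nat).
Local Notation V := 'rV[R]_d.

Lemma convex_gradient_ineq (F : V -> R) (p q : V) :
  convex_function [set: convex_lmodType V] F -> differentiable F p ->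
  dot (\row_i 'D_(base R i) F p) (q - p) <= F q - F p.
Proof.
move=> cF dF.
have -> : dot (\row_i 'D_(base R i) F p) (q - p) = 'D_(q - p) F p.
  by rewrite derive_sum_base// /dot; apply: eq_bigr => i _; rewrite mxE mulrC.
have dFv := diff_derivable (v := q - p) dF.
(* Convexity bounds the quotients only for steps in ]0, 1], hence the one-sided limit. *)
have cv : h^-1 *: (F (h *: (q - p) + p) - F p) @[h --> 0^'+] --> 'D_(q - p) F p.
  exact: cvg_dnbhs_at_right dFv.
apply: (cvgr_to_le cv).
near=> s; have s0 : 0 < s by near: s; exact: nbhs_right_gt.
have s1 : s <= 1 by near: s; exact: nbhs_right_le.
have h : F (s *: q + (1 - s) *: p) <= s * F q + (1 - s) * F p.
  exact: (cF (Itv01 (ltW s0) s1) q p (mem_set Logic.I) (mem_set Logic.I)).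
rewrite /GRing.scale/= mulrC ler_pdivrMr//.
have -> : s *: (q - p) + p = s *: q + (1 - s) *: p.
  by rewrite scalerBr scalerBl scale1r -addrA [- _ + p]addrC.
rewrite -subr_ge0; move: h; rewrite -subr_ge0; congr (0 <= _).
by rewrite /GRing.scale/=; ring.
Unshelve. all: by end_near. Qed.

End DiffConvex.

(** * Smoothness of trigonometric series *)

Section TrigSeries.
Variables (R : realType) (d : nat).
Local Notation V := 'rV[R]_d.

(** The domination is normalised so that the dominating series sums to [C] itself, and bounds on
    terms become bounds on sums with the same constant. *)
Definition geom_bounded (C : R) (u : nat -> R) : Prop := forall j, `|u j| <= C / (2 ^ j.+1)%:R.

Lemma geom_series_cvg (C : R) : series (fun k => C / (2 ^ k.+1)%:R : R) @ \oo --> C.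
Proof.
have := @cvg_geometric_series_half R C 0; rewrite expr0 divr1.
by under [X in series X @ _ --> _ -> _]funext => k do rewrite addn1.
Qed.

Lemma geom_bounded_cvg C u : geom_bounded C u -> cvgn (series u) /\ `|limn (series u)| <= C.
Proof.
move=> uC; have cC := @geom_series_cvg C.
have cn : cvgn [normed series u].
  apply: (@series_le_cvg R _ (fun k => C / (2 ^ k.+1)%:R)) => [n|n|n|].
  - exact: normr_ge0.
  - exact: le_trans (normr_ge0 _) (uC n).
  - exact: uC.
  - exact: cvgP cC.
split; first exact: (@normed_cvg R R^o u cn).
rewrite (le_trans (@lim_series_norm R R^o u cn))// -(cvg_lim (@Rhausdorff R) cC).
by apply: lim_series_le => //; exact: cvgP cC.
Qed.

Definition sumS (u : nat -> R) : R := limn (series u).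

Lemma sumS_le C u : geom_bounded C u -> `|sumS u| <= C.
Proof. by case/geom_bounded_cvg. Qed.

Lemma sumSD C C' u v : geom_bounded C u -> geom_bounded C' v ->
  sumS (fun j => u j + v j) = sumS u + sumS v.
Proof. by move=> /geom_bounded_cvg[cu _] /geom_bounded_cvg[cv _]; exact: lim_seriesD. Qed.

Lemma sumSZ C (k : R) u : geom_bounded C u -> sumS (fun j => k * u j) = k * sumS u.
Proof.
move=> /geom_bounded_cvg[cu _]; apply: cvg_lim => //.
rewrite (_ : series _ = fun n => k * series u n).
  by apply: cvgM; [exact: cvg_cst|exact: cu].
by apply/funext => n; rewrite /series/= mulr_sumr.
Qed.

Lemma geom_boundedD C C' u v : geom_bounded C u -> geom_bounded C' v ->
  geom_bounded (C + C') (fun j => u j + v j).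
Proof.
by move=> uC vC j; rewrite mulrDl (le_trans (ler_normD _ _))// lerD.
Qed.

Lemma geom_boundedZ C (k : R) u : geom_bounded C u -> geom_bounded (`|k| * C) (fun j => k * u j).
Proof. by move=> uC j; rewrite normrM -mulrA ler_wpM2l. Qed.

Lemma sumSB C C' u v : geom_bounded C u -> geom_bounded C' v ->
  sumS (fun j => u j - v j) = sumS u - sumS v.
Proof. by move=> /geom_bounded_cvg[cu _] /geom_bounded_cvg[cv _]; exact: lim_seriesB. Qed.

Lemma geom_boundedW C u v : geom_bounded C u -> (forall j, `|v j| <= `|u j|) -> geom_bounded C v.
Proof. by move=> uC vu j; rewrite (le_trans (vu j)). Qed.

Lemma sumS_ge C u n : geom_bounded C u -> (forall j, 0 <= u j) -> u n <= sumS u.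
Proof.
move=> /geom_bounded_cvg[cu _] u0.
have nd : nondecreasing_seq (series u).
  by apply/nondecreasing_seqP => m; rewrite -subr_ge0 seriesSB.
rewrite (le_trans _ (nondecreasing_cvgn_le nd cu n.+1))// /series/= big_nat_recr//=.
by rewrite lerDr sumr_ge0.
Qed.

Lemma sumS_sum (I : Type) (s : seq I) (u : I -> nat -> R) :
  (forall i, exists C, geom_bounded C (u i)) ->
  sumS (fun j => \sum_(i <- s) u i j) = \sum_(i <- s) sumS (u i).
Proof.
move=> uC; suff [] : (exists C', geom_bounded C' (fun j => \sum_(i <- s) u i j)) /\
  sumS (fun j => \sum_(i <- s) u i j) = \sum_(i <- s) sumS (u i) by [].
elim: s => [|i s [[C' ihC] ih]].
  have -> : (fun j => \sum_(i <- [::]) u i j) = fun=> 0.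
    by apply/funext => j; rewrite big_nil.
  rewrite big_nil; split; first by exists 0 => j; rewrite normr0 mul0r.
  rewrite /sumS (_ : series _ = cst 0) ?lim_cst//.
  by apply/funext => n; rewrite /series/= big1.
have -> : (fun j => \sum_(i0 <- i :: s) u i0 j) = fun j => u i j + \sum_(i0 <- s) u i0 j.
  by apply/funext => j; rewrite big_cons.
have [C uiC] := uC i.
rewrite big_cons -ih; split; first by exists (C + C'); exact: geom_boundedD.
exact: (sumSD uiC ihC).
Qed.

Lemma cos_dist_le (x y : R) : `|cos x - cos y| <= `|x - y|.
Proof.
wlog xy : x y / x <= y => [h|].
  by have [/h//|/ltW /h] := leP x y; rewrite distrC [leRHS]distrC.
have [c _] := @MVT_segment R cos (fun t => - sin t) x y xy
  (fun t _ => is_derive_cos t) (continuous_subspaceT (@continuous_cos R)).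
rewrite distrC => ->; rewrite normrM distrC normrN ler_piMl//.
by rewrite ler_norml sin_geN1 sin_le1.
Qed.

(** The derivative of cosine is written as a phase shift by [pi / 2], so that differentiated series
    keep the form of [trig_series]. *)
Lemma cos_taylor (x h : R) : `|cos (x + h) - cos x - h * cos (x + pi / 2)| <= h ^+ 2.
Proof.
have E (t : R) : cos (t + pi / 2) = - sin t by rewrite cosDpihalf.
have sin_dist (s t : R) : `|sin s - sin t| <= `|s - t|.
  rewrite -!cosBpihalf (le_trans (cos_dist_le _ _))//.
  by rewrite opprB addrA subrK.
have [c [cx E2]] : exists c : R, `|c - x| <= `|h| /\ cos (x + h) - cos x = h * - sin c.
  have [h0|h0] := leP 0 h.
    have [c] := @MVT_segment R cos (fun t => - sin t) x (x + h) (ler_wpDr h0 (lexx x))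
      (fun t _ => is_derive_cos t) (continuous_subspaceT (@continuous_cos R)).
    rewrite in_itv/= => /andP[xc cxh] E2; exists c; split; last by rewrite E2; ring.
    by rewrite !ger0_norm ?subr_ge0// lerBlDl.
  have [|c] := @MVT_segment R cos (fun t => - sin t) (x + h) x _
    (fun t _ => is_derive_cos t) (continuous_subspaceT (@continuous_cos R)).
    by rewrite gerDl ltW.
  rewrite in_itv/= => /andP[xc cxh] E2; exists c; split.
    by rewrite ler0_norm ?subr_le0// ltr0_norm//; lra.
  by rewrite -[LHS]opprB E2; ring.
rewrite E2 E -mulrBr normrM -[leRHS]real_normK ?num_real// expr2 ler_wpM2l//.
by rewrite opprK addrC (le_trans (sin_dist _ _))// distrC.
Qed.

Variables (l : nat -> V) .

Let L j := norm1 (l j).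

(** Each differentiation multiplies a coefficient by a linear form of its frequency and costs one
    power of [m]; the quadratic Taylor remainder costs two. *)
Definition decay (m : nat) (a : nat -> R) : Prop :=
  exists C, geom_bounded C (fun j => a j * (1 + L j) ^+ m).

Definition trig_series (a th : nat -> R) (x : V) : R :=
  sumS (fun j => a j * cos (dot (l j) x + th j)).

Let L1 j m : 1 <= (1 + L j) ^+ m.
Proof. by rewrite exprn_ege1// lerDl norm1_ge0. Qed.

Lemma decayS m a : decay m.+1 a -> decay m a.
Proof.
move=> [C aC]; exists C; apply: geom_boundedW aC _ => j.
rewrite !normrM ler_wpM2l// exprS normrM ler_peMl// ger0_norm ?lerDl ?norm1_ge0//.
by rewrite addr_ge0 ?norm1_ge0.
Qed.

Lemma decay_bounded m a : decay m a -> exists C, geom_bounded C a.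
Proof.
move=> [C aC]; exists C; apply: geom_boundedW aC _ => j.
by rewrite normrM ler_peMr// ger0_norm// (le_trans _ (L1 j m)).
Qed.

Lemma decay_dot m a (v : V) : decay m.+1 a -> decay m (fun j => a j * dot (l j) v).
Proof.
move=> [C aC]; exists (`|v| * C) => j.
have p0 : 0 <= 1 + L j by rewrite addr_ge0 ?norm1_ge0.
have h1 : `|dot (l j) v| <= (1 + L j) * `|v|.
  by rewrite (le_trans (dot_le_norm _ _))// ler_wpM2r// lerDr.
rewrite !normrM; apply: (@le_trans _ _ (`|v| * (`|a j| * ((1 + L j) * `|(1 + L j) ^+ m|)))).
  rewrite (_ : `|v| * _ = `|a j| * ((1 + L j) * `|v|) * `|(1 + L j) ^+ m|); last by ring.
  by rewrite ler_wpM2r// ler_wpM2l.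
rewrite -mulrA ler_wpM2l//; have := aC j.
by rewrite normrM exprS normrM [`|1 + L j|]ger0_norm.
Qed.

Lemma geom_bounded_cos C a th x : geom_bounded C a ->
  geom_bounded C (fun j => a j * cos (dot (l j) x + th j)).
Proof. by move=> aC; apply: geom_boundedW aC _ => j; rewrite normrM ler_piMr// cos_max. Qed.

(** Summing [cos_taylor] over the terms bounds the remainder by a constant times the square of the
    increment, the squared frequencies being absorbed by [decay 2]. *)
Lemma trig_series_diff a th (x : V) : decay 2 a ->
  differentiable (trig_series a th : V -> R^o) x /\
  forall v, 'D_v (trig_series a th : V -> R^o) x =
    trig_series (fun j => a j * dot (l j) v) (fun j => th j + pi / 2) x.
Proof.
move=> da.
have [C0 aC0] := decay_bounded da.
have bT v : exists C, geom_bounded C (fun j => a j * dot (l j) v * cos (dot (l j) x + (th j + pi / 2))).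
  have [C hC] := decay_bounded (decay_dot v (decayS (m := 1) da)).
  by exists C; exact: geom_bounded_cos hC.
have E v : dot (\row_i trig_series (fun j => a j * dot (l j) (base R i)) (fun j => th j + pi / 2) x) v =
    trig_series (fun j => a j * dot (l j) v) (fun j => th j + pi / 2) x.
  rewrite {1}/dot; under eq_bigr => i _.
    rewrite mxE mulrC /trig_series; have [Ci hCi] := bT (base R i).
    rewrite -(sumSZ (v ord0 i) hCi); over.
  rewrite -sumS_sum; last first.
    by move=> i; have [Ci hCi] := bT (base R i); eexists; exact: (geom_boundedZ (v ord0 i) hCi).
  congr sumS; apply/funext => j.
  rewrite [in RHS](row_base_sum v) linear_sum/= mulr_sumr mulr_suml; apply: eq_bigr => i _.
  have -> : dot (l j) (v ord0 i *: base R i) = v ord0 i * dot (l j) (base R i).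
    exact: linearZ.
  by ring.
have [C aC] := da.
have [|dT DT] := @differentiable_dot R d (trig_series a th) x
  (\row_i trig_series (fun j => a j * dot (l j) (base R i)) (fun j => th j + pi / 2) x) C.
  move=> h; rewrite E /trig_series.
  have [C1 hC1] := bT h.
  have hB := sumSB (geom_bounded_cos th (x + h) aC0) (geom_bounded_cos th x aC0).
  have gB : geom_bounded (C0 + `|-1| * C0) (fun j => a j * cos (dot (l j) (x + h) + th j) -
      a j * cos (dot (l j) x + th j)).
    have := geom_boundedD (geom_bounded_cos th (x + h) aC0)
      (geom_boundedZ (-1) (geom_bounded_cos th x aC0)).
    by under [X in geom_bounded _ X -> _]funext => j do rewrite mulN1r.
  rewrite -hB -(sumSB gB hC1).
  apply: sumS_le => j.
  rewrite (_ : _ - _ = a j * (cos (dot (l j) x + th j + dot (l j) h) - cos (dot (l j) x + th j) -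
    dot (l j) h * cos (dot (l j) x + th j + pi / 2))); last first.
    by rewrite dotDr [dot (l j) x + dot _ h + _]addrAC addrA; ring.
  have p0 : 0 <= 1 + L j by rewrite addr_ge0 ?norm1_ge0.
  have h2 : dot (l j) h ^+ 2 <= (1 + L j) ^+ 2 * `|h| ^+ 2.
    rewrite -exprMn -real_normK ?num_real// lerXn2r ?nnegrE// ?mulr_ge0//.
    by rewrite (le_trans (dot_le_norm _ _))// ler_wpM2r// lerDr.
  rewrite normrM (le_trans (ler_wpM2l _ (le_trans (cos_taylor _ _) h2)))//.
  rewrite mulrA [leRHS]mulrAC ler_wpM2r ?sqr_ge0//.
  by have := aC j; rewrite normrM [`|(1 + L j) ^+ 2|]ger0_norm// sqr_ge0.
by split=> // v; rewrite DT E.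
Qed.

Lemma trig_series_C1 a th : decay 3 a -> C1 (trig_series a th : V -> R^o).
Proof.
move=> da; split=> [x|v]; first by have [] := trig_series_diff th x (decayS da).
have -> : 'D_v (trig_series a th : V -> R^o) =
    trig_series (fun j => a j * dot (l j) v) (fun j => th j + pi / 2).
  by apply/funext => x; have [_] := trig_series_diff th x (decayS da).
move=> x; apply: (@differentiable_continuous _ _ R^o).
by have [] := trig_series_diff (fun j => th j + pi / 2) x (decay_dot v da).
Qed.

Lemma trig_series_C2 a th : decay 4 a -> C2 (trig_series a th : V -> R^o).
Proof.
move=> da; split=> [|v]; first exact: trig_series_C1 (decayS da).
have -> : 'D_v (trig_series a th : V -> R^o) =
    trig_series (fun j => a j * dot (l j) v) (fun j => th j + pi / 2).
  by apply/funext => x; have [_] := trig_series_diff th x (decayS (decayS da)).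
by apply: trig_series_C1; exact: decay_dot.
Qed.

End TrigSeries.

(** * The Fourier energy of a measure and its linearisation *)

Section Perturbation.
Variables (R : realType) (d : nat).
Local Notation T := (torus R d).
Local Notation V := 'rV[R]_d.
Local Notation P := (prob R d).
Local Notation freq := {ffun 'I_d -> int}.
Implicit Types (m : P) (x y : T).

(* Indices outside the range of [pickle] give the constant character. *)
Definition char_index (j : nat) : freq * bool :=
  odflt (0, false) (unpickle j : option (freq * bool)).
Definition char_freq j : V := freq_vec R (char_index j).1.
Definition char_phase j : R := - ((char_index j).2%:R * (pi / 2)).
Definition char_fun j : T -> R := character (char_index j).1 (char_phase j).
(* The fourth power leaves the series summable after the differentiations and
   quadratic remainders needed for [C^2]. *)
Definition char_weight j : R := (2 ^ j.+1)%:R^-1 / (1 + norm1 (char_freq j)) ^+ 4.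
Definition char_coef m j : R := \int[m]_x char_fun j x.

Lemma char_fun_bmeas j : bmeas (char_fun j : btorus R d -> R).
Proof. exact: character_bmeas. Qed.

Lemma char_coef_le1 m j : `|char_coef m j| <= 1.
Proof. by apply: int_norm_le => [|x]; [exact: char_fun_bmeas|exact: character_le1]. Qed.

Let p1 j : 1 <= 1 + norm1 (char_freq j). Proof. by rewrite lerDl norm1_ge0. Qed.
Let p0 j : 0 < 1 + norm1 (char_freq j). Proof. exact: lt_le_trans (p1 j). Qed.

Lemma char_weight_gt0 j : 0 < char_weight j.
Proof. by rewrite divr_gt0 ?invr_gt0 ?ltr0n ?expn_gt0// exprn_gt0. Qed.

Lemma char_weight_decay k (K : R) (c : nat -> R) : (k <= 4)%N -> 0 <= K ->
  (forall j, `|c j| <= K * (1 + norm1 (char_freq j)) ^+ k) ->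
  geom_bounded K (fun j => char_weight j * c j).
Proof.
move=> k4 K0 ck j; rewrite normrM (gtr0_norm (char_weight_gt0 j)) /char_weight.
rewrite -mulrA mulrC ler_wpM2r ?invr_ge0//.
rewrite ler_pdivrMl ?exprn_gt0// mulrC (le_trans (ck j))//.
by rewrite ler_wpM2l//; exact: ler_weXn2l.
Qed.

(** Half the first variation of [energy] at [m0]. *)
Definition perturbation m0 x : R := sumS (fun j => char_weight j * char_coef m0 j * char_fun j x).

Let pcoef m0 j : R := char_weight j * char_coef m0 j.

Lemma lift_perturbation m0 :
  lift_torus (perturbation m0) = trig_series char_freq (pcoef m0) char_phase.
Proof.
apply/funext => a; congr sumS; apply/funext => j.
by rewrite /char_fun characterE.
Qed.

Lemma pcoef_decay m0 : decay char_freq 4 (pcoef m0).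
Proof.
exists 1; rewrite /pcoef.
have -> : (fun j => char_weight j * char_coef m0 j * (1 + norm1 (char_freq j)) ^+ 4) =
  (fun j => char_weight j * (char_coef m0 j * (1 + norm1 (char_freq j)) ^+ 4)).
  by apply/funext => j; rewrite mulrA.
apply: (@char_weight_decay 4) => // j; rewrite mul1r normrM [X in _ * X]ger0_norm ?exprn_ge0 ?(ltW (p0 j))//.
by rewrite ler_piMl ?exprn_ge0 ?(ltW (p0 j))// char_coef_le1.
Qed.

Lemma perturbation_C2 m0 : C2_torus (perturbation m0).
Proof. by rewrite /C2_torus lift_perturbation; apply: trig_series_C2; exact: pcoef_decay. Qed.

Lemma dot_base_le (A : V) i : `|dot A (base R i)| <= 1 + norm1 A.
Proof.
rewrite /dot (bigD1 i)//= big1 ?addr0; last first.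
  by move=> j ji; rewrite mxE eqxx (negbTE ji) mulr0.
rewrite mxE !eqxx mulr1 (@le_trans _ _ (norm1 A))// ?lerDr//.
by rewrite /norm1 (bigD1 i)//= lerDl sumr_ge0.
Qed.

(** The bound is uniform in [m0], as it must be: the cost of the perturbation is fixed before the
    minimum point is known. *)
Lemma perturbation_partial1_le m0 i x : `|partial1 i (perturbation m0) x| <= 1.
Proof.
rewrite /partial1 lift_perturbation.
have d2 := decayS (decayS (pcoef_decay m0)).
have [_ ->] := trig_series_diff char_phase (repr x) d2.
apply: sumS_le; apply: geom_bounded_cos.
have -> : (fun j => pcoef m0 j * dot (char_freq j) (base R i)) =
  (fun j => char_weight j * (char_coef m0 j * dot (char_freq j) (base R i))).
  by apply/funext => j; rewrite mulrA.
apply: (@char_weight_decay 1) => // j; rewrite normrM expr1.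
by rewrite ler_pM// ?char_coef_le1// dot_base_le.
Qed.

Lemma perturbation_partial2_le m0 i k x : `|partial2 i k (perturbation m0) x| <= 1.
Proof.
rewrite /partial2 lift_perturbation.
have d3 := decayS (pcoef_decay m0).
have -> : 'D_(base R k) (trig_series char_freq (pcoef m0) char_phase : V -> R^o) =
    trig_series char_freq (fun j => pcoef m0 j * dot (char_freq j) (base R k))
      (fun j => char_phase j + pi / 2).
  by apply/funext => a; have [_] := trig_series_diff char_phase a (decayS d3).
have [_ ->] := trig_series_diff (fun j => char_phase j + pi / 2) (repr x) (decay_dot (base R k) d3).
apply: sumS_le; apply: geom_bounded_cos.
have -> : (fun j => pcoef m0 j * dot (char_freq j) (base R k) * dot (char_freq j) (base R i)) =
  (fun j => char_weight j * (char_coef m0 j * dot (char_freq j) (base R k) * dot (char_freq j) (base R i))).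
  by apply/funext => j; rewrite /pcoef; ring.
apply: (@char_weight_decay 2) => // j; rewrite !normrM expr2 -mulrA.
by rewrite ler_pM// ?char_coef_le1// ?mulr_ge0// ler_pM// dot_base_le.
Qed.

Definition energy m : R := sumS (fun j => char_weight j * char_coef m j ^+ 2).

Let gb_sq m : geom_bounded 1 (fun j => char_weight j * char_coef m j ^+ 2).
Proof.
by apply: (@char_weight_decay 0) => // j; rewrite mul1r expr0 normrX exprn_ile1 ?char_coef_le1.
Qed.

Let gb_mul m m0 : geom_bounded 1 (fun j => char_weight j * (char_coef m0 j * char_coef m j)).
Proof.
by apply: (@char_weight_decay 0) => // j; rewrite mul1r expr0 normrM mulr_ile1// char_coef_le1.
Qed.

Lemma energy_ge0 m : 0 <= energy m.
Proof.
apply: le_trans (sumS_ge 0 (gb_sq m) _).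
  by rewrite mulr_ge0 ?sqr_ge0// ltW// char_weight_gt0.
by move=> j; rewrite mulr_ge0 ?sqr_ge0// ltW// char_weight_gt0.
Qed.

Lemma energy_le1 m : energy m <= 1.
Proof. by rewrite (le_trans (ler_norm _))// sumS_le. Qed.

Lemma geom_partial_le (C : R) u n : geom_bounded C u -> `|series u n| <= C.
Proof.
move=> uC; have cC := @geom_series_cvg R C.
apply: (@le_trans _ _ (series (fun k => C / (2 ^ k.+1)%:R) n)).
  by rewrite /series/= (le_trans (ler_norm_sum _ _ _))// ler_sum.
have nd : nondecreasing_seq (series (fun k => C / (2 ^ k.+1)%:R)).
  apply/nondecreasing_seqP => k; rewrite -subr_ge0 seriesSB.
  exact: le_trans (normr_ge0 _) (uC k).
by have := nondecreasing_cvgn_le nd (cvgP _ cC) n; rewrite (cvg_lim (@Rhausdorff R) cC).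
Qed.

(** Dominated convergence applies to the partial sums, which [geom_partial_le] bounds by 1. *)
Lemma int_perturbation m m0 : \int[m]_x perturbation m0 x =
  sumS (fun j => char_weight j * (char_coef m0 j * char_coef m j)).
Proof.
pose u x j := pcoef m0 j * char_fun j x.
have gu x : geom_bounded 1 (u x).
  have -> : u x = fun j => char_weight j * (char_coef m0 j * char_fun j x).
    by apply/funext => j; rewrite /u mulrA.
  apply: (@char_weight_decay 0) => // j.
  by rewrite mul1r expr0 normrM mulr_ile1// ?char_coef_le1// character_le1.
have bu j : bmeas (fun x : btorus R d => u x j) by apply: bmeasZ; exact: char_fun_bmeas.
have bp : bmeas (perturbation m0 : btorus R d -> R).
  by apply/continuous_bmeas/C2_torus_continuous/perturbation_C2.
have c1 : \int[m]_x series (u x) n @[n --> \oo] --> \int[m]_x perturbation m0 x.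
  apply: (@int_bounded_cvg R d m (fun n x => series (u x) n) _ 1) => //.
  - by move=> n; rewrite /series/=; exact: bmeas_sum.
  - by move=> n x; exact: geom_partial_le.
  - by move=> x; have [cu _] := geom_bounded_cvg (gu x); exact: cu.
have [c2 _] := geom_bounded_cvg (gb_mul m m0).
have E : (fun n => \int[m]_x series (u x) n) =
    series (fun j => char_weight j * (char_coef m0 j * char_coef m j)).
  apply/funext => n; rewrite /series/= int_sum//; apply: eq_bigr => j _.
  by rewrite /u intZ ?/pcoef -?mulrA//; exact: char_fun_bmeas.
by rewrite E in c1; rewrite (cvg_unique _ c1 c2).
Qed.

Lemma energy_polarization m m0 :
  energy m - 2 * \int[m]_x perturbation m0 x + energy m0 =
  sumS (fun j => char_weight j * (char_coef m j - char_coef m0 j) ^+ 2).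
Proof.
rewrite int_perturbation /energy.
rewrite -(sumSZ _ (gb_mul m m0)) -(sumSB (gb_sq m) (geom_boundedZ 2 (gb_mul m m0))).
have g1 : geom_bounded (1 + `|-1| * (`|2| * 1)) (fun j => char_weight j * char_coef m j ^+ 2 -
    2 * (char_weight j * (char_coef m0 j * char_coef m j))).
  have := geom_boundedD (gb_sq m) (geom_boundedZ (-1) (geom_boundedZ 2 (gb_mul m m0))).
  by under [X in geom_bounded _ X -> _]funext => j do rewrite mulN1r.
rewrite -(sumSD g1 (gb_sq m0)); congr sumS; apply/funext => j.
by ring.
Qed.

Let gb_diff m m0 : geom_bounded 4 (fun j => char_weight j * (char_coef m j - char_coef m0 j) ^+ 2).
Proof.
apply: (@char_weight_decay 0) => // j.
have h1 := char_coef_le1 m j; have h0 := char_coef_le1 m0 j.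
rewrite expr0 mulr1 ger0_norm ?sqr_ge0//.
move: h1 h0; rewrite !ler_norml => /andP[? ?] /andP[? ?]; nra.
Qed.

Lemma energy_polarization_ge0 m m0 :
  0 <= energy m - 2 * \int[m]_x perturbation m0 x + energy m0.
Proof.
have nn j : 0 <= char_weight j * (char_coef m j - char_coef m0 j) ^+ 2.
  by rewrite mulr_ge0 ?sqr_ge0// ltW// char_weight_gt0.
by rewrite energy_polarization (le_trans (nn 0%N))// (sumS_ge 0 (gb_diff m m0)).
Qed.

(** All weights are positive and [pickle] reaches every character, so a vanishing sum would force
    all the coefficients of the two measures to agree. *)
Lemma energy_polarization_gt0 m m0 : ~ same_prob m m0 ->
  0 < energy m - 2 * \int[m]_x perturbation m0 x + energy m0.
Proof.
move=> nm; have nn j : 0 <= char_weight j * (char_coef m j - char_coef m0 j) ^+ 2.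
  by rewrite mulr_ge0 ?sqr_ge0// ltW// char_weight_gt0.
rewrite lt_neqAle energy_polarization_ge0 andbT; apply/negP => /eqP E0.
apply: nm; apply: same_prob_characters => k b.
have := sumS_ge (pickle (k, b)) (gb_diff m m0) nn.
rewrite -energy_polarization -E0 pmulr_rle0 ?char_weight_gt0// => h.
have : char_coef m (pickle (k, b)) - char_coef m0 (pickle (k, b)) = 0.
  by apply/eqP; rewrite -sqrf_eq0 eq_le h sqr_ge0.
move=> /subr0_eq; rewrite /char_coef /char_fun /char_phase /char_index pickleK /=.
by [].
Qed.

(** [dprob] is a supremum, without absolute value, over 1-Lipschitz functions; [phi] is divided by
    [L] and used with both signs. *)
Lemma int_lipschitz_ball (phi : T -> R) (L e : R) m m' : 0 < L ->
  (forall x y, `|phi x - phi y| <= L * torus_dist x y) -> prob_ball m e m' ->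
  `|\int[m]_x phi x - \int[m']_x phi x| <= L * e.
Proof.
move=> L0 lphi mm'.
have bphi : bmeas (phi : btorus R d -> R) by exact/continuous_bmeas/(lipschitz_continuous lphi).
have key (psi : T -> R) : (forall x y, `|psi x - psi y| <= torus_dist x y) ->
    \int[m]_x psi x - \int[m']_x psi x <= e.
  move=> lpsi; rewrite -lee_fin (le_trans _ (ltW mm'))//.
  by apply: ereal_sup_ubound; exists psi.
have l1 (k : R) : `|k| <= L^-1 -> forall x y, `|k * phi x - k * phi y| <= torus_dist x y.
  move=> kL x y; rewrite -mulrBr normrM (le_trans (ler_wpM2r _ kL))//.
  by rewrite ler_pdivrMl.
have iZ k (mm : P) : \int[mm]_x (k * phi x) = k * \int[mm]_x phi x by exact: intZ.
have L1 : 0 <= L^-1 by rewrite invr_ge0 ltW.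
have h1 : L^-1 * \int[m]_x phi x - L^-1 * \int[m']_x phi x <= e.
  by rewrite -!iZ; apply: key; apply: l1; rewrite ger0_norm.
have h2 : - L^-1 * \int[m]_x phi x - - L^-1 * \int[m']_x phi x <= e.
  by rewrite -!iZ; apply: key; apply: l1; rewrite normrN ger0_norm.
rewrite -(ler_pdivrMl _ _ L0).
have -> : L^-1 * `|\int[m]_x phi x - \int[m']_x phi x| =
    `|L^-1 * \int[m]_x phi x - L^-1 * \int[m']_x phi x|.
  by rewrite -mulrBr normrM [`|L^-1|]ger0_norm// invr_ge0 ltW.
by rewrite ler_norml; apply/andP; split; lra.
Qed.

Lemma char_coef_ball m e m' j : prob_ball m e m' ->
  `|char_coef m j - char_coef m' j| <= (1 + norm1 (char_freq j)) * e.
Proof.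
apply: int_lipschitz_ball; first exact: p0.
apply: lipschitz_torusP; first exact: ltW (p0 j).
move=> a b; rewrite /char_fun !characterE (le_trans (cos_dist_le _ _))//.
rewrite opprD addrACA subrr addr0 -dotBr (le_trans (dot_le_enorm _ _))//.
by rewrite ler_wpM2r ?enorm_ge0// lerDr.
Qed.

(** Coefficients are bounded by 1, so a squared coefficient varies by at most twice the variation of
    the coefficient; the weights absorb the frequency in [char_coef_ball]. *)
Lemma energy_ball m e m' : 0 < e -> prob_ball m e m' -> `|energy m - energy m'| <= 2 * e.
Proof.
move=> e0 mm'; rewrite /energy -(sumSB (gb_sq m) (gb_sq m')).
apply: sumS_le.
have -> : (fun j => char_weight j * char_coef m j ^+ 2 - char_weight j * char_coef m' j ^+ 2) =
    (fun j => char_weight j * (char_coef m j ^+ 2 - char_coef m' j ^+ 2)).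
  by apply/funext => j; rewrite mulrBr.
apply: (@char_weight_decay 1) => // [|j]; first by rewrite mulr_ge0// ltW.
rewrite expr1.
rewrite subr_sqr normrM.
have h := char_coef_ball j mm'.
have h2 : `|char_coef m j + char_coef m' j| <= 2.
  by rewrite (le_trans (ler_normD _ _))// -[leRHS]/(1 + 1) lerD// char_coef_le1.
by rewrite (le_trans (ler_pM _ _ h h2))//; lra.
Qed.

Lemma energy_continuous : continuous energy.
Proof.
move=> m; apply/(@cvgrPdist_le _ _ _ (nbhs m) _) => e e0.
have e2 : 0 < e / 2 by rewrite divr_gt0.
apply: filterS (nbhsx_ballx m (e / 2) e2) => m' mm'.
by rewrite (le_trans (energy_ball e2 mm'))//; lra.
Qed.

End Perturbation.

Lemma continuous_pair (X Y Z : topologicalType) (f : X -> Y) (g : X -> Z) :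
  continuous f -> continuous g -> continuous (fun t => (f t, g t)).
Proof. by move=> cf cg x; exact: (cvg_pair (cf x) (cg x)). Qed.

Lemma continuous_compT (X Y Z : topologicalType) (f : X -> Y) (g : Y -> Z) :
  continuous f -> continuous g -> continuous (fun t => g (f t)).
Proof. by move=> cf cg x; exact: (continuous_comp (cf x) (cg (f x))). Qed.

Lemma continuous_fst (X Y : topologicalType) : continuous (@fst X Y).
Proof. by move=> x; exact: cvg_fst. Qed.

Lemma continuous_snd (X Y : topologicalType) : continuous (@snd X Y).
Proof. by move=> x; exact: cvg_snd. Qed.

(** * The Hamiltonian *)

Section Hamiltonian.
Variables (R : realType) (d : nat) (H : torus R d -> 'rV[R]_d -> R).
Hypothesis HC1 : hamiltonian_C1 H.
Local Notation T := (torus R d).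
Local Notation V := 'rV[R]_d.
Implicit Types (u : T -> R) (p : V) (x : T).

Let Hl (z : V * V) : R^o := H (proj_torus z.1) z.2.

Let Hl_diff z : differentiable Hl z. Proof. by have [] := HC1. Qed.

Lemma hamiltonian_diff x p : differentiable (H x : V -> R^o) p.
Proof.
have -> : (H x : V -> R^o) = Hl \o (fun q : V => (repr x, q)).
  by apply/funext => q; rewrite /Hl/= proj_repr.
apply: differentiable_comp; last exact: Hl_diff.
by apply: differentiable_pair; [exact: differentiable_cst|exact: ex_diff].
Qed.

Lemma DpH_lift (a p : V) i : DpH H (proj_torus a) p ord0 i = 'D_((0, base R i) : V * V) Hl (a, p).
Proof.
rewrite mxE.
have E : (fun h : R => h^-1 *: ((H (proj_torus a) \o shift p) (h *: base R i) - H (proj_torus a) p)) =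
   (fun h : R => h^-1 *: ((Hl \o shift (a, p)) (h *: ((0, base R i) : V * V)) - Hl (a, p))).
  by apply/funext => h; rewrite /Hl/= scaler0 add0r.
by rewrite /derive E.
Qed.

Lemma DpH_continuous i : continuous (fun z : V * V => DpH H (proj_torus z.1) z.2 ord0 i).
Proof.
have -> : (fun z : V * V => DpH H (proj_torus z.1) z.2 ord0 i) = 'D_((0, base R i) : V * V) Hl.
  by apply/funext => -[a p]; exact: DpH_lift.
by have [_] := HC1; apply.
Qed.

(** Applied with [M] a bound on the gradients of a solution, this bounds its drift over all times
    and measures considered. The maximum is taken on the lift, over the unit cube times a cube of
    side [2 M]. *)
Lemma DpH_bounded (M : R) : 0 <= M -> exists2 B : R, 0 <= B &
  forall x p, (forall i, `|p ord0 i| <= M) -> \sum_i `|DpH H x p ord0 i| <= B.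
Proof.
move=> M0; pose A := [set v : V | forall i, v ord0 i \in `[0, 1]].
pose C := [set v : V | forall i, v ord0 i \in `[-M, M]].
have cA : compact A.
  have := @rV_compact R d (fun=> `[0, 1]%classic) (fun=> @segment_compact _ _ _).
  by congr compact; apply/seteqP; split => v h i; have := h i.
have cC : compact C.
  have := @rV_compact R d (fun=> `[-M, M]%classic) (fun=> @segment_compact _ _ _).
  by congr compact; apply/seteqP; split => v h i; have := h i.
pose g (z : V * V) : R := \sum_i `|DpH H (proj_torus z.1) z.2 ord0 i|.
have cg : continuous g.
  move=> z; apply: (@cvg_sumr _ R^o _ _ _ (nbhs z)) => i.
  by apply: (continuous_comp (@DpH_continuous i z)); exact: norm_continuous.
have ne : A `*` C !=set0.
  exists (0, 0); split => i /=; rewrite mxE in_itv/= ?lexx ?ler01//.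
  by rewrite oppr_le0 M0.
have [z _ zmax] := @compact_EVT_max _ R g _ ne (compact_setX cA cC)
  (continuous_subspaceT cg).
exists (g z); first by apply: sumr_ge0.
move=> x p pM; rewrite -(proj_repr x) -(proj_frac_part (repr x)).
apply: (zmax (_, p)); rewrite inE; split => i /=.
  by rewrite mxE in_itv/=; have /andP[-> /ltW ->] := frac_part_itv (repr x ord0 i).
by rewrite in_itv/= -ler_norml.
Qed.

Lemma grad_lift_continuous u : C2_torus u -> continuous (fun a : V => grad u (proj_torus a)).
Proof.
move=> cu; have -> : (fun a : V => grad u (proj_torus a)) =
    fun a => \sum_i partial1 i u (proj_torus a) *: base R i.
  by apply/funext => a; rewrite [LHS]row_base_sum; apply: eq_bigr => i _; rewrite mxE.
move=> a; apply: (@cvg_sumr _ _ _ _ _ (nbhs a)) => i.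
have c1 : continuous (fun a : V => partial1 i u (proj_torus a)).
  apply: (@continuous_compT V T R (@proj_torus R d) (partial1 i u)).
    exact: proj_torus_continuous.
  exact: partial1_continuous.
exact: (@continuous_compT V R V _ (fun t : R => t *: base R i) c1 (@scalel_continuous _ _ (base R i))).
Qed.

Let pair_grad_continuous u : C2_torus u -> continuous (fun a : V => (a, grad u (proj_torus a))).
Proof.
move=> cu; apply: (@continuous_pair V V V id); last exact: grad_lift_continuous.
by move=> a; exact: cvg_id.
Qed.

Lemma hamiltonian_grad_continuous u : C2_torus u -> continuous (fun x => H x (grad u x)).
Proof.
move=> cu; apply: continuous_torusP => a.
apply: (@continuous_comp _ _ _ (fun a : V => (a, grad u (proj_torus a))) Hl).
  exact: pair_grad_continuous.
exact: differentiable_continuous.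
Qed.

Lemma DpH_grad_continuous u i : C2_torus u -> continuous (fun x => DpH H x (grad u x) ord0 i).
Proof.
move=> cu; apply: continuous_torusP => a.
apply: (@continuous_comp _ _ _ (fun a : V => (a, grad u (proj_torus a)))
  (fun z : V * V => DpH H (proj_torus z.1) z.2 ord0 i)); first exact: pair_grad_continuous.
exact: DpH_continuous.
Qed.

Lemma transport_bmeas u (w : T -> R) : C2_torus u -> C2_torus w ->
  bmeas (fun x : btorus R d => dot (grad w x) (DpH H x (grad u x))).
Proof.
move=> cu cw; apply: bmeas_sum => i; apply: bmeasM; apply: continuous_bmeas.
  by under eq_fun do rewrite mxE; exact: partial1_continuous.
exact: DpH_grad_continuous.
Qed.

Lemma hamiltonian_bmeas u : C2_torus u -> bmeas (fun x : btorus R d => H x (grad u x)).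
Proof. by move=> cu; apply: continuous_bmeas; exact: hamiltonian_grad_continuous. Qed.

(** The tangent inequality at [grad u], tested at [grad v]: the transport term of the equation for
    [u] turns its Hamiltonian into that of [v]. *)
Lemma hamiltonian_convex_ineq u (v : T -> R) x : hamiltonian_convex H ->
  H x (grad u x) - dot (grad u x - grad v x) (DpH H x (grad u x)) <= H x (grad v x).
Proof.
move=> cH; have E : dot (grad u x - grad v x) (DpH H x (grad u x)) =
    - dot (DpH H x (grad u x)) (grad v x - grad u x).
  by rewrite /dot -sumrN; apply: eq_bigr => i _; rewrite !mxE; ring.
have : dot (DpH H x (grad u x)) (grad v x - grad u x) <= H x (grad v x) - H x (grad u x).
  exact: (convex_gradient_ineq (grad v x) (cH x) (hamiltonian_diff x (grad u x))).
by rewrite E; lra.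
Qed.

End Hamiltonian.

Lemma lap_bmeas (R : realType) (d : nat) (u : torus R d -> R) : C2_torus u ->
  bmeas (fun x : btorus R d => lap u x).
Proof.
by move=> cu; apply: bmeas_sum => i; apply: continuous_bmeas; exact: partial2_continuous.
Qed.

(** A tube lemma: continuity at each point [(x, y0)] becomes uniform in [x] by compactness. *)
Lemma compact_uniform_near (R : realType) (X Y : topologicalType) (f : X * Y -> R) (y0 : Y) (e : R) :
  compact [set: X] -> continuous f -> 0 < e ->
  \forall y \near y0, forall x, `|f (x, y) - f (x, y0)| <= e.
Proof.
move=> cX cf e0.
have e2 : 0 < e / 2 by rewrite divr_gt0.
have /compact_near_coveringP cov := cX.
suff h : forall x, [set: X] x -> \forall x' \near x & y \near nbhs y0,
    `|f (x', y) - f (x', y0)| <= e.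
  have := cov Y (nbhs y0) (fun y x => `|f (x, y) - f (x, y0)| <= e) (nbhs_filter y0) h.
  by apply: (@filterS _ (nbhs y0)) => y hy x; exact: hy.
move=> x _.
have /(@cvgrPdist_le _ _ _ (nbhs (x, y0)) _)/(_ _ e2) := cf (x, y0).
move=> [[A B] /= [Ax By] AB]; exists (A, B) => // -[x' y] /= [Ax' By'].
have h1 := AB (x', y) (conj Ax' By').
have h2 := AB (x', y0) (conj Ax' (nbhs_singleton By)).
rewrite (_ : f (x', y) - f (x', y0) =
  (f (x, y0) - f (x', y0)) - (f (x, y0) - f (x', y))); last by ring.
by rewrite (le_trans (ler_normB _ _))// [leRHS]splitr lerD.
Qed.

(** * Uniform bounds and continuity for functions of class [Bt] *)

Section Continuity.
Variables (R : realType) (d : nat).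
Local Notation T := (torus R d).
Local Notation P := (prob R d).
Implicit Types (U : R -> T -> P -> R).

(* [Bt] says nothing about negative times; freezing the value at time 0 gives a
   function continuous everywhere. *)
Definition extend0 U : R -> T -> P -> R := fun t x m => U (Num.max 0 t) x m.

Lemma extend0E U t : 0 <= t -> extend0 U t = U t.
Proof. by move=> t0; rewrite /extend0 max_r. Qed.

Lemma extend0_continuous U : Bt U ->
  continuous (fun z : R * T * P => extend0 U z.1.1 z.1.2 z.2).
Proof.
move=> [cU _ _] z.
pose r (z : R * T * P) := (Num.max 0 z.1.1, z.1.2, z.2).
have cr : continuous r.
  apply: continuous_pair; last exact: continuous_snd.
  apply: continuous_pair.
    apply: (@continuous_compT _ _ _ (fun z : R * T * P => z.1.1) (fun t => Num.max 0 t)).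
      exact: (continuous_compT (@continuous_fst _ _) (@continuous_fst _ _)).
    by move=> t; apply: continuous_max; [exact: cst_continuous|exact: cvg_id].
  exact: (continuous_compT (@continuous_fst _ _) (@continuous_snd _ _)).
have rA w : 0 <= (r w).1.1 by rewrite /r/= le_max lexx.
move/subspace_continuousP : cU => /(_ (r z) (rA z)) cUz.
move=> W Wz; have h := cr z _ (cUz W Wz).
by apply: (@filterS _ (nbhs z) _ _ _ _ h) => w /= /(_ (rA w)).
Qed.

Lemma Bt_bounds U (Tm : R) : Bt U -> 0 < Tm -> exists2 M : R, 0 <= M &
  forall t x m, 0 <= t <= Tm -> `|U t x m| <= M /\
    forall i, `|partial1 i (fun y => U t y m) x| <= M.
Proof.
move=> [_ _ bU] T0; have := bU _ T0.
set S := ereal_sup _ => Sfin.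
have sup0 (g : T -> R) : (0 <= supnorm g)%E.
  apply: le_trans (ereal_sup_ubound _); last by exists (proj_torus 0).
  by rewrite lee_fin.
have supx (g : T -> R) x : (`|g x|%:E <= supnorm g)%E.
  by apply: ereal_sup_ubound; exists x.
have S1 t m : 0 <= t <= Tm -> (C2norm (fun x => U t x m) <= S)%E.
  by move=> tT; apply: ereal_sup_ubound; exists (t, m).
have S0 : (0 <= S)%E.
  (* A Dirac mass shows that the supremum is over a nonempty family, hence not -oo. *)
  have [m _] : exists m : P, True by exists (dirac (proj_torus 0 : btorus R d)).
  apply: le_trans (S1 0 m _); last by rewrite lexx ltW.
  rewrite /C2norm !adde_ge0//; first by apply: sume_ge0.
  by apply: sume_ge0 => i _; apply: sume_ge0.
have SE : S = (fine S)%:E by rewrite fineK// ge0_fin_numE.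
exists (fine S); first exact: fine_ge0.
move=> t x m tT; have h := S1 t m tT.
have p1 : (0 <= \sum_(j < d) supnorm (partial1 j (fun y => U t y m)))%E by apply: sume_ge0.
have p2 : (0 <= \sum_(j < d) \sum_(k < d) supnorm (partial2 j k (fun y => U t y m)))%E.
  by apply: sume_ge0 => j _; apply: sume_ge0.
split=> [|i]; rewrite -lee_fin -SE; apply: (le_trans _ h); rewrite /C2norm.
  apply: (@le_trans _ _ (supnorm (fun y => U t y m))).
    exact: (supx (fun y => U t y m) x).
  by rewrite -addeA leeDl// adde_ge0.
apply: (@le_trans _ _ (\sum_(j < d) supnorm (partial1 j (fun y => U t y m)))%E).
  rewrite (bigD1 i)//=; apply: (@le_trans _ _ (supnorm (partial1 i (fun y => U t y m)))).
    exact: (supx (partial1 i (fun y => U t y m)) x).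
  by rewrite leeDl//; apply: sume_ge0.
apply: (@le_trans _ _ (supnorm (fun x => U t x m) +
  \sum_(j < d) supnorm (partial1 j (fun y => U t y m)))%E); first by rewrite leeDr.
by rewrite leeDl.
Qed.

Lemma Bt_C2 U t m : Bt U -> 0 <= t -> C2_torus (fun x => U t x m).
Proof. by move=> [_ c2 _] t0; exact: c2. Qed.

Lemma Bt_lipschitz U t m : Bt U -> 0 <= t ->
  exists2 L : R, 0 < L & forall x y, `|U t x m - U t y m| <= L * torus_dist x y.
Proof.
(* The horizon [t + 1] is positive even when [t] is 0. *)
move=> bU t0; have [M M0 MP] := Bt_bounds bU (ltr_wpDl t0 ltr01).
exists (d%:R * M + 1); first by rewrite ltr_wpDl// mulr_ge0.
move=> x y.
have h i z : `|partial1 i (fun y => U t y m) z| <= M.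
  by have [|_] := MP t z m; [rewrite t0 lerDl ler01|apply].
rewrite (le_trans (C2_torus_lipschitz (Bt_C2 m bU t0) M0 h x y))//.
by rewrite ler_wpM2r ?torus_dist_ge0// lerDl.
Qed.

Lemma Bt_bmeas U t m : Bt U -> 0 <= t -> bmeas (fun x : btorus R d => U t x m).
Proof. by move=> bU t0; apply: continuous_bmeas; apply: C2_torus_continuous; exact: Bt_C2. Qed.

(** The measure moves first, under a fixed Lipschitz integrand, which [d_1] controls; the integrand
    moves next, uniformly in [x] by compactness of the torus. *)
Lemma int_extend0_continuous U : Bt U ->
  continuous (fun z : R * P * P => \int[z.2]_x extend0 U z.1.1 x z.1.2).
Proof.
move=> bU [[t m] r]; apply/(@cvgrPdist_le _ _ _ (nbhs ((t, m), r)) _) => e e0 /=.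
have t0 s : 0 <= Num.max 0 s :> R by rewrite le_max lexx.
have [L L0 lU] := Bt_lipschitz m bU (t0 t).
pose f (z : T * (R * P)) := extend0 U z.2.1 z.1 z.2.2.
have cf : continuous f.
  apply: (@continuous_compT _ _ _ (fun z : T * (R * P) => ((z.2.1, z.1), z.2.2))
    (fun z : R * T * P => extend0 U z.1.1 z.1.2 z.2)); last exact: extend0_continuous.
  apply: continuous_pair.
    apply: continuous_pair; last exact: continuous_fst.
    exact: (continuous_compT (@continuous_snd _ _) (@continuous_fst _ _)).
  exact: (continuous_compT (@continuous_snd _ _) (@continuous_snd _ _)).
have e2 : 0 < e / 2 by rewrite divr_gt0.
have near1 := compact_uniform_near (t, m) (@torus_compact R d) cf e2.
have eL : 0 < e / 2 / L by rewrite divr_gt0.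
exists ([set z | forall x, `|f (x, z) - f (x, (t, m))| <= e / 2], ball r (e / 2 / L)).
  by split => //; exact: nbhsx_ballx.
move=> [[t' m'] r'] /= [h1 h2].
rewrite (_ : _ - _ = (\int[r]_x extend0 U t x m - \int[r']_x extend0 U t x m) +
  (\int[r']_x extend0 U t x m - \int[r']_x extend0 U t' x m')); last by rewrite addrA subrK.
rewrite (le_trans (ler_normD _ _))// [leRHS]splitr lerD//.
  have := int_lipschitz_ball L0 lU h2.
  by rewrite mulrCA divff ?gt_eqF// mulr1.
have b1 : bmeas (fun x : btorus R d => extend0 U t x m) by exact: (Bt_bmeas m bU (t0 t)).
have b2 : bmeas (fun x : btorus R d => extend0 U t' x m') by exact: (Bt_bmeas m' bU (t0 t')).
have h3 x : `|extend0 U t x m - extend0 U t' x m'| <= e / 2.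
  by rewrite distrC; exact: (h1 x).
by exact: (int_dist_le _ b1 b2 h3).
Qed.

Lemma Bt_uniform0 U (e : R) : Bt U -> 0 < e -> exists2 eta : R, 0 < eta &
  forall t x m, 0 <= t < eta -> `|U t x m - U 0 x m| <= e.
Proof.
move=> bU e0.
pose f (z : (T * P) * R) := extend0 U z.2 z.1.1 z.1.2.
have cf : continuous f.
  apply: (@continuous_compT _ _ _ (fun z : (T * P) * R => ((z.2, z.1.1), z.1.2))
    (fun z : R * T * P => extend0 U z.1.1 z.1.2 z.2)); last exact: extend0_continuous.
  apply: continuous_pair.
    apply: continuous_pair; first exact: continuous_snd.
    exact: (continuous_compT (@continuous_fst _ _) (@continuous_fst _ _)).
  exact: (continuous_compT (@continuous_fst _ _) (@continuous_snd _ _)).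
have cTP : compact [set: T * P].
  by rewrite -setXTT; apply: compact_setX; [exact: torus_compact|exact: prob_compact].
have /nbhs_ballP[eta /= eta0 etaP] := compact_uniform_near (0 : R) cTP cf e0.
exists eta => // t x m /andP[t0 te].
have := etaP t; rewrite /ball/= sub0r normrN ger0_norm// => /(_ te (x, m)).
by rewrite /f/= !extend0E.
Qed.

End Continuity.

Lemma horner_derivative_iter (R : realType) (p : {poly R}) n :
  (horner p)^`(n)%classic = horner p^`(n).
Proof. by elim: n => [|n ih]; rewrite ?derivn0// derive1nS ih -derivE derivnS. Qed.

Lemma smooth_halfline_horner (R : realType) (p : {poly R}) : smooth_halfline (horner p).
Proof.
split=> [|n]; first by apply: continuous_subspaceT; exact: continuous_horner.
rewrite horner_derivative_iter; split=> [t _|]; first exact: derivable_horner.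
apply: (cvgP (p^`(n)).[0]); apply: cvg_at_right_filter; exact: continuous_horner.
Qed.

(** * The inequality at a minimum *)

Section Viscosity.
Variables (R : realType) (d : nat) (sigma : R) (H : torus R d -> 'rV[R]_d -> R).
Variables (f U0 : torus R d -> prob R d -> R).
Hypotheses (hsigma : 0 < sigma) (HC1 : hamiltonian_C1 H) (Hconvex : hamiltonian_convex H).
Hypothesis fcont : continuous (fun z : torus R d * prob R d => f z.1 z.2).
Local Notation T := (torus R d).
Local Notation P := (prob R d).

Lemma source_bmeas m : bmeas (fun x : btorus R d => f x m).
Proof.
apply: continuous_bmeas.
apply: (@continuous_compT T (T * P)%type R (fun x => (x, m)) (fun z => f z.1 z.2)); last exact: fcont.
by apply: (@continuous_pair T T P id) => x; [exact: cvg_id|exact: cst_continuous].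
Qed.

Definition elliptic (u : T -> R) (x : T) : R := - sigma * lap u x + H x (grad u x).

Lemma elliptic_bmeas u : C2_torus u -> bmeas (fun x : btorus R d => elliptic u x).
Proof.
move=> cu; apply: bmeasD; last exact: (hamiltonian_bmeas HC1 cu).
by apply: bmeasZ; exact: lap_bmeas.
Qed.

Lemma dot_le_sum (p b : 'rV[R]_d) : (forall i, `|p ord0 i| <= 1) ->
  dot p b <= \sum_i `|b ord0 i|.
Proof.
move=> p1; apply: ler_sum => i _; rewrite (le_trans (ler_norm _))// normrM.
by rewrite -[leRHS]mul1r ler_wpM2r.
Qed.

Lemma dotBZl (k : R) (a b q : 'rV[R]_d) : dot (a - k *: b) q = dot a q - k * dot b q.
Proof.
by rewrite /dot mulr_sumr -sumrB; apply: eq_bigr => i _; rewrite !mxE; ring.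
Qed.

Lemma perturbation_lap_ge (m : P) (x : T) : - d%:R <= lap (perturbation m) x.
Proof.
have -> : - d%:R = \sum_(i < d) (-1) :> R by rewrite sumr_const card_ord mulNrn.
apply: ler_sum => i _; have := perturbation_partial2_le m i i x.
by rewrite ler_norml => /andP[].
Qed.

(** The left side is the density of all the terms of the viscosity inequality that are integrated
    against [mu0]. The Laplacians of [u] cancel, convexity replaces its Hamiltonian by that of [v],
    and the unit bounds on the derivatives of [perturbation m] leave the error
    [2 e (B + sigma d)]. *)
Lemma elliptic_perturbation (u v : T -> R) (m : P) (e B : R) (w : T -> R) x : C2_torus u -> C2_torus v ->
  0 < e -> \sum_i `|DpH H x (grad u x) ord0 i| <= B ->
  w = (fun y => u y - (v y + 2 * e * perturbation m y)) ->
  elliptic u x - dot (grad w x) (DpH H x (grad u x)) + sigma * lap w x <=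
  elliptic v x + 2 * e * (B + sigma * d%:R).
Proof.
move=> cu cv e0 hB wdef.
have cp := perturbation_C2 m.
have cz2 := C2_torusZ (2 * e) cp.
have cz := C2_torusD cv cz2.
have cz1 := C2_torusZ (-1) cz.
have wE : w = fun y => u y + (-1) * (v y + 2 * e * perturbation m y).
  by rewrite wdef; apply/funext => y; ring.
have gE : grad w x = grad u x - grad v x - (2 * e) *: grad (perturbation m) x.
  rewrite wE (gradD x cu cz1) (gradZ (-1) x cz) (gradD x cv cz2) (gradZ (2 * e) x cp).
  by rewrite scaleN1r opprD addrA.
have lE : lap w x = lap u x - lap v x - 2 * e * lap (perturbation m) x.
  rewrite wE (lapD x cu cz1) (lapZ (-1) x cz) (lapD x cv cz2) (lapZ (2 * e) x cp).
  by move: (lap u x) (lap v x) (lap _ x) => a b c; ring.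
have dE : dot (grad w x) (DpH H x (grad u x)) =
    dot (grad u x - grad v x) (DpH H x (grad u x)) -
    2 * e * dot (grad (perturbation m) x) (DpH H x (grad u x)).
  by rewrite gE dotBZl.
have h1 := hamiltonian_convex_ineq HC1 u v x Hconvex.
have h2 : dot (grad (perturbation m) x) (DpH H x (grad u x)) <= B.
  by apply: le_trans hB; apply: dot_le_sum => i; rewrite mxE perturbation_partial1_le.
have h3 : - sigma * lap (perturbation m) x <= sigma * d%:R.
  by rewrite mulNr -mulrN ler_wpM2l ?(ltW hsigma)// lerNl perturbation_lap_ge.
have h4 : 2 * e * (dot (grad (perturbation m) x) (DpH H x (grad u x)) -
    sigma * lap (perturbation m) x) <= 2 * e * (B + sigma * d%:R).
  rewrite ler_wpM2l ?mulr_ge0 ?(ltW e0)// -mulNr; exact: lerD.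
rewrite dE lE /elliptic; move: h1 h3 h4.
move: (lap u x) (lap v x) (lap _ x) (H x _) (H x _) (dot _ _) (dot _ _).
move=> a b c h1 h2' p q; clear; lra.
Qed.

Variable U : R -> T -> P -> R.
Hypothesis sol : monotone_solution sigma H f U0 U.

Let bU : Bt U. Proof. by have [] := sol. Qed.

(** The conclusion is deliberately asymmetric: convexity moves the elliptic operator from [U] to [v]
    under [mu0] and leaves it on [U] under [nu0]. Exchanging the two solutions then produces the
    opposite elliptic terms. *)
Lemma monotone_solution_at_min (v : T -> R) (Tm t0 s0 e g k B : R) (mu0 nu0 : P) :
  C2_torus v -> 0 < t0 <= Tm -> 0 < e ->
  (forall x, \sum_i `|DpH H x (grad (fun y => U t0 y mu0) x) ord0 i| <= B) ->
  let J (t : R) (m : P) := \int[m]_x (U t x m - v x) - \int[nu0]_x (U t x m - v x)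
                + g * t + k * (t - s0) ^+ 2 - e * energy m in
  (forall t m, 0 <= t <= Tm -> J t0 mu0 <= J t m) ->
  \int[mu0]_x f x mu0 - \int[nu0]_x f x mu0 <=
  - g - 2 * k * (t0 - s0) + \int[mu0]_x elliptic v x
  - \int[nu0]_x elliptic (fun x => U t0 x mu0) x + 2 * e * (B + sigma * d%:R).
Proof.
move=> cv /andP[t00 t0T] e0 hB J Jmin.
have cp := perturbation_C2 mu0.
have bv := continuous_bmeas (C2_torus_continuous cv).
have bp := continuous_bmeas (C2_torus_continuous cp).
pose phi x := v x + 2 * e * perturbation mu0 x.
have cphi : C2_torus phi := C2_torusD cv (C2_torusZ (2 * e) cp).
have bphi := continuous_bmeas (C2_torus_continuous cphi).
(* The test function of time reproduces the time terms of [J]; the extra square, with zero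
   derivative at [t0], makes the minimum strict in time. *)
pose p : {poly R} := - g *: 'X - k *: ('X - s0%:P) ^+ 2 - ('X - t0%:P) ^+ 2.
have pE t : p.[t] = - g * t - k * (t - s0) ^+ 2 - (t - t0) ^+ 2 by rewrite /p !hornerE.
have dpE : (horner p)^`()%classic t0 = - g - 2 * k * (t0 - s0).
  rewrite -derivE /p !(derivB, derivZ, derivX, deriv_exp, derivC, subr0, mul1r).
  by rewrite !hornerE/=; ring.
pose Q m := energy m - 2 * \int[m]_x perturbation mu0 x + energy mu0.
have Q0 : Q mu0 = 0.
  rewrite /Q int_perturbation /energy.
  under [X in sumS X - _ * sumS _]eq_fun do rewrite expr2.
  by under [X in _ - _ + sumS X]eq_fun do rewrite expr2; ring.
(* These are the terms of the test functional that depend neither on [t] nor on [m]. *)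
pose C := 2 * e * \int[nu0]_x perturbation mu0 x - e * energy mu0.
have testE t m : 0 <= t -> test_functional U phi (charge_of_prob nu0) (horner p) t m =
    J t m + e * Q m + (t - t0) ^+ 2 + C.
  move=> tp; have bu := Bt_bmeas m bU tp.
  have E (r : P) : \int[r]_x (U t x m - phi x) =
      \int[r]_x (U t x m - v x) - 2 * e * \int[r]_x perturbation mu0 x.
    rewrite -(intZ r _ bp) -intB//; [|exact: bmeasB|exact: bmeasZ].
    apply: eq_Rintegral => x _; rewrite /phi.
    by move: (U t x m) (v x) (perturbation _ x) => a b c; ring.
  rewrite /test_functional (@pairing_sub _ _ _ m nu0 (bmeasB bu bphi)).
  rewrite !E pE /J /Q /C.
  move: (\int[m]_x (U t x m - v x)) (\int[nu0]_x (U t x m - v x)) (energy m) (energy mu0).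
  move: (\int[m]_x perturbation mu0 x) (\int[nu0]_x perturbation mu0 x).
  by move=> a b c1 c2 c3 c4; ring.
have smin : strict_min (test_functional U phi (charge_of_prob nu0) (horner p)) Tm t0 mu0.
  move=> t m tT nn; have /andP[tp _] := tT.
  rewrite !testE ?(ltW t00)// Q0 mulr0 subrr expr0n/= !addr0 ltrD2r.
  have hJ := Jmin t m tT.
  have sq := sqr_ge0 (t - t0).
  have [sm|nsm] := pselect (same_prob m mu0).
    have : 0 < (t - t0) ^+ 2.
      by rewrite exprn_even_gt0//= subr_eq0; apply/eqP => tt; apply: nn.
    have : 0 <= e * Q m by rewrite mulr_ge0 ?(ltW e0)// energy_polarization_ge0.
    by lra.
  have : 0 < e * Q m by rewrite mulr_gt0// energy_polarization_gt0.
  by lra.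
have [_ _ visc] := sol.
have := visc phi (charge_of_prob nu0) (horner p) Tm t0 mu0 cphi
  (smooth_halfline_horner p) (lt_le_trans t00 t0T) _ smin.
rewrite t00 t0T => /(_ isT)/=.
set u := fun x => U t0 x mu0.
have cu : C2_torus u by exact: (Bt_C2 mu0 bU (ltW t00)).
have be := elliptic_bmeas cu.
have bev := elliptic_bmeas cv.
set w := fun x => u x - phi x.
have cw : C2_torus w.
  have -> : w = fun y => u y + (-1) * phi y by apply/funext => y; rewrite /w; ring.
  exact: (C2_torusD cu (C2_torusZ (-1) cphi)).
have blw := lap_bmeas cw.
have btr := transport_bmeas HC1 cu cw.
rewrite (pairing_sub mu0 nu0 (source_bmeas mu0)) dpE.
rewrite /pairing_div /pairing_lap (pairing_prob mu0 btr) (pairing_prob mu0 blw).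
rewrite (pairing_sub mu0 nu0 be) opprK.
have b1 := bmeasB be btr.
have b2 := bmeasD b1 (bmeasZ sigma blw).
have := int_le mu0 b2 (bmeasD bev (bmeas_cst _ (2 * e * (B + sigma * d%:R))))
  (fun x => @elliptic_perturbation u v mu0 e B w x cu cv e0 (hB x) erefl).
rewrite (intD mu0 b1 (bmeasZ sigma blw)) (intB mu0 be btr) (intZ mu0 sigma blw).
rewrite (intD mu0 bev (bmeas_cst _ _)) int_cst.
rewrite -/(elliptic u); do !move: (Rintegral _ _ _) => ?; lra.
Qed.

End Viscosity.

Lemma continuousTD (X : topologicalType) (R : realType) (f g : X -> R) :
  continuous f -> continuous g -> continuous (fun x => f x + g x).
Proof. by move=> cf cg x; exact: (cvgD (cf x) (cg x)). Qed.

Lemma continuousTB (X : topologicalType) (R : realType) (f g : X -> R) :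
  continuous f -> continuous g -> continuous (fun x => f x - g x).
Proof. by move=> cf cg x; exact: (cvgB (cf x) (cg x)). Qed.

Lemma continuousTM (X : topologicalType) (R : realType) (f g : X -> R) :
  continuous f -> continuous g -> continuous (fun x => f x * g x).
Proof. by move=> cf cg x; exact: (cvgM (cf x) (cg x)). Qed.

(** * Doubling of variables *)

Section Doubling.
Variables (R : realType) (d : nat).
Local Notation T := (torus R d).
Local Notation P := (prob R d).
Implicit Types (U V : R -> T -> P -> R) (t s : R) (mu nu : P).

(** The four integrals are kept apart so that continuity and bounds can be proved for each;
    [doubledE] recovers the pairing. *)
Definition doubled U V t s mu nu : R :=
  (\int[mu]_x U t x mu - \int[nu]_x U t x mu) - (\int[mu]_x V s x nu - \int[nu]_x V s x nu).

Lemma doubledE U V t s mu nu : Bt U -> Bt V -> 0 <= t -> 0 <= s ->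
  doubled U V t s mu nu =
  \int[mu]_x (U t x mu - V s x nu) - \int[nu]_x (U t x mu - V s x nu).
Proof.
move=> bU bV t0 s0; have bu := Bt_bmeas mu bU t0; have bv := Bt_bmeas nu bV s0.
rewrite (intB mu bu bv) (intB nu bu bv) /doubled.
by do !move: (Rintegral _ _ _) => ?; ring.
Qed.

Lemma doubled_sym U V t s mu nu : doubled V U s t nu mu = doubled U V t s mu nu.
Proof. by rewrite /doubled; do !move: (Rintegral _ _ _) => ?; ring. Qed.

Lemma doubled_continuous U V : Bt U -> Bt V ->
  continuous (fun z : (R * R) * (P * P) =>
    doubled (extend0 U) (extend0 V) z.1.1 z.1.2 z.2.1 z.2.2).
Proof.
move=> bU bV.
have cK (W : R -> T -> P -> R) (a : (R * R) * (P * P) -> R) (b c : (R * R) * (P * P) -> P) :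
    Bt W -> continuous a -> continuous b -> continuous c ->
    continuous (fun z => \int[c z]_x extend0 W (a z) x (b z)).
  move=> bW ca cb cc.
  apply: (@continuous_compT _ _ _ (fun z => (a z, b z, c z))
    (fun z : R * P * P => \int[z.2]_x extend0 W z.1.1 x z.1.2)).
    by apply: continuous_pair => //; exact: continuous_pair.
  exact: int_extend0_continuous.
have c11 : continuous (fun z : (R * R) * (P * P) => z.1.1).
  exact: (continuous_compT (@continuous_fst _ _) (@continuous_fst _ _)).
have c12 : continuous (fun z : (R * R) * (P * P) => z.1.2).
  exact: (continuous_compT (@continuous_fst _ _) (@continuous_snd _ _)).
have c21 : continuous (fun z : (R * R) * (P * P) => z.2.1).
  exact: (continuous_compT (@continuous_snd _ _) (@continuous_fst _ _)).
have c22 : continuous (fun z : (R * R) * (P * P) => z.2.2).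
  exact: (continuous_compT (@continuous_snd _ _) (@continuous_snd _ _)).
by apply: continuousTB; apply: continuousTB; exact: cK.
Qed.

Lemma doubled_bound U V (M N : R) t s mu nu : Bt U -> Bt V -> 0 <= t -> 0 <= s ->
  (forall x, `|U t x mu| <= M) -> (forall x, `|V s x nu| <= N) ->
  - (2 * M + 2 * N) <= doubled U V t s mu nu.
Proof.
move=> bU bV t0 s0 UM VN.
have bu := Bt_bmeas mu bU t0; have bv := Bt_bmeas nu bV s0.
have := int_norm_le mu bu UM; have := int_norm_le nu bu UM.
have := int_norm_le mu bv VN; have := int_norm_le nu bv VN.
rewrite /doubled; do !move: (Rintegral _ _ _) => ?.
by rewrite !ler_norml => /andP[? ?] /andP[? ?] /andP[? ?] /andP[? ?]; lra.
Qed.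

Lemma doubled_near0 U V (a : R) t s mu nu : Bt U -> Bt V -> 0 <= t -> 0 <= s ->
  (forall x, `|U t x mu - U 0 x mu| <= a) -> (forall x, `|V s x nu - V 0 x nu| <= a) ->
  doubled U V 0 0 mu nu - 4 * a <= doubled U V t s mu nu.
Proof.
move=> bU bV t0 s0 Ua Va.
have bu := Bt_bmeas mu bU t0; have bv := Bt_bmeas nu bV s0.
have bu0 := Bt_bmeas mu bU (lexx 0); have bv0 := Bt_bmeas nu bV (lexx 0).
have := int_dist_le mu bu bu0 Ua; have := int_dist_le nu bu bu0 Ua.
have := int_dist_le mu bv bv0 Va; have := int_dist_le nu bv bv0 Va.
rewrite /doubled; do !move: (Rintegral _ _ _) => ?.
by rewrite !ler_norml => /andP[? ?] /andP[? ?] /andP[? ?] /andP[? ?]; lra.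
Qed.

Lemma monotone_dual_doubled (g : T -> P -> R) U V t s : Bt U -> Bt V -> 0 <= t -> 0 <= s ->
  (forall x m, U t x m = g x m) -> (forall x m, V s x m = g x m) -> monotone_dual g ->
  forall mu nu, 0 <= doubled U V t s mu nu.
Proof.
move=> bU bV t0 s0 Ug Vg gm mu nu; have := gm mu nu.
have bu := Bt_bmeas mu bU t0; have bv := Bt_bmeas nu bV s0.
have -> : (fun x => g x mu - g x nu) = (fun x => U t x mu - V s x nu).
  by apply/funext => x; rewrite Ug Vg.
by rewrite (pairing_sub mu nu (bmeasB bu bv)) doubledE.
Qed.

Variables (sigma : R) (H : T -> 'rV[R]_d -> R) (f U0 : T -> P -> R).
Hypotheses (hsigma : 0 < sigma) (HC1 : hamiltonian_C1 H) (Hconvex : hamiltonian_convex H).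
Hypothesis fcont : continuous (fun z : T * P => f z.1 z.2).
Hypotheses (fmono : monotone_dual f) (U0mono : monotone_dual U0).

(** In the sum of the two inequalities the elliptic terms and the derivatives of the penalty cancel,
    and the source terms add up to the pairing of [f], which is nonnegative. Two drifts [g] and two
    errors [2 e (B + sigma d)] remain. *)
Lemma doubled_min_contra U V (Tm t0 s0 e g k B : R) mu0 nu0 :
  monotone_solution sigma H f U0 U -> monotone_solution sigma H f U0 V ->
  0 < t0 <= Tm -> 0 < s0 <= Tm -> 0 < e ->
  (forall x, \sum_i `|DpH H x (grad (fun y => U t0 y mu0) x) ord0 i| <= B) ->
  (forall x, \sum_i `|DpH H x (grad (fun y => V s0 y nu0) x) ord0 i| <= B) ->
  let Phi (t s : R) (mu nu : P) := doubled U V t s mu nu + g * (t + s) + k * (t - s) ^+ 2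
     - e * (energy mu + energy nu) in
  (forall t s mu nu, 0 <= t <= Tm -> 0 <= s <= Tm -> Phi t0 s0 mu0 nu0 <= Phi t s mu nu) ->
  2 * g <= 4 * e * (B + sigma * d%:R).
Proof.
move=> solU solV t0T s0T e0 UB VB Phi Phimin.
have [bU _ _] := solU; have [bV _ _] := solV.
have t00 : 0 <= t0 by have /andP[/ltW] := t0T.
have s00 : 0 <= s0 by have /andP[/ltW] := s0T.
have t0T' : 0 <= t0 <= Tm by have /andP[_ ->] := t0T; rewrite t00.
have s0T' : 0 <= s0 <= Tm by have /andP[_ ->] := s0T; rewrite s00.
have h1 := monotone_solution_at_min hsigma HC1 Hconvex fcont solU (s0 := s0) (g := g) (k := k)
  (nu0 := nu0) (Bt_C2 nu0 bV s00) t0T e0 UB.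
have h2 := monotone_solution_at_min hsigma HC1 Hconvex fcont solV (s0 := t0) (g := g) (k := k)
  (nu0 := mu0) (Bt_C2 mu0 bU t00) s0T e0 VB.
have {}h1 := h1 _; have {}h2 := h2 _.
have m1 (t : R) (m : P) : 0 <= t <= Tm -> 
  \int[mu0]_x (U t0 x mu0 - V s0 x nu0) - \int[nu0]_x (U t0 x mu0 - V s0 x nu0)
    + g * t0 + k * (t0 - s0) ^+ 2 - e * energy mu0 <=
  \int[m]_x (U t x m - V s0 x nu0) - \int[nu0]_x (U t x m - V s0 x nu0)
    + g * t + k * (t - s0) ^+ 2 - e * energy m.
  move=> tT; have := Phimin t s0 m nu0 tT s0T'.
  have /andP[tp _] := tT.
  rewrite /Phi !doubledE//; do !move: (Rintegral _ _ _) => ?.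
  by move: (energy _) (energy _) (energy _) (_ ^+ 2) (_ ^+ 2) => ? ? ? ? ?; lra.
have m2 (s : R) (n : P) : 0 <= s <= Tm -> 
  \int[nu0]_x (V s0 x nu0 - U t0 x mu0) - \int[mu0]_x (V s0 x nu0 - U t0 x mu0)
    + g * s0 + k * (s0 - t0) ^+ 2 - e * energy nu0 <=
  \int[n]_x (V s x n - U t0 x mu0) - \int[mu0]_x (V s x n - U t0 x mu0)
    + g * s + k * (s - t0) ^+ 2 - e * energy n.
  move=> sT; have := Phimin t0 s mu0 n t0T' sT.
  have /andP[sp _] := sT.
  rewrite /Phi -!(doubled_sym U V) !doubledE// -(sqrrN (t0 - s)) -(sqrrN (t0 - s0)) !opprB.
  do !move: (Rintegral _ _ _) => ?.
  by move: (energy _) (energy _) (energy _) (_ ^+ 2) (_ ^+ 2) => ? ? ? ? ?; lra.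
have {h1} := h1 m1; have {h2} := h2 m2.
have := fmono mu0 nu0.
have bf1 := source_bmeas fcont mu0; have bf2 := source_bmeas fcont nu0.
rewrite (pairing_sub mu0 nu0 (bmeasB bf1 bf2)) (intB mu0 bf1 bf2) (intB nu0 bf1 bf2).
by do !move: (Rintegral _ _ _) => ?; lra.
Qed.

Lemma doubled_ge0 U V t mu nu :
  monotone_solution sigma H f U0 U -> monotone_solution sigma H f U0 V ->
  0 <= t -> 0 <= doubled U V t t mu nu.
Proof.
move=> solU solV t0; rewrite leNgt; apply/negP => neg.
have [bU U0E _] := solU; have [bV V0E _] := solV.
have W00 := monotone_dual_doubled bU bV (lexx 0) (lexx 0) U0E V0E U0mono.
have tp : 0 < t.
  rewrite lt_neqAle t0 andbT; apply/eqP => t00; move: neg; rewrite -t00.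
  by rewrite ltNge W00.
(* A third of the deficit: the drift adds [delta] at the starting point, so the minimum is at most
   [-2 delta], and every lower bound derived below stays above that. *)
pose delta := - doubled U V t t mu nu / 3.
have dE : doubled U V t t mu nu = - (3 * delta) by rewrite /delta; field.
have dp : 0 < delta by rewrite /delta divr_gt0// oppr_gt0.
pose g := delta / (2 * t).
have gp : 0 < g by rewrite divr_gt0// mulr_gt0.
have gE : g * (t + t) = delta by rewrite /g; field; rewrite gt_eqF.
have [M M0 UM] := Bt_bounds bU tp; have [N N0 VN] := Bt_bounds bV tp.
have [B1 B10 B1P] := DpH_bounded HC1 M0; have [B2 B20 B2P] := DpH_bounded HC1 N0.
pose D := B1 + B2 + sigma * d%:R.
have D0 : 0 <= D by rewrite !addr_ge0// mulr_ge0// ltW.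
(* The first bound limits the energy term to [delta / 4], each energy being at most 1; the second
   makes [4 e D] smaller than [2 g], against [doubled_min_contra]. *)
pose e := Num.min (delta / 8) (g / (4 * (D + 1))).
have D1 : 0 < 4 * (D + 1) by rewrite mulr_gt0// ltr_wpDl.
have ep : 0 < e by rewrite lt_min; apply/andP; split; apply: divr_gt0 => //; lra.
have e1 : e <= delta / 8 by rewrite ge_min lexx.
have e2 : e * (4 * (D + 1)) <= g by rewrite -ler_pdivlMr// ge_min lexx orbT.
have d8 : 0 < delta / 8 by rewrite divr_gt0.
have [eta1 eta10 eta1P] := Bt_uniform0 bU d8.
have [eta2 eta20 eta2P] := Bt_uniform0 bV d8.
pose eta := Num.min eta1 eta2.
have etap : 0 < eta by rewrite lt_min eta10.
(* For times at distance at least [eta] the penalty outweighs the lower bound [-(2 M + 2 N)] of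
   [doubled], and the functional is too large for a minimum. *)
pose k := (2 * M + 2 * N + 1) / eta ^+ 2.
have kE : k * eta ^+ 2 = 2 * M + 2 * N + 1 by rewrite /k divfK// expf_neq0 ?gt_eqF.
have kp : 0 < k by rewrite divr_gt0// ?exprn_gt0// ltr_wpDl// addr_ge0// mulr_ge0.
pose F (z : (R * R) * (P * P)) := doubled (extend0 U) (extend0 V) z.1.1 z.1.2 z.2.1 z.2.2
  + g * (z.1.1 + z.1.2) + k * (z.1.1 - z.1.2) ^+ 2 - e * (energy z.2.1 + energy z.2.2).
have cF : continuous F.
  have c11 : continuous (fun z : (R * R) * (P * P) => z.1.1).
    exact: (continuous_compT (@continuous_fst _ _) (@continuous_fst _ _)).
  have c12 : continuous (fun z : (R * R) * (P * P) => z.1.2).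
    exact: (continuous_compT (@continuous_fst _ _) (@continuous_snd _ _)).
  have c21 : continuous (fun z : (R * R) * (P * P) => energy z.2.1).
    apply: (@continuous_compT _ _ _ (fun z : (R * R) * (P * P) => z.2.1) (@energy R d)).
      exact: (continuous_compT (@continuous_snd _ _) (@continuous_fst _ _)).
    exact: energy_continuous.
  have c22 : continuous (fun z : (R * R) * (P * P) => energy z.2.2).
    apply: (@continuous_compT _ _ _ (fun z : (R * R) * (P * P) => z.2.2) (@energy R d)).
      exact: (continuous_compT (@continuous_snd _ _) (@continuous_snd _ _)).
    exact: energy_continuous.
  have cc (r : R) : continuous (fun z : (R * R) * (P * P) => r) by move=> z; exact: cst_continuous.
  apply: continuousTB; last by apply: continuousTM => //; exact: continuousTD.
  apply: continuousTD; last first.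
    by apply: continuousTM => //; apply: continuousTM; exact: continuousTB.
  apply: continuousTD; first exact: doubled_continuous.
  by apply: continuousTM => //; exact: continuousTD.
have FE t' s' m n : 0 <= t' -> 0 <= s' -> F ((t', s'), (m, n)) =
    doubled U V t' s' m n + g * (t' + s') + k * (t' - s') ^+ 2 - e * (energy m + energy n).
  by move=> t'0 s'0; rewrite /F/= /doubled !extend0E.
pose K : set ((R * R) * (P * P)) := (`[0, t]%classic `*` `[0, t]%classic) `*` [set: P * P].
have cK : compact K.
  apply: compact_setX; first by apply: compact_setX; exact: segment_compact.
  by rewrite -setXTT; apply: compact_setX; exact: prob_compact.
have Kt : K ((t, t), (mu, nu)) by split => //; split; rewrite /= in_itv/= lexx t0.
have K0 : K !=set0 by exists ((t, t), (mu, nu)).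
have [[[t1 s1] [m1 n1]] Kz zmin] := compact_EVT_min K0 cK (continuous_subspaceT cF).
have [t1T s1T] : 0 <= t1 <= t /\ 0 <= s1 <= t.
  by move: Kz; rewrite inE => -[[]]; rewrite /= !in_itv/=.
have [/andP[t10 _] /andP[s10 _]] := (t1T, s1T).
have Fmin t' s' m n : 0 <= t' <= t -> 0 <= s' <= t -> F ((t1, s1), (m1, n1)) <= F ((t', s'), (m, n)).
  by move=> h1 h2; apply: zmin; rewrite inE; split => //; split; rewrite /= in_itv.
have tT : 0 <= t <= t by rewrite t0 lexx.
have := Fmin t t mu nu tT tT.
rewrite !FE// subrr expr0n/= mulr0 addr0 gE dE => Fle.
have [Em En] := (energy_ge0 mu, energy_ge0 nu).
have eE : 0 <= e * (energy mu + energy nu) by rewrite mulr_ge0 ?addr_ge0// ltW.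
have eE1 : e * (energy m1 + energy n1) <= delta / 4.
  apply: (@le_trans _ _ (e * 2)); last by clear -e1; lra.
  rewrite ler_wpM2l ?(ltW ep)//.
  exact: (lerD (energy_le1 m1) (energy_le1 n1)).
have gts : 0 <= g * (t1 + s1) by rewrite mulr_ge0 ?addr_ge0// ltW.
have Wb := doubled_bound bU bV t10 s10 (fun x => (UM t1 x m1 t1T).1) (fun x => (VN s1 x n1 s1T).1).
have close : `|t1 - s1| < eta.
  rewrite ltNge; apply/negP => far.
  have : eta ^+ 2 <= (t1 - s1) ^+ 2.
    by rewrite -[leRHS]real_normK ?num_real// lerXn2r// ?nnegrE// ltW.
  rewrite -(ler_pM2l kp) kE; move: (doubled _ _ t1 _ _ _) Fle Wb => W Fle Wb.
  by clear -Fle Wb eE eE1 gts dp; lra.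
have kts : 0 <= k * (t1 - s1) ^+ 2 by rewrite mulr_ge0 ?sqr_ge0// ltW.
(* If both times were below [eta], replacing them by 0 would change [doubled] by at most
   [delta / 2], and monotonicity of [U0] would contradict the value of the minimum. One time thus
   reaches [eta], and [close] makes the other positive. *)
have big : eta <= t1 \/ eta <= s1.
  have [|tl] := leP eta t1; first by left.
  have [|sl] := leP eta s1; first by right.
  move: tl sl; rewrite !lt_min => /andP[tl1 _] /andP[_ sl2].
  have h1 x : `|U t1 x m1 - U 0 x m1| <= delta / 8 by apply: eta1P; rewrite t10.
  have h2 x : `|V s1 x n1 - V 0 x n1| <= delta / 8 by apply: eta2P; rewrite s10.
  have := doubled_near0 bU bV t10 s10 h1 h2.
  have := W00 m1 n1; move: (doubled _ _ 0 _ _ _) (doubled _ _ t1 _ _ _) Fle => W0 W Fle.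
  by clear -Fle eE eE1 gts kts dp; lra.
move: close; rewrite ltr_norml => /andP[cl1 cl2].
have t1p : 0 < t1 by clear -big cl1 cl2 t10 s10 etap; case: big; lra.
have s1p : 0 < s1 by clear -big cl1 cl2 t10 s10 etap; case: big; lra.
have t1T' : 0 < t1 <= t by have /andP[_ ->] := t1T; rewrite t1p.
have s1T' : 0 < s1 <= t by have /andP[_ ->] := s1T; rewrite s1p.
have UB x : \sum_i `|DpH H x (grad (fun y => U t1 y m1) x) ord0 i| <= B1 + B2.
  apply: (@le_trans _ _ B1); last by rewrite lerDl.
  by apply: B1P => i; rewrite mxE; have [_] := UM t1 x m1 t1T; apply.
have VB x : \sum_i `|DpH H x (grad (fun y => V s1 y n1) x) ord0 i| <= B1 + B2.
  apply: (@le_trans _ _ B2); last by rewrite lerDr.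
  by apply: B2P => i; rewrite mxE; have [_] := VN s1 x n1 s1T; apply.
have := doubled_min_contra solU solV t1T' s1T' ep UB VB (g := g) (k := k).
rewrite -/D => /= h.
have : 2 * g <= 4 * e * D.
  apply: h => t' s' m n t'T s'T; have [/andP[t'0 _] /andP[s'0 _]] := (t'T, s'T).
  by rewrite -!FE//; exact: Fmin.
have : 0 <= e by exact: ltW.
move: e2; rewrite mulrCA mulrDr mulr1 -[4 * e * D]mulrA.
by move: (e * D) => eD; clear -gp; lra.
Qed.

End Doubling.

(** * Convex combinations of measures and independence of the difference from [x] *)

Lemma probability_mixture d (T : measurableType d) (R : realType) (m n : probability T R) (e : R) :
  0 <= e <= 1 -> exists q : probability T R, forall g, bmeas g ->
    \int[q]_x g x = (1 - e) * \int[m]_x g x + e * \int[n]_x g x.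
Proof.
move=> /andP[e0 e1]; have e1' : 0 <= 1 - e by rewrite subr_ge0.
pose m1 : {measure set T -> \bar R} := mscale (NngNum e1') m.
pose n1 : {measure set T -> \bar R} := mscale (NngNum e0) n.
pose s : {measure set T -> \bar R} := measure_add m1 n1.
have m1T : m1 setT = (1 - e)%:E by rewrite /m1/= /mscale/= probability_setT mule1.
have n1T : n1 setT = e%:E by rewrite /n1/= /mscale/= probability_setT mule1.
have sT : s setT = 1%E.
  transitivity (m1 setT + n1 setT)%E; first exact: measure_addE.
  by rewrite m1T n1T -EFinD subrK.
(* Normalising supplies the probability structure and changes nothing, since [s] already has mass 1;
   [m] is the default value for degenerate masses. *)
pose q : probability T R := mnormalize s m.
have qE A : q A = s A.
  by rewrite /q/= /mnormalize/= sT onee_eq0/= invr1 mule1.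
have q0 g : bmeas g -> (forall x, 0 <= g x) ->
    \int[q]_x g x = (1 - e) * \int[m]_x g x + e * \int[n]_x g x.
  move=> bg g0; have mg : measurable_fun [set: T] (EFin \o g).
    by apply/measurable_EFinP; case: bg.
  have gE0 x : [set: T] x -> (0 <= (EFin \o g) x)%E by move=> _; rewrite lee_fin.
  have fin (r : probability T R) : (\int[r]_x (g x)%:E)%E \is a fin_num.
    by apply: integrable_fin_num => //; exact: (bmeas_integrable (prob_setT_lty r) bg).
  have -> : \int[q]_x g x = \int[s]_x g x.
    by congr fine; apply: eq_measure_integral => A _ _; exact: qE.
  have sE := @ge0_integral_measure_add _ T R m1 n1 setT measurableT _ gE0 mg.
  have m1E := @ge0_integral_mscale _ T R m setT measurableT (NngNum e1') _ mg gE0.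
  have n1E := @ge0_integral_mscale _ T R n setT measurableT (NngNum e0) _ mg gE0.
  rewrite /Rintegral [X in fine X]sE [X in fine (X + _)]m1E [X in fine (_ + X)]n1E /=.
  by rewrite fineD ?fin_numM// !fineM.
(* Adding the bound [M] of [g] reduces to a nonnegative integrand. *)
exists q => g bg; have [_ [M gM]] := bg.
have bM := bmeas_cst T M.
have gM0 x : 0 <= g x + M by have := gM x; rewrite ler_norml => /andP[]; lra.
have := q0 _ (bmeasD bg bM) gM0; rewrite !(intD _ bg bM) !int_cst.
by do !move: (Rintegral _ _ _) => ?; lra.
Qed.

Section Uniqueness.
Variables (R : realType) (d : nat).
Local Notation T := (torus R d).
Local Notation P := (prob R d).

Lemma int_torus_dirac (x : T) (g : T -> R) : bmeas (g : btorus R d -> R) ->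
  \int[(dirac (x : btorus R d) : P)]_y g y = g x.
Proof.
move=> [mg _]; rewrite /Rintegral integral_dirac//=; last exact/measurable_EFinP.
by rewrite indicE in_setT mul1r.
Qed.

Lemma mixture_near (m : P) (x : T) (r : R) : 0 < r ->
  exists (e : R) (q : P), [/\ 0 < e, prob_ball m r q &
    forall g : T -> R, bmeas (g : btorus R d -> R) ->
      \int[q]_y g y = (1 - e) * \int[m]_y g y + e * g x].
Proof.
(* The mixture lies within [e d] of [m]; this choice gives [e <= 1] and [e d < r] for every positive
   [r]. *)
move=> r0; pose e := r / (d%:R + 1 + r).
have D0 : 0 < d%:R + 1 + r by rewrite addr_gt0// ltr_wpDl.
have e0 : 0 < e by rewrite divr_gt0.
have e1 : e <= 1 by rewrite ler_pdivrMr// mul1r lerDr addr_ge0.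
have ed : e * d%:R < r.
  rewrite /e mulrAC ltr_pdivrMr// ltr_pM2l//.
  by rewrite -addrA ltrDl addr_gt0.
have e01 : 0 <= e <= 1 by rewrite e1 ltW.
have [q qE] := @probability_mixture _ (btorus R d) R m (dirac (x : btorus R d)) e e01.
exists e, q; split => //; last first.
  by move=> g bg; rewrite qE// int_torus_dirac.
apply: (@le_lt_trans _ _ (e * d%:R)%:E); last by rewrite lte_fin.
apply: ge_ereal_sup => _ [phi lphi <-]; rewrite lee_fin.
have bphi : bmeas (phi : btorus R d -> R).
  by apply: continuous_bmeas; apply: (@lipschitz_continuous _ _ _ 1) => a b; rewrite mul1r.
rewrite qE// int_torus_dirac//.
have : `|\int[m]_y phi y - phi x| <= d%:R.
  rewrite -[X in _ - X](int_cst m (phi x)); apply: (int_dist_le m bphi (bmeas_cst _ _)) => y.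
  by rewrite (le_trans (lphi _ _))// torus_dist_bound.
rewrite ler_norml => /andP[_ h].
have := ler_wpM2l (ltW e0) h.
by move: (Rintegral _ _ _) (phi x) => a b; lra.
Qed.

Variables (sigma : R) (H : T -> 'rV[R]_d -> R) (f U0 : T -> P -> R).
Hypotheses (hsigma : 0 < sigma) (HC1 : hamiltonian_C1 H) (Hconvex : hamiltonian_convex H).
Hypothesis fcont : continuous (fun z : T * P => f z.1 z.2).
Hypotheses (fmono : monotone_dual f) (U0mono : monotone_dual U0).

(** Since [q - m] is [e] times the difference of the Dirac mass at [x] and [m], the pairing given by
    [doubled_ge0] is linear in [e]. This factor is divided out first; only then is [U t y q]
    replaced by [U t y m], uniformly in [y]. *)
Lemma monotone_solution_diff_ge (U V : R -> T -> P -> R) (t : R) (x : T) (m : P) :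
  monotone_solution sigma H f U0 U -> monotone_solution sigma H f U0 V -> 0 <= t ->
  \int[m]_y U t y m - \int[m]_y V t y m <= U t x m - V t x m.
Proof.
move=> solU solV t0; have [bU _ _] := solU; have [bV _ _] := solV.
apply/ler_addgt0Pr => a a0; have a2 : 0 < a / 2 by rewrite divr_gt0.
pose F (z : T * P) := extend0 U t z.1 z.2.
have cF : continuous F.
  apply: (@continuous_compT _ _ _ (fun z : T * P => ((t, z.1), z.2))
    (fun z : R * T * P => extend0 U z.1.1 z.1.2 z.2)); last exact: extend0_continuous.
  apply: continuous_pair; last exact: continuous_snd.
  apply: continuous_pair; last exact: continuous_fst.
  by move=> z; exact: cst_continuous.
have /nbhs_ballP[r /= r0 rP] := compact_uniform_near m (@torus_compact R d) cF a2.
have [e [q [e0 mq qE]]] := mixture_near m x r0.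
have Uq y : `|U t y q - U t y m| <= a / 2 by have := rP q mq y; rewrite /F/= !extend0E.
have bq := Bt_bmeas q bU t0; have bm := Bt_bmeas m bU t0; have bv := Bt_bmeas m bV t0.
have := doubled_ge0 hsigma HC1 Hconvex fcont fmono U0mono q m solU solV t0.
have := int_dist_le m bq bm Uq; have := Uq x.
rewrite /doubled !qE// !ler_norml => /andP[h1 h2] /andP[h3 h4] h5.
have {}h5 : 0 <= e * ((U t x q - \int[m]_y U t y q) - (V t x m - \int[m]_y V t y m)).
  by move: h5; do !move: (Rintegral _ _ _) => ?; move: (U t x q) (V t x m) => ? ?; lra.
rewrite pmulr_rge0// in h5.
move: h1 h2 h3 h4 h5; do !move: (Rintegral _ _ _) => ?.
by move: (U t x q) (U t x m) (V t x m) => ? ? ?; lra.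
Qed.

End Uniqueness.

Theorem theorem3p4 (R : realType) (d : nat) (sigma : R)
    (H : torus R d -> 'rV[R]_d -> R) (f U0 : torus R d -> prob R d -> R)
    (hd : (1 < d)%N) (hsigma : 0 < sigma)
    (HC1 : hamiltonian_C1 H) (Hconvex : hamiltonian_convex H)
    (fcont : continuous (fun z : torus R d * prob R d => f z.1 z.2))
    (U0cont : continuous (fun z : torus R d * prob R d => U0 z.1 z.2))
    (fmono : monotone_dual f) (U0mono : monotone_dual U0) :
  (forall U V : R -> torus R d -> prob R d -> R,
     monotone_solution sigma H f U0 U -> monotone_solution sigma H f U0 V ->
     exists c : R -> prob R d -> R,
       forall (t : R) (x : torus R d) (m : prob R d), 
         0 <= t -> U t x m = V t x m + c t m) /\
  (forall U : R -> torus R d -> prob R d -> R,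
     monotone_solution sigma H f U0 U ->
     forall t : R, 0 <= t -> monotone_dual (U t)).
Proof.
split=> [U V solU solV|U solU t t0 mu nu].
  (* A lower bound by the mean against [m], valid for [U - V] and for [V - U], forces the difference
     to equal its mean. *)
  exists (fun (t : R) (m : prob R d) => \int[m]_y U t y m - \int[m]_y V t y m) => t x m t0.
  have := monotone_solution_diff_ge hsigma HC1 Hconvex fcont fmono U0mono x m solU solV t0.
  have := monotone_solution_diff_ge hsigma HC1 Hconvex fcont fmono U0mono x m solV solU t0.
  do !move: (Rintegral _ _ _) => ?.
  by move: (U t x m) (V t x m) => u v h1 h2; apply/eqP; rewrite eq_le; apply/andP; split; lra.
(* Monotonicity is the comparison of [U] with itself. *)
have [bU _ _] := solU.
have bmu := Bt_bmeas mu bU t0; have bnu := Bt_bmeas nu bU t0.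
rewrite (pairing_sub mu nu (bmeasB bmu bnu)) -doubledE//.
exact: (doubled_ge0 hsigma HC1 Hconvex fcont fmono U0mono mu nu solU solU t0).
Qed.
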